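(* Let $n\ge 2$, $p>1$, $q>0$ and $Q\in\mathcal{S}^n_{(o)}$, and let $\mu$ be a discrete measure on $S^{n-1}$ that is not concentrated on any closed hemisphere. Then there exists a polytope $P\in\mathcal{K}^n_{(o)}$ such that $\widetilde{V}_q(P,Q)^{-1}\,\widetilde{C}_{p,q}(P,Q,\cdot)=\mu$.
   Context: $S^{n-1}$ is the unit sphere of $\mathbb{R}^n$, $o$ the origin, $\mathcal{H}^{k}$ the $k$-dimensional Hausdorff measure. A discrete measure on $S^{n-1}$ is a finite positive Borel measure with finite support. $\mathcal{K}^n_{(o)}$ is the family of convex bodies (compact convex sets with non-empty interior) in $\mathbb{R}^n$ containing $o$ in their interior. A polytope is the convex hull of finitely many points, with non-empty interior. $\mathcal{S}^n_{(o)}$ is the family of compact sets $Q\subset\mathbb{R}^n$ that are star shaped with respect to $o$ and contain $o$ in their interior; their radial functions are assumed continuous. The radial function is $\varrho_S(u)=\max\{t\ge 0: tu\in S\}$, $u\in S^{n-1}$. The support function is $h_K(u)=\max_{x\in K}\langle x,u\rangle$, and $F(K,u)=\{x\in K:\langle x,u\rangle=h_K(u)\}$. For a Borel set $\eta\subset S^{n-1}$, $\alpha_K^*(\eta)=\{u\in S^{n-1}:\varrho_K(u)u\in F(K,v)\text{ for some }v\in\eta\}$. Define $$\widetilde{C}_q(K,Q,\eta)=\frac1n\int_{\alpha_K^*(\eta)}\varrho_K^q\varrho_Q^{n-q}\,d\mathcal{H}^{n-1},\qquad \widetilde{V}_q(K,Q)=\frac1n\int_{S^{n-1}}\varrho_K^q\varrho_Q^{n-q}\,d\mathcal{H}^{n-1},$$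 and, for $K\in\mathcal{K}^n_{(o)}$, $d\widetilde{C}_{p,q}(K,Q,\cdot)=h_K^{-p}\,d\widetilde{C}_q(K,Q,\cdot)$. *)

(* Defs.v *)
From HB Require Import structures.
From mathcomp Require Import all_boot all_order all_algebra.
From mathcomp Require Import all_classical all_reals all_analysis.

Set Implicit Arguments.
Unset Strict Implicit.
Unset Printing Implicit Defensive.

Import Order.TTheory GRing.Theory Num.Theory.
Import numFieldNormedType.Exports.

Local Open Scope classical_set_scope.
Local Open Scope ring_scope.

(* Points of R^n are row vectors. The library norm on ['rV[R]_n] is the sup
   norm: it gives the usual topology, but metric notions (sphere, diameter)
   must go through [enorm]. *)
Section euclidean.
Context {R : realType} {n : nat}.
Implicit Types (u v x : 'rV[R]_n) (A : set 'rV[R]_n).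

Definition dot u v : R := \sum_(i < n) u ord0 i * v ord0 i.

Definition enorm u : R := Num.sqrt (dot u u).

Definition sphere : set 'rV[R]_n := [set u | enorm u = 1].

(* [-oo] on the empty set *)
Definition diam A : \bar R :=
  ereal_sup [set (enorm (x.1 - x.2))%:E | x in A `*` A].

End euclidean.
Arguments sphere : clear implicits.

(* Volume of the unit ball of R^k: pi^(k/2) / Gamma(k/2 + 1), computed by
   omega_k = (2 pi / k) omega_(k-2). *)
Fixpoint ball_volume (R : realType) (k : nat) : R :=
  match k with
  | 0%N => 1
  | 1%N => 2
  | k'.+2 => 2 * pi / k'.+2%:R * ball_volume R k'
  end.

Lemma ball_volume_ge0 (R : realType) k : 0 <= ball_volume R k.
Proof.
suff : 0 <= ball_volume R k /\ 0 <= ball_volume R k.+1 by case.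
elim: k => [|k [k0 k1]]; first by split.
split => //=; apply: mulr_ge0 => //; apply: divr_ge0 => //.
by rewrite mulr_ge0// pi_ge0.
Qed.

Section hausdorff.
Local Open Scope ereal_scope.
Context {R : realType} {n : nat}.
Variable k : nat.
Implicit Types (A E : set 'rV[R]_n) (F : (set 'rV[R]_n)^nat).

(* With the factor omega_k / 2^k, the measure H^k agrees with k-dimensional
   volume. The test for [set0] only matters for k = 0. *)
Definition hausdorff_gauge E : \bar R :=
  if E == set0 then 0
  else (ball_volume R k)%:E * ((2^-1)%:E * diam E) ^+ k.

Definition delta_cover (delta : R) A : set ((set 'rV[R]_n)^nat) :=
  [set F | (forall i, diam (F i) <= delta%:E) /\ A `<=` \bigcup_i F i].

Definition hausdorff_delta (delta : R) A : \bar R :=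
  ereal_inf [set \sum_(i <oo) hausdorff_gauge (F i) | F in delta_cover delta A].

Definition hausdorff A : \bar R :=
  ereal_sup [set hausdorff_delta delta A | delta in [set d : R | (0 < d)%R]].

Lemma diam0 : diam (set0 : set 'rV[R]_n) = -oo.
Proof. by rewrite /diam set0X image_set0 ereal_sup0. Qed.

Lemma hausdorff_gauge0 : hausdorff_gauge set0 = 0.
Proof. by rewrite /hausdorff_gauge eqxx. Qed.

Lemma hausdorff_gauge_ge0 E : 0 <= hausdorff_gauge E.
Proof.
rewrite /hausdorff_gauge; case: ifPn => // /set0P[x Ex].
rewrite mule_ge0 ?lee_fin ?ball_volume_ge0// expe_ge0// mule_ge0 ?lee_fin//.
apply: (@le_trans _ _ (enorm (x - x))%:E); first by rewrite lee_fin sqrtr_ge0.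
by apply: ereal_sup_ubound; exists (x, x).
Qed.

Lemma hausdorff_delta_ge0 delta A : 0 <= hausdorff_delta delta A.
Proof.
apply: le_ereal_inf_tmp => _ [F _ <-].
by apply: nneseries_ge0 => i _ _; exact: hausdorff_gauge_ge0.
Qed.

Lemma hausdorff_delta0 delta : hausdorff_delta delta set0 = 0.
Proof.
apply/eqP; rewrite eq_le hausdorff_delta_ge0 andbT.
apply: ereal_inf_lbound; exists (fun=> set0).
  by split=> [i|//]; rewrite diam0 leNye.
by rewrite eseries0// => i _ _; rewrite hausdorff_gauge0.
Qed.

Lemma le_hausdorff_delta delta :
  {homo hausdorff_delta delta : A B / A `<=` B >-> A <= B}.
Proof.
move=> A B AB; apply/ereal_inf_le_tmp => _ [F [dF BF] <-].
by exists F => //; split => //; exact: subset_trans AB BF.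
Qed.

Lemma hausdorff_delta_sigma_subadditive delta :
  sigma_subadditive (hausdorff_delta delta).
Proof.
move=> A; have [[i ioo]|] := pselect (exists i, hausdorff_delta delta (A i) = +oo).
  rewrite (eseries_pinfty _ _ ioo) ?leey// => m _.
  by rewrite -ltNye (lt_le_trans _ (hausdorff_delta_ge0 _ _)).
rewrite -forallNE => Aoo.
apply/lee_addgt0Pr => _/posnumP[e].
rewrite (le_trans _ (epsilon_trick _ _ _))//; last first.
  by move=> m; exact: hausdorff_delta_ge0.
pose P m F := delta_cover delta (A m) F /\
  \sum_(j <oo) hausdorff_gauge (F j) <=
    hausdorff_delta delta (A m) + (e%:num / (2 ^ m.+1)%:R)%:E.
have [G PG] : {G : ((set 'rV[R]_n)^nat)^nat & forall m, P m (G m)}.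
  apply: (@choice _ _ P) => m.
  have fin : hausdorff_delta delta (A m) \is a fin_num.
    rewrite ge0_fin_numE ?hausdorff_delta_ge0// ltey; exact/eqP/Aoo.
  have em : (0 < e%:num / (2 ^ m.+1)%:R :> R)%R by [].
  have [_ [F cF <-] ltF] := lb_ereal_inf_adherent em fin.
  by exists F; split => //; exact/ltW.
pose g := hausdorff_gauge \o uncurry G.
have g0 x : 0 <= g x by exact: hausdorff_gauge_ge0.
apply: (@le_trans _ _ (\esum_(i in setT) g i)).
  apply: ereal_inf_lbound => /=.
  have /card_esym/ppcard_eqP[f] := card_nat2.
  exists (uncurry G \o f).
    split => [i|t [i _ Ait]].
      by rewrite /=; case: (f i) => a b; have [[dG _] _] := PG a; exact: dG.
    have [[_ /(_ _ Ait)[j _ Gijt]] _] := PG i.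
    by exists (f^-1%FUN (i, j)) => //=; rewrite invK ?inE.
  rewrite -(esum_pred_image g _ xpredT) ?[fun=> _]set_true//.
  by rewrite image_eq.
rewrite (_ : esum _ _ = \sum_(i <oo) \sum_(j <oo) hausdorff_gauge (G i j)); last first.
  pose J : nat -> set (nat * nat) := fun i => [set (i, j) | j in setT].
  rewrite (_ : setT = \bigcup_k J k); last first.
    by rewrite predeqE => -[a b]; split => // _; exists a => //; exists b.
  rewrite esum_bigcupT /=; last 2 first.
  - apply/trivIsetP => i j _ _ ij.
    rewrite predeqE => -[a b] /=; split => //= -[] [_] _ [<-{a} _].
    by move=> [m' _] [] /esym/eqP; rewrite (negbTE ij).
  - by move=> a; exact: g0.
  rewrite -(image_id [set: nat]) -fun_true esum_pred_image//; last first.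
    by move=> a _; exact: esum_ge0.
  apply: eq_eseriesr => /= j _.
  rewrite -(esum_pred_image g (pair j) predT)//=; last first.
    by move=> ? ? _ _; exact: (@can_inj _ _ _ snd).
  by congr esum; rewrite predeqE => -[a b]; split; move=> [i _ <-]; exists i.
apply: lee_nneseries => i _; last exact: (PG i).2.
by move=> *; apply: nneseries_ge0 => j *; exact: hausdorff_gauge_ge0.
Qed.

Let hausdorff0 : hausdorff set0 = 0.
Proof.
apply/eqP; rewrite eq_le; apply/andP; split.
  by apply: ge_ereal_sup => _ [d _ <-]; rewrite hausdorff_delta0.
by apply: ereal_sup_ubound; exists 1%R => //=; rewrite hausdorff_delta0.
Qed.

Let hausdorff_ge0 A : 0 <= hausdorff A.
Proof.
apply: (le_trans (hausdorff_delta_ge0 1 A)).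
by apply: ereal_sup_ubound; exists 1%R => /=.
Qed.

Let le_hausdorff : {homo hausdorff : A B / A `<=` B >-> A <= B}.
Proof.
move=> A B AB; apply: ge_ereal_sup => _ [d d0 <-].
apply: (le_trans (@le_hausdorff_delta d _ _ AB)).
by apply: ereal_sup_ubound; exists d.
Qed.

Let hausdorff_sigma_subadditive : sigma_subadditive hausdorff.
Proof.
move=> A; apply: ge_ereal_sup => _ [d d0 <-].
apply: (le_trans (hausdorff_delta_sigma_subadditive _ _)).
apply: lee_nneseries => i _; first by move=> _; exact: hausdorff_delta_ge0.
by apply: ereal_sup_ubound; exists d.
Qed.

HB.instance Definition _ := isOuterMeasure.Build R 'rV[R]_n hausdorff
  hausdorff0 hausdorff_ge0 le_hausdorff hausdorff_sigma_subadditive.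

Definition hausdorff_outer : {outer_measure set 'rV[R]_n -> \bar R} :=
  hausdorff.

(* H^k, on the sigma-algebra of its Caratheodory-measurable sets. These
   include the Borel sets, and also the sets [alpha_star K eta] below with K
   a convex body and [eta] Borel, which are a priori only analytic. *)
Definition hausdorff_measure :
  {measure set (caratheodory_type hausdorff_outer) -> \bar R} :=
  hausdorff_outer.

End hausdorff.
Arguments hausdorff_measure : clear implicits.

Notation borel_rV R n := (g_sigma_algebraType (@open 'rV[R]_n)).

Section convex_geometry.
Context {R : realType} {n : nat}.
Implicit Types (K P Q S : set 'rV[R]_n) (u v : 'rV[R]_n).

(* For the compact sets considered here, the two suprema are maxima. *)
Definition radial S u : R := sup [set t | 0 <= t /\ S (t *: u)].

Definition supportf K u : R := sup [set dot x u | x in K].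

Definition face K u : set 'rV[R]_n := [set x | K x /\ dot x u = supportf K u].

(* K^n_(o) *)
Definition convex_body_o K :=
  [/\ compact K, convex_set K & interior K 0].

(* S^n_(o) *)
Definition star_body_o Q :=
  [/\ compact Q,
      forall x t, Q x -> 0 <= t <= 1 -> Q (t *: x),
      interior Q 0 &
      {within sphere R n, continuous (radial Q)}].

Definition convex_hull (A : set 'rV[R]_n) : set 'rV[R]_n :=
  smallest (@convex_set R 'rV[R]_n) A.

Definition polytope P :=
  interior P !=set0 /\
  exists2 A : set 'rV[R]_n, finite_set A & P = convex_hull A.

Definition alpha_star K (eta : set 'rV[R]_n) : set 'rV[R]_n :=
  [set u | sphere R n u /\
     exists v, [/\ sphere R n v, eta v & face K v (radial K u *: u)]].

Local Open Scope ereal_scope.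

(* Borel measures on the sphere are Borel measures on R^n carried by the
   sphere; only [eta `&` sphere R n] counts in [dualC q K Q eta]. *)
Definition dualC (q : R) K Q (eta : set (borel_rV R n)) : \bar R :=
  (n%:R^-1)%:E * \int[hausdorff_measure R n n.-1]_(u in alpha_star K eta)
    (radial K u `^ q * radial Q u `^ (n%:R - q))%:E.

Definition dualV (q : R) K Q : \bar R :=
  (n%:R^-1)%:E * \int[hausdorff_measure R n n.-1]_(u in sphere R n)
    (radial K u `^ q * radial Q u `^ (n%:R - q))%:E.

(* [dualC q K Q] is a plain set function here; [integral] accepts one. *)
Definition dualC_pq (p q : R) K Q (eta : set (borel_rV R n)) : \bar R :=
  \int[dualC q K Q]_(v in eta) (supportf K v `^ (- p))%:E.

Definition measure_support (mu : {finite_measure set (borel_rV R n) -> \bar R})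
    : set 'rV[R]_n :=
  [set x | forall U : set 'rV[R]_n, open U -> U x -> 0 < mu U].

Definition discrete_on_sphere
    (mu : {finite_measure set (borel_rV R n) -> \bar R}) :=
  mu (~` sphere R n) = 0 /\ finite_set (measure_support mu).

Definition closed_hemisphere u : set 'rV[R]_n :=
  [set x | sphere R n x /\ (0 <= dot x u)%R].

Definition concentrated_on
    (mu : {finite_measure set (borel_rV R n) -> \bar R}) (A : set 'rV[R]_n) :=
  mu (~` A) = 0.

End convex_geometry.

(* Main.v *)
(* With u_1, ..., u_k the atoms of mu and alpha_i their masses, let
   P(z) = {x : <x, u_i> <= z_i for all i} for z >= 0, and let V(z) be the
   integral over the sphere of rho_P(z)^q rho_Q^(n-q). Maximize V on the compact
   set {z >= 0 : sum_i alpha_i z_i^p = 1}.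

   No coordinate of a maximizer z vanishes: raising the zero coordinates to t
   makes the radial function bounded below on the directions v with
   0 < max_(z_i = 0) <v, u_i> <= t, a set of measure at least c t, so V
   gains at order t, while the constraint only costs order t^p with p > 1.

   Shrinking z_i by the factor e^(-s) and letting s tend to 0 yields
   C_i >= alpha_i z_i^p V, where C_i is the integral over the directions that hit
   the facet with normal u_i. As the C_i sum up to V, as do the right-hand
   sides, equality holds for all i; up to a null set, alpha*(eta) is the union
   of these sets of directions over the u_i in eta. *)

From HB Require Import structures.
Require Import Defs.
From mathcomp Require Import all_boot all_order all_algebra.
From mathcomp Require Import all_classical all_reals all_analysis.
From mathcomp Require Import measurable_realfun.
From mathcomp Require Import ring lra zify.

Set Implicit Arguments.
Unset Strict Implicit.
Unset Printing Implicit Defensive.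

Import Order.TTheory GRing.Theory Num.Theory.
Import numFieldNormedType.Exports.

Local Open Scope classical_set_scope.
Local Open Scope ring_scope.

(** * Euclidean norm on row vectors *)

(** Once [z] is positive, its coordinates are only ever decreased, one at a time. So [V] is never
    differentiated, and only the upper half of its continuity is proved. No final rescaling is
    required either: as [h_P(u_i) = z_i], the normalised measure has mass [z_i^(-p) C_i / V] at
    [u_i], which is already [alpha_i].

    The body [Q] enters through the function [rho_Q^(n-q)], of which the argument uses positive
    bounds from both sides and measurability on the sphere.

    The obstacle is the Hausdorff measure, which is given by coverings and has to be handled without
    a formula for surface area. The argument is arranged so that constants do not matter: closed
    sets are measurable, the sphere has finite measure, great spheres are null, and the strips above
    have measure at least [c t]. These facts come from Lipschitz maps between pieces of the sphere
    and of hyperplanes, from translations, and from a count of grid points that stands in for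
    Lebesgue measure. *)

Section dot_enorm.
Context {R : realType} {n : nat}.
Implicit Types (x y z : 'rV[R]_n) (a : R).

Lemma dotC x y : dot x y = dot y x.
Proof. by apply: eq_bigr => i _; rewrite mulrC. Qed.

Lemma dotDl x y z : dot (x + y) z = dot x z + dot y z.
Proof. by rewrite /dot -big_split/=; apply: eq_bigr => i _; rewrite mxE mulrDl. Qed.

Lemma dotZl a x y : dot (a *: x) y = a * dot x y.
Proof. by rewrite /dot mulr_sumr; apply: eq_bigr => i _; rewrite mxE mulrA. Qed.

Lemma dotNl x y : dot (- x) y = - dot x y.
Proof. by rewrite -scaleN1r dotZl mulN1r. Qed.

Lemma dotDr x y z : dot x (y + z) = dot x y + dot x z.
Proof. by rewrite dotC dotDl !(dotC x). Qed.

Lemma dotZr a x y : dot x (a *: y) = a * dot x y.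
Proof. by rewrite dotC dotZl dotC. Qed.

Lemma dotNr x y : dot x (- y) = - dot x y.
Proof. by rewrite dotC dotNl dotC. Qed.

Lemma dot0l x : dot 0 x = 0.
Proof. by rewrite -(scale0r x) dotZl mul0r. Qed.

Lemma dot0r x : dot x 0 = 0. Proof. by rewrite dotC dot0l. Qed.

Definition dotE := (dotDl, dotDr, dotZl, dotZr, dotNl, dotNr).

Lemma dotxx_ge0 x : 0 <= dot x x.
Proof. by apply: sumr_ge0 => i _; rewrite -expr2 sqr_ge0. Qed.

Lemma dotxx_eq0 x : (dot x x == 0) = (x == 0).
Proof.
apply/idP/eqP => [|->]; last by rewrite dot0l.
rewrite psumr_eq0 => [/allP x0|i _]; last by rewrite -expr2 sqr_ge0.
apply/rowP => i; rewrite mxE; apply/eqP.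
by have := x0 i (mem_index_enum i); rewrite -expr2 sqrf_eq0.
Qed.

Lemma enorm_ge0 x : 0 <= enorm x. Proof. exact: sqrtr_ge0. Qed.

Lemma enorm_sqr x : enorm x ^+ 2 = dot x x.
Proof. by rewrite sqr_sqrtr// dotxx_ge0. Qed.

Lemma enorm_eq0 x : (enorm x == 0) = (x == 0).
Proof. by rewrite sqrtr_eq0 -dotxx_eq0 eq_le dotxx_ge0 andbT. Qed.

Lemma enorm0 : enorm (0 : 'rV[R]_n) = 0.
Proof. by apply/eqP; rewrite enorm_eq0. Qed.

Lemma enorm_gt0 x : (0 < enorm x) = (x != 0).
Proof. by rewrite lt_def enorm_eq0 enorm_ge0 andbT. Qed.

Lemma enormZ a x : enorm (a *: x) = `|a| * enorm x.
Proof. by rewrite /enorm !dotE mulrA -expr2 sqrtrM ?sqr_ge0// sqrtr_sqr. Qed.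

Lemma enormN x : enorm (- x) = enorm x.
Proof. by rewrite -scaleN1r enormZ normrN1 mul1r. Qed.

Lemma enormB x y : enorm (x - y) = enorm (y - x).
Proof. by rewrite -enormN opprB. Qed.

Lemma cauchy_schwarz x y : `|dot x y| <= enorm x * enorm y.
Proof.
rewrite -[leLHS]ger0_norm ?normr_ge0// -ler_sqr ?nnegrE ?mulr_ge0 ?enorm_ge0//.
rewrite normr_id exprMn !enorm_sqr real_normK ?num_real//.
have [->|y0] := eqVneq y 0; first by rewrite !dot0r expr0n mulr0.
have yy : 0 < dot y y by rewrite lt_def dotxx_eq0 y0 dotxx_ge0.
have := dotxx_ge0 (dot y y *: x - dot x y *: y).
rewrite !dotE (dotC y x) => h.
have : 0 <= dot y y * (dot x x * dot y y - dot x y ^+ 2) by nra.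
by rewrite pmulr_rge0// subr_ge0.
Qed.

Lemma le_dot x y : dot x y <= enorm x * enorm y.
Proof. exact: le_trans (ler_norm _) (cauchy_schwarz _ _). Qed.

Lemma enormD x y : enorm (x + y) <= enorm x + enorm y.
Proof.
rewrite -ler_sqr ?nnegrE ?addr_ge0 ?enorm_ge0// sqrrD !enorm_sqr !dotE.
by have := le_dot x y; rewrite (dotC y x) -mulr_natr; lra.
Qed.

Lemma enormD3 x y z : enorm (x - z) <= enorm (x - y) + enorm (y - z).
Proof. by rewrite (_ : x - z = (x - y) + (y - z)) ?enormD// addrA subrK. Qed.

Lemma ler_enormB x y : `|enorm x - enorm y| <= enorm (x - y).
Proof.
rewrite ler_norml; apply/andP; split.
  have := enormD (y - x) x; rewrite subrK enormB; lra.
have := enormD (x - y) y; rewrite subrK; lra.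
Qed.

Lemma coord_le_enorm x i : `|x ord0 i| <= enorm x.
Proof.
rewrite -ler_sqr ?nnegrE ?normr_ge0 ?enorm_ge0// enorm_sqr real_normK ?num_real//.
rewrite /dot (bigD1 i)//= -expr2 lerDl; apply: sumr_ge0 => j _.
by rewrite -expr2 sqr_ge0.
Qed.

Lemma norm_le_enorm x : `|x| <= enorm x.
Proof.
rewrite /Num.norm/= mx_normrE; apply: bigmax_le => [|[i j] _]; first exact: enorm_ge0.
by rewrite (ord1 i) coord_le_enorm.
Qed.

Lemma coord_le_norm x i : `|x ord0 i| <= `|x|.
Proof.
by rewrite [leRHS]/Num.norm/= mx_normrE; exact: (le_bigmax _ (fun p => `|x p.1 p.2|) (ord0, i)).
Qed.

Lemma enorm_le_coord x a : (forall i, `|x ord0 i| <= a) -> enorm x <= n%:R * a.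
Proof.
move=> xa; case: (posnP n) => [n0|n0].
  have -> : x = 0 by apply/rowP => i; by case: (i) => k ki; exfalso; move: ki; rewrite n0.
  by rewrite enorm0 n0 mul0r.
have a0 : 0 <= a by exact: le_trans (normr_ge0 _) (xa (Ordinal n0)).
rewrite -ler_sqr ?nnegrE ?enorm_ge0 ?mulr_ge0// enorm_sqr.
apply: (@le_trans _ _ (\sum_(i < n) a ^+ 2)).
  apply: ler_sum => i _; rewrite -expr2 -real_normK ?num_real//.
  by rewrite ler_sqr ?nnegrE.
rewrite sumr_const card_ord -[leLHS]mulr_natl exprMn ler_wpM2r ?sqr_ge0//.
by rewrite expr2 -natrM ler_nat leq_pmulr.
Qed.

Lemma enorm_le_norm x : enorm x <= n%:R * `|x|.
Proof. by apply: enorm_le_coord => i; exact: coord_le_norm. Qed.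

(** The neighbourhoods are those of the sup norm, which is comparable to [enorm] up to the factor
    [n]. The radius [e / n.+1] avoids a division by zero for [n = 0]. *)
Lemma near_enorm x e : 0 < e -> \forall y \near x, enorm (x - y) < e.
Proof.
move=> e0; have e1 : 0 < e / n.+1%:R by rewrite divr_gt0.
apply: filterS (nbhsx_ballx x _ e1) => y; rewrite -ball_normE/= => xy.
apply: le_lt_trans (enorm_le_norm _) _.
move: xy; rewrite ltr_pdivlMr// mulrC; apply: le_lt_trans.
by rewrite ler_wpM2r// ler_nat.
Qed.

Lemma continuous_lip (f : 'rV[R]_n -> R) L :
  (forall x y, `|f x - f y| <= L * enorm (x - y)) -> continuous f.
Proof.
move=> fL x; apply/(@cvgrPdist_lt _ _ _ (nbhs x) _ f (f x)) => e e0.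
have L0 : 0 < `|L| + 1 by rewrite ltr_wpDl.
have e1 : 0 < e / (`|L| + 1) by exact: divr_gt0.
have xe : nbhs x [set y | enorm (x - y) < e / (`|L| + 1)] by exact: near_enorm.
apply: filterS xe => y /=.
rewrite ltr_pdivlMr// mulrC; apply: le_lt_trans; apply: le_trans (fL _ _) _.
by rewrite ler_wpM2r ?enorm_ge0// ler_wpDr// ler_norm.
Qed.

Lemma continuous_dot y : continuous (dot y).
Proof.
apply: (@continuous_lip _ (enorm y)) => x z.
by rewrite -dotNr -dotDr cauchy_schwarz.
Qed.

Lemma continuous_dotl y : continuous (dot^~ y).
Proof. by rewrite (_ : dot^~ y = dot y); [exact: continuous_dot|apply/funext => x; rewrite dotC]. Qed.

Lemma continuous_enorm : continuous (@enorm R n).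
Proof. by apply: (@continuous_lip _ 1) => x y; rewrite mul1r ler_enormB. Qed.

Lemma closed_sphere : closed (sphere R n).
Proof.
have -> : sphere R n = enorm @^-1` [set 1] by [].
apply: closed_comp => [x _|]; first exact: continuous_enorm.
exact: closed_eq.
Qed.

Lemma bounded_enorm_compact (A : set 'rV[R]_n) M :
  closed A -> (forall x, A x -> enorm x <= M) -> compact A.
Proof.
move=> cA AM.
have cB : compact [set v : 'rV[R]_n | forall i, `[- M, M]%classic (v ord0 i)].
  by apply: (@rV_compact _ _ (fun=> `[- M, M]%classic)) => i; exact: segment_compact.
apply: (subclosed_compact cA cB) => x Ax i /=; rewrite in_itv/= -ler_norml.
exact: le_trans (coord_le_enorm _ _) (AM _ Ax).
Qed.

Lemma compact_sphere : compact (sphere R n).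
Proof.
by apply: (@bounded_enorm_compact _ 1); [exact: closed_sphere|move=> x ->].
Qed.

Lemma enorm_normalize x : x != 0 -> sphere R n ((enorm x)^-1 *: x).
Proof.
move=> x0; rewrite /sphere/= enormZ ger0_norm ?invr_ge0 ?enorm_ge0//.
by rewrite mulVf// enorm_eq0.
Qed.

End dot_enorm.

(** * Hausdorff measures *)

Section hausdorff_basics.
Context {R : realType}.
Local Open Scope ereal_scope.

Lemma diam_le n (A : set 'rV[R]_n) (d : R) :
  (forall x y, A x -> A y -> (enorm (x - y) <= d)%R) -> diam A <= d%:E.
Proof.
move=> Ad; apply: ge_ereal_sup => _ [[x y] [Ax Ay] <-].
by rewrite lee_fin; exact: Ad.
Qed.

Lemma enorm_le_diam n (A : set 'rV[R]_n) x y :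
  A x -> A y -> (enorm (x - y))%:E <= diam A.
Proof. by move=> Ax Ay; apply: ereal_sup_ubound; exists (x, y). Qed.

Lemma le_diam n (A B : set 'rV[R]_n) : A `<=` B -> diam A <= diam B.
Proof.
by move=> AB; apply: ge_ereal_sup => _ [[x y] [Ax Ay] <-]; apply: enorm_le_diam; exact: AB.
Qed.

Lemma diam_fin n (A : set 'rV[R]_n) (delta : R) : A !=set0 ->
  diam A <= delta%:E -> exists2 d : R, (0 <= d)%R & diam A = d%:E.
Proof.
move=> [x Ax] Ad; have A0 : 0 <= diam A.
  by apply: le_trans (enorm_le_diam Ax Ax); rewrite lee_fin enorm_ge0.
have /fineK Af : diam A \is a fin_num.
  by rewrite ge0_fin_numE// (le_lt_trans Ad)// ltry.
by exists (fine (diam A)); rewrite -?lee_fin Af.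
Qed.

Lemma hausdorff_gaugeE n k (A : set 'rV[R]_n) (d : R) : A !=set0 ->
  diam A = d%:E ->
  hausdorff_gauge k A = (ball_volume R k * (2^-1 * d) ^+ k)%:E.
Proof.
move=> /set0P/negbTE A0 Ad; rewrite /hausdorff_gauge A0 Ad.
by rewrite -EFinM -EFin_expe -EFinM.
Qed.

Lemma hausdorff_gauge_le n k (A : set 'rV[R]_n) (d : R) : (0 <= d)%R ->
  (forall x y, A x -> A y -> (enorm (x - y) <= d)%R) ->
  hausdorff_gauge k A <= (ball_volume R k * (2^-1 * d) ^+ k)%:E.
Proof.
move=> d0 Ad; have [->|/set0P A0] := eqVneq A set0.
  by rewrite hausdorff_gauge0 lee_fin mulr_ge0 ?ball_volume_ge0// exprn_ge0// mulr_ge0.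
have [e e0 Ae] := diam_fin A0 (diam_le Ad).
rewrite (hausdorff_gaugeE k A0 Ae) lee_fin ler_wpM2l ?ball_volume_ge0//.
rewrite lerXn2r ?nnegrE ?mulr_ge0// ler_wpM2l// -lee_fin -Ae; exact: diam_le.
Qed.

Lemma hausdorff_ge_delta n k (A : set 'rV[R]_n) (d : R) : (0 < d)%R ->
  hausdorff_delta k d A <= hausdorff k A.
Proof. by move=> d0; apply: ereal_sup_ubound; exists d. Qed.

Lemma hausdorff_delta_anti n k (A : set 'rV[R]_n) (d e : R) : (d <= e)%R ->
  hausdorff_delta k e A <= hausdorff_delta k d A.
Proof.
move=> de; apply/ereal_inf_le_tmp => _ [F [dF AF] <-].
exists F => //; split => // i; apply: le_trans (dF i) _; by rewrite lee_fin.
Qed.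

(** A [d / L]-cover of [A] is pushed forward to a [d]-cover of the image, each gauge growing by at
    most the factor [L ^+ k]. As [g] is Lipschitz on [A] only, the covering sets are first cut down
    to [A]. *)
Lemma hausdorff_lip a b k (g : 'rV[R]_a -> 'rV[R]_b) (A : set 'rV[R]_a) (L : R) :
  (0 < L)%R ->
  (forall x y, A x -> A y -> (enorm (g x - g y) <= L * enorm (x - y))%R) ->
  hausdorff k (g @` A) <= (L ^+ k)%:E * hausdorff k A.
Proof.
move=> L0 gL; apply: ge_ereal_sup => _ [d d0 <-].
apply: (@le_trans _ _ ((L ^+ k)%:E * hausdorff_delta k (d / L) A)); last first.
  by rewrite lee_pmul2l ?lte_fin ?exprn_gt0// hausdorff_ge_delta// divr_gt0.
rewrite -lee_pdivrMl ?exprn_gt0//; apply: le_ereal_inf_tmp => _ [F [dF AF] <-].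
rewrite lee_pdivrMl ?exprn_gt0// -nneseriesZl; last first.
  by move=> i _; exact: hausdorff_gauge_ge0.
pose G i := g @` (F i `&` A).
have Glip i x y : G i x -> G i y -> (enorm (x - y))%:E <= L%:E * diam (F i).
  move=> [x' [Fx Ax] <-] [y' [Fy Ay] <-].
  apply: (@le_trans _ _ (L * enorm (x' - y'))%:E).
    by rewrite lee_fin gL.
  by rewrite EFinM lee_pmul2l// enorm_le_diam.
apply: (@le_trans _ _ (\sum_(i <oo) hausdorff_gauge k (G i))).
  apply: ereal_inf_lbound; exists G => //; split => [i|].
    apply: diam_le => x y Gx Gy; rewrite -lee_fin; apply: le_trans (Glip _ _ _ Gx Gy) _.
    by rewrite muleC -lee_pdivlMr// -EFinM; exact: dF.
  move=> _ [x Ax <-]; have [i _ Fx] := AF _ Ax.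
  by exists i => //; exists x.
apply: lee_nneseries => [i _ _|i _]; first exact: hausdorff_gauge_ge0.
have [->|/set0P G0] := eqVneq (G i) set0.
  by rewrite hausdorff_gauge0 mule_ge0 ?lee_fin ?exprn_ge0 ?(ltW L0) ?hausdorff_gauge_ge0.
have F0 : F i !=set0 by move: G0 => [_ [x [Fx _] _]]; exists x.
have [e e0 Fe] := diam_fin F0 (dF i).
rewrite (hausdorff_gaugeE k F0 Fe) -EFinM.
rewrite [leRHS](_ : _ = (ball_volume R k * (2^-1 * (L * e)) ^+ k)%:E); last first.
  by congr EFin; rewrite !exprMn; ring.
apply: hausdorff_gauge_le => [|x y Gx Gy]; first by rewrite mulr_ge0// ltW.
by rewrite -lee_fin EFinM -Fe; exact: Glip.
Qed.

(** A set of diameter less than [d] cannot meet both [A] and [B], so the members of a fine cover of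
    the union split into a cover of [A] and one of [B]. *)
Lemma hausdorff_metric n k (A B : set 'rV[R]_n) (d : R) : (0 < d)%R ->
  (forall x y, A x -> B y -> (d <= enorm (x - y))%R) ->
  hausdorff k A + hausdorff k B <= hausdorff k (A `|` B).
Proof.
move=> d0 AB; set M := hausdorff k (A `|` B).
have hdM (e : R) : (0 < e)%R -> hausdorff_delta k e A + hausdorff_delta k e B <= M.
  move=> e0; pose f := (Order.min e (d / 2))%R.
  have f0 : (0 < f)%R by rewrite lt_min e0 divr_gt0.
  have fd : (f < d)%R by rewrite gt_min ltr_pdivrMr// ltr_pMr// ltr1n orbT.
  have fe : (f <= e)%R by rewrite ge_min lexx.
  apply: (@le_trans _ _ (hausdorff_delta k f A + hausdorff_delta k f B)).
    by apply: leeD; exact: hausdorff_delta_anti.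
  apply: le_trans (hausdorff_ge_delta k _ f0).
  apply: le_ereal_inf_tmp => _ [F [dF ABF] <-].
  (* This is [F i] if it meets [C], and empty otherwise. *)
  pose G (C : set 'rV[R]_n) i := [set x | F i x /\ (F i `&` C) !=set0].
  have hG C : C `<=` A `|` B ->
      hausdorff_delta k f C <= \sum_(i <oo) hausdorff_gauge k (G C i).
    move=> CAB; apply: ereal_inf_lbound; exists (G C) => //; split => [i|x Cx].
      by apply: le_trans (dF i); apply: le_diam => x [].
    by have [i _ Fx] := ABF _ (CAB _ Cx); exists i => //; split => //; exists x.
  apply: (@le_trans _ _ (\sum_(i <oo) (hausdorff_gauge k (G A i) + hausdorff_gauge k (G B i)))).
    rewrite nneseriesD; [|by move=> ? _ _; exact: hausdorff_gauge_ge0..].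
    by apply: leeD; apply: hG => x; [left|right].
  apply: lee_nneseries => [i _ _|i _]; first by rewrite adde_ge0 ?hausdorff_gauge_ge0.
  have G0 C : ~ (F i `&` C !=set0) -> hausdorff_gauge k (G C i) = 0.
    move=> FC; rewrite (_ : G C i = set0) ?hausdorff_gauge0//.
    by rewrite -subset0 => x [].
  have G1 C : F i `&` C !=set0 -> G C i = F i.
    by move=> FC; apply/seteqP; split => x // [].
  have [FA|FA] := pselect (F i `&` A !=set0); last first.
    rewrite (G0 _ FA) add0e.
    have [FB|FB] := pselect (F i `&` B !=set0); first by rewrite G1.
    by rewrite (G0 _ FB) hausdorff_gauge_ge0.
  rewrite (G1 _ FA) (G0 B) ?adde0// => -[y [Fy By]].
  have [x [Fx Ax]] := FA.
  have := le_trans (enorm_le_diam Fx Fy) (dF i).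
  by rewrite lee_fin leNgt (lt_le_trans fd)// AB.
have [->|Moo] := eqVneq M +oo; first exact: leey.
have HAM : hausdorff k A <= M by apply: (le_outer_measure (hausdorff_outer k)) => x; left.
have HBM : hausdorff k B <= M by apply: (le_outer_measure (hausdorff_outer k)) => x; right.
have HB0 : 0 <= hausdorff k B by exact: (outer_measure_ge0 (hausdorff_outer k)).
have Bf : hausdorff k B \is a fin_num.
  by rewrite ge0_fin_numE//; apply: le_lt_trans HBM _; rewrite ltey.
(* The two suprema over [delta] are bounded one after the other; moving a term across requires it to
   be finite. *)
rewrite -leeBrDr//; apply: ge_ereal_sup => _ [d1 /= d10 <-].
rewrite leeBrDr// addeC.
have hA0 := hausdorff_delta_ge0 k d1 A.
have Af : hausdorff_delta k d1 A \is a fin_num.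
  rewrite ge0_fin_numE//; apply: le_lt_trans (hausdorff_ge_delta k A d10) _.
  by apply: le_lt_trans HAM _; rewrite ltey.
rewrite -leeBrDr//; apply: ge_ereal_sup => _ [d2 /= d20 <-].
rewrite leeBrDr// addeC.
have d0' : (0 < Order.min d1 d2)%R by rewrite lt_min d10.
apply: le_trans (hdM _ d0').
by apply: leeD; apply: hausdorff_delta_anti; rewrite ge_min lexx ?orbT.
Qed.

End hausdorff_basics.

(** * Caratheodory measurability of closed sets *)

Section hausdorff_closed.
Context {R : realType} {n : nat}.
Variable k : nat.
Implicit Types (A X : set 'rV[R]_n) (x y : 'rV[R]_n).
Local Open Scope ereal_scope.

Let H := @hausdorff_outer R n k.

(* Among the shells [r (i+1) < g <= r i], with [r i = 1 / (i+1)], those with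
   index of a given parity are at positive mutual distance, so that the measures
   of their intersections with [X] have a finite sum. *)
Lemma caratheodory_lip (g : 'rV[R]_n -> R) :
  (forall x y, (`|g x - g y| <= enorm (x - y))%R) ->
  H.-caratheodory [set x | (g x <= 0)%R].
Proof.
move=> gL; apply: le_caratheodory_measurable => X.
set A := [set x | _].
have [->|Xoo] := eqVneq (H X) +oo; first exact: leey.
pose r (i : nat) : R := (i.+1%:R^-1)%R.
have r0 i : (0 < r i)%R by rewrite invr_gt0.
have rS i : (r i.+1 < r i)%R by rewrite ltf_pV2 ?posrE// ltr_nat.
pose T i := X `&` [set x | (r i.+1 < g x <= r i)%R].
pose S i := X `&` [set x | (r i < g x)%R].
have sep (B C : set 'rV[R]_n) (d e : R) : (d < e)%R ->
    (forall x, B x -> (g x <= d)%R) -> (forall x, C x -> (e < g x)%R) ->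
    H B + H C <= H (B `|` C).
  move=> de Bd Ce; apply: (@hausdorff_metric _ _ _ _ _ (e - d)); first by rewrite subr_gt0.
  move=> x y /Bd gx /Ce gy; apply: le_trans (gL _ _); rewrite distrC.
  by apply: le_trans (ler_norm _); apply: lerB => //; exact: ltW.
have TS c N : \sum_(0 <= j < N) H (T (2 * j + c).+1) <= H (S (2 * N + c)%N).
  elim: N => [|N IH]; first by rewrite big_geq// outer_measure_ge0.
  rewrite big_nat_recr//=; apply: le_trans (leeD2r _ IH) _.
  rewrite addeC; apply: le_trans (sep _ _ (r (2 * N + c).+1) (r (2 * N + c)%N) _ _ _) _ => //.
  - by move=> x [_ /andP[]].
  - by move=> x [].
  - apply: le_outer_measure => x [] [Xx /=].
      move=> /andP[h _]; split => //=; by rewrite mulnS addSn addSn.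
    move=> h; split => //=; apply: lt_trans h.
    by rewrite mulnS !addSn; apply: lt_trans (rS _) (rS _).
have Tfin c : \sum_(0 <= j <oo) H (T (2 * j + c).+1) < +oo.
  apply: (@le_lt_trans _ _ (H X)); last by rewrite ltey.
  apply: lime_le; first by apply: is_cvg_nneseries => *; exact: outer_measure_ge0.
  apply: nearW => N; apply: le_trans (TS c N) _.
  by apply: le_outer_measure => x [].
have T0 c := nneseries_tail_cvg (Tfin c) (fun j _ => outer_measure_ge0 H _).
(* The inequality is proved up to the tails of two convergent series, then [N] tends to infinity. *)
have cvg0 : H X + (\sum_(N <= j <oo) H (T (2 * j + 0).+1) +
    \sum_(N <= j <oo) H (T (2 * j + 1).+1)) @[N --> \oo] --> H X.
  rewrite -[X in _ --> X]adde0; apply: cvgeD; rewrite ?fin_num_adde_defl//.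
    exact: cvg_cst.
  by rewrite -[X in _ --> X]adde0; apply: cvgeD; [|exact: T0|exact: T0].
apply: (cvge_ge _ cvg0); apply: nearW => N.
have XA : H (X `&` A) + H (S (2 * N).+1) <= H X.
  apply: le_trans (sep _ _ 0%R (r (2 * N).+1) (r0 _) _ _) _.
  - by move=> x [].
  - by move=> x [].
  - by apply: le_outer_measure => x [] [].
have XC : H (X `&` ~` A) <= H (S (2 * N).+1) + (\sum_(N <= j <oo) H (T (2 * j + 0).+1) +
    \sum_(N <= j <oo) H (T (2 * j + 1).+1)).
  pose T1 c := \bigcup_(j in ~` `I_N) T (2 * j + c).+1.
  apply: (@le_trans _ _ (H (S (2 * N).+1 `|` (T1 0%N `|` T1 1%N)))); last first.
    apply: le_trans (outer_measureU2 _ _ _) _; apply: leeD => //.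
    apply: le_trans (outer_measureU2 _ _ _) _; apply: leeD;
      exact: (outer_measure_sigma_subadditive_tail H N (fun j => T (2 * j + _).+1)).
  apply: le_outer_measure => x [Xx /= /negP]; rewrite -ltNge => gx.
  have [h|h] := ltP (r (2 * N).+1) (g x); first by left.
  right.
  have ex_r : exists i, (r i < g x)%R.
    have [i] : exists i, (0 + i.+1%:R^-1 < g x)%R by apply/ltr_add_invr.
    by rewrite add0r => ?; exists i.
  (* The least index with [r i < g x] is one past the shell that contains [x]; the parity of the
     shell decides between the two unions [T1]. *)
  case: (ex_minnP ex_r) => -[|i] ri imin.
    by move: (lt_le_trans ri h); rewrite ltf_pV2 ?posrE// ltr_nat.
  have gi : (g x <= r i)%R.
    by rewrite leNgt; apply/negP => /imin; rewrite ltnn.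
  have Ni : ((2 * N).+1 <= i)%N.
    by move: (lt_le_trans ri h); rewrite ltf_pV2 ?posrE// ltr_nat ltnS.
  case: i {imin} ri gi Ni => // i ri gi; rewrite ltnS => Ni.
  have hN : ~ (i./2 < N)%N by move=> hN; move: Ni; rewrite -(odd_double_half i); lia.
  have hT c : nat_of_bool (odd i) = c -> T1 c x.
    move=> oc; exists i./2 => //=; rewrite /T -oc mul2n addnC odd_double_half.
    by split => //=; rewrite ri gi.
  by have := hT _ erefl; case: (odd i); [right|left].
apply: le_trans (leeD2l _ XC) _.
by rewrite addeA leeD2r.
Qed.

Let dist A x := inf [set enorm (x - a)%R | a in A].

Let dist_le A x a : A a -> (dist A x <= enorm (x - a))%R.
Proof.
move=> Aa; apply: ge_inf; last by exists a.
by exists 0%R => _ [b _ <-]; exact: enorm_ge0.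
Qed.

Let le_dist A x (d : R) : A !=set0 -> (forall a, A a -> (d <= enorm (x - a))%R) ->
  (d <= dist A x)%R.
Proof.
move=> [a Aa] h; apply: lb_le_inf; first by exists (enorm (x - a)); exists a.
by move=> _ [b Ab <-]; exact: h.
Qed.

(** A closed set is the zero set of the distance to it, which is Lipschitz with constant 1. The
    empty set is treated apart because an infimum over it is a default value. *)
Lemma closed_caratheodory A : closed A -> H.-caratheodory A.
Proof.
move=> cA; have [->|/set0P A0] := eqVneq A set0.
  exact: caratheodory_measurable_set0.
have <- : [set x | (dist A x <= 0)%R] = A.
  apply/seteqP; split => x /= => [dx|Ax]; last first.
    by apply: le_trans (dist_le x Ax) _; rewrite subrr enorm0.
  apply: contrapT => nAx.
  have /nbhs_ballP[e /= e0 eA] : nbhs x (~` A).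
    by apply: open_nbhs_nbhs; split => //; exact: closed_openC.
  suff : (e <= dist A x)%R by rewrite leNgt (le_lt_trans dx).
  apply: le_dist => // a Aa; apply: le_trans (norm_le_enorm _).
  rewrite leNgt; apply/negP => xa; apply: (eA a) => //.
  by rewrite -ball_normE.
apply: caratheodory_lip => x y; rewrite ler_norml; apply/andP; split.
  rewrite lerNl opprB lerBlDl -lerBlDr; apply: le_dist => // a Aa.
  rewrite lerBlDr; apply: le_trans (dist_le y Aa) _.
  by rewrite [leRHS]addrC (enormB x y) enormD3.
rewrite lerBlDl -lerBlDr; apply: le_dist => // a Aa.
rewrite lerBlDr; apply: le_trans (dist_le x Aa) _.
by rewrite [leRHS]addrC enormD3.
Qed.

Lemma closed_measurable_hausdorff A : closed A ->
  measurable (A : set (caratheodory_type H)).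
Proof. exact: closed_caratheodory. Qed.

Lemma open_measurable_hausdorff A : open A ->
  measurable (A : set (caratheodory_type H)).
Proof.
move=> oA; rewrite -(setCK A); apply: measurableC.
by apply: closed_measurable_hausdorff; exact: open_closedC.
Qed.

End hausdorff_closed.

(** * Finiteness and positivity of the measure of cubes *)

Section hausdorff_box.
Context {R : realType}.

(** Covers are sequences by definition; a finite one is padded with empty sets, of diameter [-oo]
    and gauge 0. *)
Lemma hausdorff_delta_fin n k (d : R) (I : finType) (F : I -> set 'rV[R]_n) A :
  (forall i, diam (F i) <= d%:E)%E -> A `<=` \bigcup_i F i ->
  (hausdorff_delta k d A <= \sum_(i : I) hausdorff_gauge k (F i))%E.
Proof.
move=> Fd AF.
pose G (j : nat) := if insub j is Some o then F (enum_val (o : 'I_#|I|)) else set0.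
apply: (@le_trans _ _ (\sum_(j <oo) hausdorff_gauge k (G j))%E).
  apply: ereal_inf_lbound; exists G => //; split => [j|x /AF[i _ Fx]].
    by rewrite /G; case: insubP => [i0 _ _|_]; [exact: Fd|rewrite diam0 leNye].
  by exists (enum_rank i) => //; rewrite /G valK enum_rankK.
rewrite (nneseries_split 0 #|I|); last by move=> *; exact: hausdorff_gauge_ge0.
rewrite add0n eseries0 ?adde0; last first.
  by move=> j Ij _; rewrite /G insubN ?hausdorff_gauge0// -leqNgt.
rewrite big_mkord (reindex (@enum_rank I)) /=; last first.
  by exists enum_val => x _; rewrite ?enum_rankK ?enum_valK.
by apply: lee_sum => i _; rewrite /G valK enum_rankK.
Qed.

Definition cube m (M : R) : set 'rV[R]_m := [set x | forall i, `|x ord0 i| <= M].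
Arguments cube : clear implicits.

(** Cutting the cube into [N ^ m] cells of side [2 M / N] yields covers whose total gauge has a
    bound independent of [N], although the diameters tend to 0. *)
Lemma hausdorff_cube_fin m (M : R) : 0 < M -> (hausdorff m (cube m M) < +oo)%E.
Proof.
move=> M0; apply: (@le_lt_trans _ _ (ball_volume R m * (2^-1 * (m%:R * (2 * M))) ^+ m)%:E);
  last by rewrite ltry.
apply: ge_ereal_sup => _ [d /= d0 <-].
have [N0 N0d] : exists N, m%:R * (2 * M) / d < N.+1%:R.
  exists (Num.truncn (m%:R * (2 * M) / d)); exact: truncnS_gt.
pose N := N0.+1.
have Npos : 0 < N%:R :> R by [].
pose h := 2 * M / N%:R.
pose cell (c : {ffun 'I_m -> 'I_N}) : set 'rV[R]_m :=
  [set x | forall i, - M + h * (c i)%:R <= x ord0 i <= - M + h * (c i).+1%:R].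
have h0 : 0 < h by rewrite divr_gt0// mulr_gt0.
have hN : h * N%:R = 2 * M by rewrite /h divfK// gt_eqF.
have cellh c x y : cell c x -> cell c y -> enorm (x - y) <= m%:R * h.
  move=> cx cy; apply: enorm_le_coord => i; rewrite !mxE ler_norml.
  move: (cx i) (cy i); rewrite -[(c i).+1]addn1 natrD mulrDr mulr1.
  by move=> /andP[? ?] /andP[? ?]; apply/andP; split; lra.
have mhd : m%:R * h <= d.
  by rewrite /h mulrA ler_pdivrMr// [leRHS]mulrC -ler_pdivrMr// ltW.
apply: le_trans (@hausdorff_delta_fin m m d _ cell _ _ _) _.
- by move=> c; apply: diam_le => x y cx cy; exact: le_trans (cellh _ _ _ cx cy) mhd.
- move=> x Mx.
  have ex (i : 'I_m) : exists c : 'I_N, - M + h * c%:R <= x ord0 i <= - M + h * c.+1%:R.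
    have := Mx i; rewrite ler_norml => /andP[x1 x2].
    have y0 : 0 <= (x ord0 i + M) / h by rewrite divr_ge0 ?(ltW h0)//; lra.
    have [c1|c1] := ltnP (Num.truncn ((x ord0 i + M) / h)) N.
      exists (Ordinal c1) => /=; have /andP[a b] := truncn_itv y0.
      move: a b; rewrite ler_pdivlMr// ltr_pdivrMr// => a b.
      by apply/andP; split; lra.
    (* Only the right end of the interval gets here; it is put into the last cell. *)
    exists ord_max => /=.
    have xN : N%:R * h <= x ord0 i + M.
      rewrite -ler_pdivlMr//; apply: le_trans (_ : (Num.truncn ((x ord0 i + M) / h))%:R <= _).
        by rewrite ler_nat.
      by have /andP[] := truncn_itv y0.
    have -> : N0%:R = N%:R - 1 :> R by rewrite /N -[N0.+1]addn1 natrD addrK.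
    rewrite -/N mulrBr mulr1 hN; move: xN; rewrite mulrC hN => xN.
    by apply/andP; split; lra.
  pose c i := projT1 (cid (ex i)).
  by exists (finfun c) => // i; rewrite ffunE; exact: projT2 (cid (ex i)).
apply: (@le_trans _ _ (\sum_(c : {ffun 'I_m -> 'I_N}) (ball_volume R m * (2^-1 * (m%:R * h)) ^+ m)%:E)%E).
  apply: lee_sum => c _; apply: hausdorff_gauge_le; last exact: cellh.
  by rewrite mulr_ge0// ltW.
rewrite sumEFin lee_fin sumr_const card_ffun !card_ord -[leLHS]mulr_natr.
rewrite -mulrA natrX -exprMn ler_wpM2l ?ball_volume_ge0//.
by have -> : 2^-1 * (m%:R * h) * N%:R = 2^-1 * (m%:R * (2 * M)) by rewrite -hN; ring.
Qed.

(** All the indices counted lie at most [2 * r / s] above the least one. *)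
Lemma card_interval N (r s x : R) : 0 <= r -> 0 < s ->
  #|[set k : 'I_N | `|s * k%:R - x| <= r]%SET|%:R <= 2 * r / s + 1.
Proof.
move=> r0 s0; set A := finset _.
have rs0 : 0 <= 2 * r / s by rewrite divr_ge0 ?(ltW s0)// mulr_ge0.
have [->|/set0Pn[k0 Ak0]] := eqVneq A finset.set0.
  by rewrite cards0 addr_ge0.
pose K := Num.truncn (2 * r / s).
case: (@arg_minnP _ k0 (fun k => k \in A) val Ak0) => a Aa amin.
have AK : (#|A| <= K.+1)%N.
  rewrite cardE -(size_map val) -(size_iota a K.+1); apply: uniq_leq_size.
    by rewrite map_inj_uniq ?enum_uniq//; exact: val_inj.
  move=> _ /mapP[k + ->]; rewrite mem_enum => Ak.
  rewrite mem_iota amin//= addnS ltnS -leq_subLR.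
  rewrite truncn_ge_nat// ler_pdivlMr// natrB ?amin//.
  move: Aa Ak; rewrite !inE !ler_norml => /andP[a1 a2] /andP[k1 k2]; lra.
apply: le_trans (_ : K.+1%:R <= _); first by rewrite ler_nat.
rewrite -[K.+1]addn1 natrD lerD2r.
by have /andP[] := truncn_itv rs0.
Qed.

(* Counts the points of [(s/N)Z^m] in the box, for [N] so large that
   [s/N <= r i] for all the finitely many [i]. *)
Lemma box_cover_volume m (s : R) (I : eqType) (D : seq I) (x : I -> 'rV[R]_m) (r : I -> R) :
  0 < s -> (forall i, 0 < r i) ->
  (forall y : 'rV[R]_m, (forall j, 0 <= y ord0 j <= s) ->
     exists2 i, i \in D & forall j, `|y ord0 j - x i ord0 j| <= r i) ->
  s ^+ m <= \sum_(i <- D) (3 * r i) ^+ m.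
Proof.
move=> s0 r0 cov.
have [N0 N0r] : exists N, forall i, i \in D -> s / r i < N.+1%:R.
  elim: D {cov} => [|i D [N IH]]; first by exists 0%N.
  exists (maxn N (Num.truncn (s / r i))) => j; rewrite in_cons => /orP[/eqP ->|/IH jN].
    apply: lt_le_trans (truncnS_gt _) _; by rewrite ler_nat ltnS leq_maxr.
  by apply: lt_le_trans jN _; rewrite ler_nat ltnS leq_maxl.
pose N := N0.+1; have Npos : 0 < N%:R :> R by [].
have sN0 : 0 < s / N%:R by exact: divr_gt0.
pose B i := family (fun j => [set k : 'I_N | `|s / N%:R * k%:R - x i ord0 j| <= r i]%SET).
have NB : (N ^ m <= \sum_(i <- D) #|B i|)%N.
  rewrite -[X in (X ^ _)%N]card_ord -[X in (_ ^ X)%N]card_ord -card_ffun.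
  rewrite -sum1_card; apply: (@leq_trans (\sum_(c : {ffun 'I_m -> 'I_N}) \sum_(i <- D) (c \in B i))).
    apply: leq_sum => c _.
    have [j|i iD hi] := cov (\row_j (s / N%:R * (c j)%:R)).
      rewrite mxE mulr_ge0 ?(ltW sN0)//= -[leRHS](divfK (lt0r_neq0 Npos)).
      by rewrite ler_wpM2l ?(ltW sN0)// ler_nat ltnW.
    rewrite (big_rem i)//= (_ : c \in B i) ?leq_addr//; apply/familyP => j.
    by rewrite inE; have := hi j; rewrite mxE.
  rewrite exchange_big/=; apply: leq_sum => i _.
  by rewrite -sum1_card [leqRHS]big_mkcond/=; apply: leq_sum => c _; case: ifP.
have -> : s ^+ m = (s / N%:R) ^+ m * (N ^ m)%:R.
  by rewrite natrX -exprMn divfK// gt_eqF.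
apply: (@le_trans _ _ ((s / N%:R) ^+ m * (\sum_(i <- D) #|B i|)%:R)).
  by rewrite ler_wpM2l ?exprn_ge0 ?(ltW sN0)// ler_nat.
rewrite natr_sum mulr_sumr big_seq [leRHS]big_seq; apply: ler_sum => i iD.
have Bi : #|B i|%:R <= (2 * r i / (s / N%:R) + 1) ^+ m.
  rewrite card_family; have -> : (2 * r i / (s / N%:R) + 1) ^+ m =
      \prod_(j <- enum 'I_m) (2 * r i / (s / N%:R) + 1).
    by rewrite big_const_seq count_predT size_enum_ord iter_mulr_1.
  rewrite /image_mem; elim: (enum 'I_m) => [|j e IH]; first by rewrite big_nil.
  rewrite big_cons /= natrM; apply: ler_pM => //.
  rewrite (_ : #|_| = #|[set k : 'I_N | `|s / N%:R * k%:R - x i ord0 j| <= r i]%SET|).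
    exact: card_interval (ltW (r0 i)) sN0.
  by apply: eq_card => k; rewrite inE.
apply: le_trans (_ : (s / N%:R) ^+ m * (2 * r i / (s / N%:R) + 1) ^+ m <= _).
  by rewrite ler_wpM2l ?exprn_ge0 ?(ltW sN0)//.
rewrite -exprMn lerXn2r ?nnegrE ?mulr_ge0 ?addr_ge0 ?divr_ge0 ?mulr_ge0 ?(ltW (r0 i)) ?(ltW s0)//.
rewrite mulrDr mulr1 mulrC divfK ?gt_eqF//.
(* The extra grid point costs [s / N], which turns [2 * r i] into [3 * r i]. *)
have : s / N%:R <= r i.
  by rewrite ler_pdivrMr// mulrC -ler_pdivrMr// ltW// N0r.
lra.
Qed.

Definition box m (s : R) : set 'rV[R]_m := [set x | forall i, 0 <= x ord0 i <= s].
Arguments box : clear implicits.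

Lemma ball_volume_gt0 k : 0 < ball_volume R k.
Proof.
suff : 0 < ball_volume R k /\ 0 < ball_volume R k.+1 by case.
elim: k => [|k [k0 k1]]; first by split.
by split => //=; apply: mulr_gt0 => //; rewrite divr_gt0// mulr_gt0// pi_gt0.
Qed.

(** Replacing each covering set by an open ball of comparable size makes a finite subcover
    available, in which grid points can be counted. *)
Lemma hausdorff_box_gt0 m (s : R) : (0 < m)%N -> 0 < s -> (0 < hausdorff m (box m s))%E.
Proof.
move=> m0 s0; set b := ball_volume R m.
have b0 : 0 < b by exact: ball_volume_gt0.
(* 12 is 4 times 3: a set of diameter [d] is enclosed in a ball of radius [r = 2 * d], so half its
   diameter is [r / 4], and the count works with [3 * r]. *)
pose c := b * (12^-1 * s) ^+ m.
have c0 : 0 < c by rewrite mulr_gt0// exprn_gt0// mulr_gt0.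
apply: (@lt_le_trans _ _ c%:E); first by rewrite lte_fin.
apply: le_trans (@hausdorff_ge_delta _ _ _ _ 1 ltr01).
apply: le_ereal_inf_tmp => _ [F [dF BF] <-].
apply/lee_addgt0Pr => e e0.
apply: le_trans (epsilon_trick predT (fun i => hausdorff_gauge_ge0 m (F i)) (ltW e0)).
pose ei i := e / (2 ^ i.+1)%:R.
have ei0 i : 0 < ei i by rewrite divr_gt0// ltr0n expn_gt0.
have ex i : exists xr : 'rV[R]_m * R, [/\ 0 < xr.2,
    forall y, F i y -> `|y - xr.1| < xr.2 &
    ((b * (4^-1 * xr.2) ^+ m)%:E <= hausdorff_gauge m (F i) + (ei i)%:E)%E].
  (* Empty sets and single points also get a ball of positive radius. Its cost is charged to [ei i],
     using [t ^+ m <= t] for [m > 0]. *)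
  have small : exists2 r : R, 0 < r & ((b * (4^-1 * r) ^+ m)%:E <= (ei i)%:E)%E.
    pose t := Order.min 1 (ei i / b).
    have t0 : 0 < t by rewrite lt_min ltr01 divr_gt0.
    exists (4 * t); first by rewrite mulr_gt0.
    rewrite mulKf// lee_fin mulrC -ler_pdivlMr//.
    apply: (@le_trans _ _ t); last by rewrite ge_min lexx orbT.
    by rewrite -[leRHS]expr1 ler_wiXn2l ?(ltW t0)// ge_min lexx.
  have [F0|/set0P F0] := eqVneq (F i) set0.
    have [r r0 hr] := small; exists (0, r); split => //=; first by rewrite F0.
    by rewrite (le_trans hr)// leeDr// hausdorff_gauge_ge0.
  have [d d0 Fd] := diam_fin F0 (dF i); have [x Fx] := F0.
  have Fxy y : F i y -> `|y - x| <= d.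
    move=> Fy; apply: le_trans (norm_le_enorm _) _.
    by rewrite -lee_fin -Fd; exact: enorm_le_diam.
  move: d0; rewrite le_eqVlt => /orP[/eqP d0|d0].
    have [r r0 hr] := small; exists (x, r); split => //= [y /Fxy|].
      by rewrite -d0 => /le_lt_trans; apply.
    by rewrite (le_trans hr)// leeDr// hausdorff_gauge_ge0.
  exists (x, 2 * d); split => /= [|y /Fxy h|]; first by rewrite mulr_gt0.
    by apply: le_lt_trans h _; lra.
  rewrite (hausdorff_gaugeE m F0 Fd) -EFinD lee_fin.
  rewrite (_ : 4^-1 * (2 * d) = 2^-1 * d); last by field.
  by rewrite lerDl ltW.
have [xr hxr] : {xr : nat -> 'rV[R]_m * R & forall i, [/\ 0 < (xr i).2,
    forall y, F i y -> `|y - (xr i).1| < (xr i).2 &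
    ((b * (4^-1 * (xr i).2) ^+ m)%:E <= hausdorff_gauge m (F i) + (ei i)%:E)%E]}.
  exact: choice ex.
have cB : compact (box m s).
  rewrite (_ : box m s = [set v | forall i, `[0, s]%classic (v ord0 i)]).
    by apply: (@rV_compact _ _ (fun=> `[0, s]%classic)) => i; exact: segment_compact.
  by apply/seteqP; split => x /= h i; have := h i; rewrite /= in_itv.
move: cB; rewrite compact_cover => /(_ nat setT (fun i => ball (xr i).1 (xr i).2)).
case=> [i _|y /BF[i _ Fy]|D _ BD]; first exact: ball_open.
  by exists i => //; rewrite -ball_normE/= distrC; have [_ h _] := hxr i; exact: h.
have vol : s ^+ m <= \sum_(i <- finmap.enum_fset D) (3 * (xr i).2) ^+ m.
  apply: (@box_cover_volume m s _ _ (fun i => (xr i).1)) => // [i|y By].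
    by have [] := hxr i.
  have [i /= iD] := BD y By; rewrite -ball_normE/= distrC => h; exists i => // j.
  by have := coord_le_norm (y - (xr i).1) j; rewrite !mxE => /le_trans; apply; exact: ltW.
apply: (@le_trans _ _ (\sum_(i <- finmap.enum_fset D) (b * (4^-1 * (xr i).2) ^+ m)%:E)%E).
  rewrite sumEFin lee_fin /c -mulr_sumr ler_wpM2l ?(ltW b0)//.
  rewrite exprMn.
  rewrite (eq_bigr (fun i => 12^-1 ^+ m * (3 * (xr i).2) ^+ m)).
    by rewrite -mulr_sumr ler_wpM2l// exprn_ge0.
  by move=> i _; rewrite -exprMn; congr (_ ^+ _); field.
apply: (@le_trans _ _ (\sum_(i <- finmap.enum_fset D) (hausdorff_gauge m (F i) + (ei i)%:E))%E).
  by apply: lee_sum => i _; have [] := hxr i.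
apply: (@lee_sum_fset_lim _ (fun i => hausdorff_gauge m (F i) + (ei i)%:E)%E D predT) => i _.
by rewrite adde_ge0 ?hausdorff_gauge_ge0// lee_fin ltW// ei0.
Qed.

End hausdorff_box.
Arguments cube {R} m M.
Arguments box {R} m s.

(** * The Hausdorff measure of the sphere *)

Section sphere_charts.
Context {R : realType}.

Lemma sum_lift m (k : 'I_m.+1) (F : 'I_m.+1 -> R) :
  \sum_j F j = F k + \sum_i F (lift k i).
Proof.
rewrite (bigD1 k)//=; congr (_ + _); case: m k F => [|m] k F.
  by rewrite big_ord0 big1// => j; rewrite !ord1 eqxx.
rewrite (reindex (lift k)) /=; first by apply: eq_bigl => i; rewrite eq_sym neq_lift.
exists (fun j => odflt ord0 (unlift k j)) => [i _|j]; first by rewrite liftK.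
by rewrite inE eq_sym => /unlift_some[i -> ->].
Qed.

Lemma dot_lift m (k : 'I_m.+1) (x y : 'rV[R]_m.+1) :
  dot x y = x ord0 k * y ord0 k + dot (col' k x) (col' k y).
Proof.
by rewrite /dot (sum_lift k); congr (_ + _); apply: eq_bigr => i _; rewrite !mxE.
Qed.

(** Chart of the hyperplane where the [k]-th coordinate equals [s], with inverse [col' k]. *)
Definition insert m (k : 'I_m.+1) (s : R) (y : 'rV[R]_m) : 'rV[R]_m.+1 :=
  \row_j (if unlift k j is Some i then y ord0 i else s).

Lemma insertk m (k : 'I_m.+1) s (y : 'rV[R]_m) : insert k s y ord0 k = s.
Proof. by rewrite mxE unlift_none. Qed.

Lemma col'_insert m (k : 'I_m.+1) s (y : 'rV[R]_m) : col' k (insert k s y) = y.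
Proof. by apply/rowP => i; rewrite !mxE liftK. Qed.

Lemma insert_col' m (k : 'I_m.+1) (x : 'rV[R]_m.+1) :
  insert k (x ord0 k) (col' k x) = x.
Proof. by apply/rowP => j; rewrite !mxE; case: unliftP => [i ->|->] //; rewrite mxE. Qed.

Lemma col'B m (k : 'I_m.+1) (x y : 'rV[R]_m.+1) : col' k (x - y) = col' k x - col' k y.
Proof. by apply/rowP => j; rewrite !mxE. Qed.

Lemma enorm_col' m (k : 'I_m.+1) (x : 'rV[R]_m.+1) : enorm (col' k x) <= enorm x.
Proof.
rewrite ler_sqrt ?dotxx_ge0// (dot_lift k x x) lerDr -expr2 sqr_ge0//.
Qed.

Lemma insertB m (k : 'I_m.+1) s (y z : 'rV[R]_m) :
  insert k s y - insert k s z = insert k 0 (y - z).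
Proof. by apply/rowP => j; rewrite !mxE; case: unlift => [i|]; rewrite ?mxE// subrr. Qed.

Lemma enorm_insert m (k : 'I_m.+1) s (y : 'rV[R]_m) :
  enorm (insert k s y) = Num.sqrt (s ^+ 2 + enorm y ^+ 2).
Proof. by rewrite {1}/enorm (dot_lift k) insertk col'_insert -enorm_sqr expr2. Qed.

Lemma enorm_insert0 m (k : 'I_m.+1) (y : 'rV[R]_m) : enorm (insert k 0 y) = enorm y.
Proof. by rewrite enorm_insert expr0n/= add0r sqrtr_sqr ger0_norm// enorm_ge0. Qed.

Definition normalize n (x : 'rV[R]_n) := (enorm x)^-1 *: x.

(** One half of the factor 2 comes from [x - y] itself, the other from the change of length, by the
    reverse triangle inequality. *)
Lemma normalize_lip n (x y : 'rV[R]_n) : 1 <= enorm x -> 1 <= enorm y ->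
  enorm (normalize x - normalize y) <= 2 * enorm (x - y).
Proof.
move=> x1 y1; have x0 : 0 < enorm x by exact: lt_le_trans x1.
have y0 : 0 < enorm y by exact: lt_le_trans y1.
have -> : normalize x - normalize y =
    (enorm x)^-1 *: (x - y) + ((enorm x)^-1 * (enorm y - enorm x) / enorm y) *: y.
  apply/rowP => i; rewrite !mxE; field.
  by rewrite !gt_eqF.
apply: le_trans (enormD _ _) _; rewrite !enormZ.
rewrite !normrM !normfV (ger0_norm (ltW y0)) (ger0_norm (ltW x0)).
rewrite divfK ?gt_eqF// -mulrDr.
have := ler_enormB y x; rewrite enormB => h.
have i1 : (enorm x)^-1 <= 1 by rewrite invf_le1.
have := enorm_ge0 (x - y) => d0.
apply: (@le_trans _ _ (1 * (enorm (x - y) + enorm (x - y)))).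
  by apply: ler_pM => //; rewrite ?invr_ge0 ?enorm_ge0 ?addr_ge0 ?lerD2l.
by rewrite mul1r mulr2n mulrDl mul1r.
Qed.

(** The sphere is the central projection of the boundary of a cube. This is the part of [E] seen in
    the face where coordinate [kb.1] equals 1 or -1, as a subset of [R^m]. *)
Definition face_set m (E : set 'rV[R]_m.+1) (kb : 'I_m.+1 * bool) : set 'rV[R]_m :=
  [set y | cube m 1 y /\ E (normalize (insert kb.1 ((-1) ^+ kb.2) y))].

Lemma outer_measure_bigcup_fin n (mu : {outer_measure set 'rV[R]_n -> \bar R})
    (I : finType) (F : I -> set 'rV[R]_n) A : A `<=` \bigcup_i F i ->
  (mu A <= \sum_(i : I) mu (F i))%E.
Proof.
move=> AF; pose G (j : nat) := if insub j is Some i0 then F (enum_val (i0 : 'I_#|I|)) else set0.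
apply: (@le_trans _ _ (mu (\big[setU/set0]_(j < #|I|) G j))).
  apply: le_outer_measure => x /AF[i _ Fx].
  rewrite -bigcup_mkord; exists (enum_rank i) => /=; first exact: ltn_ord.
  by rewrite /G valK enum_rankK.
apply: le_trans (outer_measure_subadditive _ _ _) _.
rewrite (reindex (@enum_rank I)) /=; last first.
  by exists enum_val => x _; rewrite ?enum_rankK ?enum_valK.
by apply: lee_sum => i _; rewrite /G valK enum_rankK.
Qed.

(** A unit vector divided by its largest absolute coordinate lands in a face of the cube. The faces
    lie outside the open unit ball, where normalization has Lipschitz constant 2. *)
Lemma hausdorff_sphere_charts m k (E : set 'rV[R]_m.+1) : E `<=` sphere R m.+1 ->
  (hausdorff k E <= \sum_kb (2 ^+ k)%:E * hausdorff k (face_set E kb))%E.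
Proof.
move=> ES.
pose F kb := (fun y => normalize (insert kb.1 ((-1) ^+ (kb.2 : bool)) y)) @` face_set E kb.
apply: le_trans (@outer_measure_bigcup_fin _ (hausdorff_outer k) _ F E _) _.
  move=> u Eu; have Su : enorm u = 1 := ES _ Eu.
  have [k0 _ k0max] := @Order.TotalTheory.arg_maxP _ _ _ (ord0 : 'I_m.+1) xpredT (fun j => `|u ord0 j|) isT.
  have uk : 0 < `|u ord0 k0|.
    rewrite lt_def normr_ge0 andbT; apply/negP => /eqP uk0.
    have : enorm u <= m.+1%:R * 0 by apply: enorm_le_coord => i; rewrite -uk0; exact: k0max.
    by rewrite mulr0 Su ler10.
  pose b := u ord0 k0 < 0.
  have ub : (-1) ^+ b = `|u ord0 k0|^-1 * u ord0 k0.
    rewrite /b; have := uk; rewrite normr_gt0 => u0; case: ltP => h.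
      by rewrite (ltr0_norm h) expr1 invrN mulNr mulVf.
    by rewrite (ger0_norm h) expr0 mulVf.
  have unorm : insert k0 ((-1) ^+ b) (col' k0 (`|u ord0 k0|^-1 *: u)) = `|u ord0 k0|^-1 *: u.
    by rewrite ub -[RHS](insert_col' k0) mxE.
  have nrmu : normalize (`|u ord0 k0|^-1 *: u) = u.
    rewrite /normalize enormZ Su mulr1 scalerA normfV normr_id mulVf ?scale1r//.
    by rewrite invr_eq0 gt_eqF.
  exists (k0, b) => //; exists (col' k0 (`|u ord0 k0|^-1 *: u)); last by rewrite /= unorm nrmu.
  split => [i|]; last by rewrite /= unorm nrmu.
  by rewrite !mxE normrM normfV normr_id mulrC ler_pdivrMr// mul1r; exact: k0max.
apply: lee_sum => -[k0 b] _; apply: hausdorff_lip => // y z _ _.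
have ins1 (x : 'rV[R]_m) : 1 <= enorm (insert k0 ((-1) ^+ b) x).
  have := coord_le_enorm (insert k0 ((-1) ^+ b) x) k0.
  by rewrite insertk normrX normrN1 expr1n.
by apply: le_trans (normalize_lip (ins1 _) (ins1 _)) _; rewrite insertB enorm_insert0.
Qed.

Lemma hausdorff_sphere_fin m : (hausdorff m (sphere R m.+1) < +oo)%E.
Proof.
apply: le_lt_trans (hausdorff_sphere_charts _ (@subset_refl _ _)) _.
rewrite lte_sum_pinfty// => kb _.
rewrite lte_mul_pinfty ?lee_fin ?exprn_ge0//.
apply: le_lt_trans (@hausdorff_cube_fin R m 1 ltr01).
by apply: (le_outer_measure (hausdorff_outer m)) => y [].
Qed.

(* Infinitely many disjoint translates of the set fit in a larger cube. *)
Lemma hausdorff_hyperplane m (w : 'rV[R]_m) (c : R) : w != 0 ->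
  hausdorff m (cube m 1 `&` [set y | dot y w = c]) = 0%E.
Proof.
move=> w0; set E := cube m 1 `&` _; have nw : 0 < enorm w by rewrite enorm_gt0.
pose C := cube m (1 + enorm w).
have Cfin : (hausdorff m C < +oo)%E by apply: hausdorff_cube_fin; rewrite addr_gt0.
have C0 : (0 <= hausdorff m C)%E := outer_measure_ge0 (hausdorff_outer m) C.
have E0 : (0 <= hausdorff m E)%E := outer_measure_ge0 (hausdorff_outer m) E.
have EC : (hausdorff m E <= hausdorff m C)%E.
  apply: (le_outer_measure (hausdorff_outer m)) => y [Ey _] i.
  by apply: le_trans (Ey i) _; rewrite lerDl enorm_ge0.
have Efin : hausdorff m E \is a fin_num by rewrite ge0_fin_numE// (le_lt_trans EC).
(* The half-space contains the [j] translates of [E] by multiples [i / N.+1] of [w] with [i < j]. It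
   is at distance at least [enorm w / N.+1] from the next translate, so they are added up one at a
   time. *)
have trans N j : (j <= N)%N -> ((j%:R)%:E * hausdorff m E <=
    hausdorff m (C `&` [set y | (dot y w <= c + ((j%:R - 1) / N.+1%:R) * dot w w)%R]))%E.
  elim: j => [|j IH] jN; first by rewrite mul0e (outer_measure_ge0 (hausdorff_outer m)).
  pose t : R := j%:R / N.+1%:R.
  have t0 : 0 <= t by rewrite divr_ge0.
  have t1 : t <= 1 by rewrite ler_pdivrMr// mul1r ler_nat ltnW// (leq_trans jN).
  pose Ej := (fun y => y + t *: w) @` E.
  have EEj : (hausdorff m E <= hausdorff m Ej)%E.
    have {1}-> : E = (fun y => y - t *: w) @` Ej.
      apply/seteqP; split => [y Ey|_ [_ [y Ey <-] <-]]; last by rewrite /= addrK.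
      by exists (y + t *: w); [exists y|rewrite /= addrK].
    rewrite -[leRHS]mul1e -(expr1n R m); apply: hausdorff_lip => // x y _ _.
    by rewrite mul1r opprB addrA subrK.
  rewrite -natr1 EFinD ge0_muleDl ?lee_fin// mul1e.
  apply: le_trans (leeD (IH (ltnW jN)) EEj) _.
  have d0 : 0 < enorm w / N.+1%:R by rewrite divr_gt0.
  refine (le_trans (@hausdorff_metric _ _ _ _ Ej _ d0 _) _).
    move=> x _ [_ hx] [y [_ hy] <-].
    rewrite ler_pdivrMr// -(ler_pM2r nw) -expr2 enorm_sqr mulrAC -ler_pdivrMr//.
    rewrite enormB; apply: le_trans (le_dot _ _).
    move: hx hy => /= hx hy; rewrite !dotE hy.
    have tE : t * dot w w = (j%:R - 1) / N.+1%:R * dot w w + dot w w / N.+1%:R.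
      by rewrite /t mulrBl mul1r mulrBl [X in _ - X]mulrC subrK.
    move: hx; rewrite tE; move: (_ * dot w w) (dot w w / _) => a b; lra.
  apply: (le_outer_measure (hausdorff_outer m)) => x [[Cx /= hx]|[y [Ey /= hy] <-]].
    split => //=; apply: le_trans hx _; rewrite lerD2l ler_wpM2r ?dotxx_ge0//.
    by rewrite ler_wpM2r// lerD2r lerDl.
  split => /= [i|].
    rewrite !mxE; apply: le_trans (ler_normD _ _) _; apply: lerD; first exact: Ey.
    rewrite normrM (ger0_norm t0); apply: le_trans (_ : 1 * enorm w <= _).
      by apply: ler_pM => //; exact: coord_le_enorm.
    by rewrite mul1r.
  by rewrite !dotE hy addrK.
apply/eqP; rewrite eq_le E0 andbT; rewrite leNgt; apply/negP => Epos.
pose e := fine (hausdorff m E); pose a := fine (hausdorff m C).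
have e0 : 0 < e by rewrite -lte_fin /e fineK.
have hN N : N%:R * e <= a.
  rewrite -lee_fin EFinM /e /a !fineK// ?ge0_fin_numE//.
  apply: le_trans (trans N N (leqnn _)) _.
  by apply: (le_outer_measure (hausdorff_outer m)) => x [].
have := truncnS_gt (a / e); rewrite ltr_pdivrMr// ltNge => /negP; apply.
exact: hN.
Qed.

(** Each chart turns the great sphere into a hyperplane section of the cube with normal [col' k w].
    If that vector vanishes, [w] is a multiple of the [k]-th basis vector and the section is
    empty. *)
Lemma hausdorff_great_sphere m (w : 'rV[R]_m.+1) : w != 0 ->
  hausdorff m (sphere R m.+1 `&` [set u | dot u w = 0]) = 0%E.
Proof.
move=> w0; apply/eqP; rewrite eq_le (outer_measure_ge0 (hausdorff_outer m)) andbT.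
apply: le_trans (hausdorff_sphere_charts _ (@subIsetl _ _ _)) _.
rewrite big1// => -[k b] _; pose s : R := (-1) ^+ b.
have s1 : s != 0 by rewrite signr_eq0.
apply/eqP; rewrite mule_eq0; apply/orP; right.
rewrite eq_le (outer_measure_ge0 (hausdorff_outer m)) andbT.
have sub : face_set (sphere R m.+1 `&` [set u | dot u w = 0]) (k, b) `<=`
    cube m 1 `&` [set y | dot y (col' k w) = - (s * w ord0 k)].
  move=> y [Cy [Sy /= yw]]; split => //=; apply/eqP.
  change (dot (normalize (insert k s y)) w = 0) in yw.
  move: yw => /eqP; rewrite dotZl mulf_eq0 invr_eq0 enorm_eq0 => /orP[/eqP y0|].
    by move: (insertk k s y); rewrite y0 mxE => /eqP; rewrite eq_sym (negbTE s1).
  by rewrite (dot_lift k) insertk col'_insert addr_eq0 => /eqP ->; rewrite opprK.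
apply: le_trans (le_outer_measure (hausdorff_outer m) _ _ sub) _.
have [w'0|w'0] := eqVneq (col' k w) 0; last by rewrite /= hausdorff_hyperplane.
rewrite w'0 (_ : _ `&` _ = set0) ?outer_measure0//.
rewrite -subset0 => y [_ /=]; rewrite dot0r => /esym/eqP.
rewrite oppr_eq0 mulf_eq0 (negbTE s1)/= => /eqP wk0.
by move: w0; rewrite -(insert_col' k w) wk0 w'0 => /eqP; apply; apply/rowP => j;
  rewrite !mxE; case: unlift => // i; rewrite mxE.
Qed.

End sphere_charts.

(** * Lower bound for the measure of strips *)

Section strip.
Context {R : realType}.

Lemma hausdorff_translate n k (a : 'rV[R]_n) (A B : set 'rV[R]_n) :
  (forall x, A x -> B (x + a)) -> (hausdorff k A <= hausdorff k B)%E.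
Proof.
move=> AB; apply: (@le_trans _ _ (hausdorff k ((fun y => y - a) @` B))).
  apply: (le_outer_measure (hausdorff_outer k)) => x /AB Bx.
  by exists (x + a) => //; rewrite addrK.
rewrite -[leRHS]mul1e -(expr1n R k); apply: hausdorff_lip => // x y _ _.
by rewrite mul1r opprB addrA subrK.
Qed.

Lemma exists_orthogonal m (w : 'rV[R]_m.+1) : (0 < m)%N -> w != 0 ->
  exists2 v, sphere R m.+1 v & dot w v = 0.
Proof.
move=> m0 w0; have [j wj] : exists j, w ord0 j != 0.
  apply: contrapT => /forallNP h; case/eqP: w0; apply/rowP => j; rewrite mxE.
  by apply/eqP/negPn/negP; exact: h.
(* A second coordinate exists as [m > 0]. The vector [v] below is the projection of [w] to these two
   coordinates, turned by a right angle. *)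
pose k := lift j (Ordinal m0).
have kj : k != j by rewrite eq_sym neq_lift.
pose v : 'rV[R]_m.+1 := w ord0 j *: delta_mx ord0 k - w ord0 k *: delta_mx ord0 j.
have v0 : v != 0.
  apply/negP => /eqP /rowP /(_ k); rewrite !mxE !eqxx/= (negbTE kj) mulr1 mulr0 subr0.
  exact/eqP.
have dotd (l : 'I_m.+1) : dot w (delta_mx ord0 l) = w ord0 l.
  rewrite /dot (bigD1 l)//= mxE !eqxx mulr1 big1 ?addr0// => i il.
  by rewrite mxE (negbTE il) andbF mulr0.
exists ((enorm v)^-1 *: v); first exact: enorm_normalize.
by rewrite !dotE !dotd [w ord0 k * _]mulrC subrr mulr0.
Qed.

(** Omitting a coordinate [k] with [v_k] nonzero does not increase distances, and the image of the
    flat ball, moved to the origin, contains a box of full dimension [m]. *)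
Lemma hausdorff_flat_ball m (v x0 : 'rV[R]_m.+1) (r : R) : (0 < m)%N -> 0 < r ->
  v != 0 ->
  (0 < hausdorff m [set x | (dot (x - x0) v = 0 /\ enorm (x - x0) <= r)%R])%E.
Proof.
move=> m0 r0 v0; have [k vk] : exists j, v ord0 j != 0.
  apply: contrapT => /forallNP h; case/eqP: v0; apply/rowP => j; rewrite mxE.
  by apply/eqP/negPn/negP; exact: h.
set B := [set x | _].
(* The vector of the hyperplane above [z] has length at most [c * enorm z]; the side [s] keeps the
   points above the box in the ball. *)
pose c := 1 + enorm (col' k v) / `|v ord0 k|.
have c0 : 0 < c by rewrite ltr_pwDl// divr_ge0// enorm_ge0.
pose s := r / (m%:R * c).
have s0 : 0 < s by rewrite divr_gt0// mulr_gt0// ltr0n.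
apply: lt_le_trans (hausdorff_box_gt0 m0 s0) _.
apply: (@le_trans _ _ (hausdorff m ((fun x => col' k (x - x0)) @` B))).
  apply: (le_outer_measure (hausdorff_outer m)) => z sz.
  pose t := - dot z (col' k v) / v ord0 k.
  exists (x0 + insert k t z); last by rewrite addrC addKr col'_insert.
  rewrite /B/= addrC addKr; split.
    by rewrite (dot_lift k) insertk col'_insert /t divfK// addNr.
  have zs : enorm z <= m%:R * s.
    apply: enorm_le_coord => i; have /andP[z0 z1] := sz i.
    by rewrite ger0_norm.
  have tz : `|t| <= enorm z * (enorm (col' k v) / `|v ord0 k|).
    by rewrite /t normrM normrN normfV mulrA ler_wpM2r ?invr_ge0// cauchy_schwarz.
  rewrite enorm_insert; apply: (@le_trans _ _ (`|t| + enorm z)).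
    rewrite -ler_sqr ?nnegrE ?sqrtr_ge0 ?addr_ge0 ?enorm_ge0//.
    rewrite sqr_sqrtr ?addr_ge0 ?sqr_ge0// sqrrD real_normK ?num_real//.
    by rewrite lerD2r lerDl mulrn_wge0// mulr_ge0 ?enorm_ge0.
  apply: (@le_trans _ _ (enorm z * c)).
    by rewrite /c mulrDr mulr1 addrC lerD2l.
  apply: le_trans (_ : m%:R * s * c <= _); first by rewrite ler_wpM2r// ltW.
  by rewrite /s mulrAC mulrC divfK// gt_eqF// mulr_gt0// ltr0n.
rewrite -[leRHS]mul1e -(expr1n R m); apply: hausdorff_lip => // x y _ _.
by rewrite mul1r -col'B; apply: le_trans (enorm_col' _ _) _; rewrite opprB addrA subrK.
Qed.

(* In the chart [dot x v = 1] with [v] orthogonal to [w0], a ball is covered by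
   the [N.+1] layers [max_i <x + k w, u i> > 0 >= max_i <x + (k+1) w, u i>],
   [w := w1 / N.+1], all of which can be translated along [w0] into the strip
   [0 < max_i <x, u i> <= D / N.+1]. *)
Lemma hausdorff_strip m (T : finType) (I : pred T) (u : T -> 'rV[R]_m.+1)
    (w0 : 'rV[R]_m.+1) (i0 : T) : (0 < m)%N -> I i0 ->
  (forall i, sphere R m.+1 (u i)) -> (forall i, I i -> dot w0 (u i) < 0) ->
  exists c D : R, [/\ 0 < c, 0 < D & forall N : nat,
    ((c / N.+1%:R)%:E <= hausdorff m [set x | [/\ sphere R m.+1 x,
      exists2 i, I i & (0 < dot x (u i))%R &
      forall i, I i -> (dot x (u i) <= D / N.+1%:R)%R]])%E].
Proof.
move=> m0 Ii0 u1 w0u.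
have u1' i : enorm (u i) = 1 := u1 i.
have w00 : w0 != 0.
  by apply/negP => /eqP w00; have := w0u _ Ii0; rewrite w00 dot0l ltxx.
have [v v1 w0v] := exists_orthogonal m0 w00.
have v1' : enorm v = 1 := v1.
have [d d0 w0d] : exists2 d, 0 < d & forall i, I i -> dot w0 (u i) <= - d.
  pose F i := - dot w0 (u i).
  have [j Ij jmin] := @Order.TotalTheory.arg_minP _ _ _ i0 I F Ii0.
  exists (F j); first by rewrite oppr_gt0 w0u.
  by move=> i Ii; rewrite lerNr; exact: jmin.
(* The term [s * dot w0 (u i) <= -2] outweighs [dot v (u i)], which lies between -1 and 1: every
   functional with [I i] is at least 1 at [x1] and at most -1 at [x1 + w1]. A ball of radius 1/2
   keeps these signs. *)
pose s := 2 / d; have s0 : 0 < s by rewrite divr_gt0.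
pose x1 := v - s *: w0; pose w1 := (2 * s) *: w0.
have sd i : I i -> s * dot w0 (u i) <= - 2.
  move=> Ii; apply: le_trans (_ : s * - d <= _).
    by rewrite ler_wpM2l ?w0d// ltW.
  by rewrite mulrN /s divfK ?gt_eqF.
have dotv i : `|dot v (u i)| <= 1.
  by apply: le_trans (cauchy_schwarz _ _) _; rewrite v1' u1' mulr1.
have x1u i : I i -> 1 <= dot x1 (u i).
  move=> /sd h; have := dotv i; rewrite ler_norml /x1 !dotE => /andP[h1 h2]; lra.
have x1wu i : I i -> dot (x1 + w1) (u i) <= -1.
  move=> /sd h; have := dotv i; rewrite ler_norml /x1 /w1 !dotE => /andP[h1 h2]; lra.
pose B := [set x | dot (x - x1) v = 0 /\ (enorm (x - x1) <= 2^-1)%R].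
have vv : dot v v = 1 by rewrite -enorm_sqr v1' expr1n.
have x1v : dot x1 v = 1 by rewrite /x1 !dotE w0v mulr0 subr0.
have w1v : dot w1 v = 0 by rewrite dotZl w0v mulr0.
have Bu x i : B x -> `|dot x (u i) - dot x1 (u i)| <= 2^-1.
  move=> [_ xB]; rewrite -dotNl -dotDl.
  by apply: le_trans (cauchy_schwarz _ _) _; rewrite u1' mulr1.
have HB : (0 < hausdorff m B)%E.
  apply: hausdorff_flat_ball => //.
  by rewrite -enorm_eq0 v1' oner_eq0.
pose M := enorm x1 + 1 + enorm w1.
have M0 : 0 < M by rewrite ltr_wpDr ?enorm_ge0// ltr_wpDl ?enorm_ge0.
pose D := enorm w1.
have w10 : 0 < D.
  by rewrite enorm_gt0 scaler_eq0 negb_or w00 andbT gt_eqF// mulr_gt0.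
pose strip N := [set x | [/\ sphere R m.+1 x,
      exists2 i, I i & (0 < dot x (u i))%R &
      forall i, I i -> (dot x (u i) <= D / N.+1%:R)%R]].
pose E N := [set y | [/\ dot y v = 1, (enorm y <= M)%R,
      exists2 i, I i & (0 < dot y (u i))%R &
      forall i, I i -> (dot y (u i) <= D / N.+1%:R)%R]].
(* Lipschitz constant of the map to the chart on unit vectors with [dot x v >= M^-1]: [M] from the
   difference of the vectors, [M ^+ 2] from that of the factors. *)
pose L := M + M ^+ 2; have L0 : 0 < L by rewrite addr_gt0// exprn_gt0.
have EL N : (hausdorff m (E N) <= (L ^+ m)%:E * hausdorff m (strip N))%E.
  pose S' := strip N `&` [set x | M^-1 <= dot x v].
  apply: (@le_trans _ _ (hausdorff m ((fun x => (dot x v)^-1 *: x) @` S'))).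
    apply: (le_outer_measure (hausdorff_outer m)) => y [yv yM [i Ii yi] yD].
    (* Normalizing therefore only lowers the positive values [dot y (u i)], and the image stays in
       the strip. *)
    have y1 : 1 <= enorm y.
      by rewrite -yv; apply: le_trans (le_dot _ _) _; rewrite v1' mulr1.
    have y0 : 0 < enorm y by exact: lt_le_trans y1.
    exists ((enorm y)^-1 *: y); last first.
      by rewrite dotZl yv mulr1 invrK scalerA mulfV ?scale1r// gt_eqF.
    split; last by rewrite /= dotZl yv mulr1 lef_pV2.
    split; first by apply: enorm_normalize; rewrite -enorm_gt0.
      by exists i => //; rewrite dotZl mulr_gt0// invr_gt0.
    move=> j Ij; rewrite dotZl.
    have [h|h] := leP (dot y (u j)) 0.
      apply: (@le_trans _ _ 0); last by rewrite divr_ge0// ltW.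
      by rewrite mulr_ge0_le0// invr_ge0 ltW.
    apply: le_trans (yD _ Ij); by rewrite ler_piMl ?(ltW h) ?invf_le1.
  apply: (@le_trans _ _ ((L ^+ m)%:E * hausdorff m S')%E); last first.
    rewrite lee_pmul2l ?lte_fin ?exprn_gt0//.
    by apply: (le_outer_measure (hausdorff_outer m)) => x [].
  apply: hausdorff_lip => // x y [[Sx _ _] /= xv] [[Sy _ _] /= yv].
  have M'0 : 0 < M^-1 by rewrite invr_gt0.
  have xv0 : 0 < dot x v by exact: lt_le_trans xv.
  have yv0 : 0 < dot y v by exact: lt_le_trans yv.
  have xvM : (dot x v)^-1 <= M by rewrite -[M]invrK lef_pV2 ?posrE.
  have yvM : (dot y v)^-1 <= M by rewrite -[M]invrK lef_pV2 ?posrE.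
  have -> : (dot x v)^-1 *: x - (dot y v)^-1 *: y =
      (dot x v)^-1 *: (x - y) + ((dot x v)^-1 * (dot y v)^-1 * dot (y - x) v) *: y.
    apply/rowP => i; rewrite !dotE !mxE; field.
    by rewrite !gt_eqF.
  have Sy' : enorm y = 1 := Sy.
  apply: le_trans (enormD _ _) _; rewrite !enormZ Sy' mulr1 !normrM.
  rewrite (@ger0_norm _ (dot x v)^-1) ?invr_ge0 ?(ltW xv0)//.
  rewrite (@ger0_norm _ (dot y v)^-1) ?invr_ge0 ?(ltW yv0)//.
  rewrite /L mulrDl; apply: lerD; first by rewrite ler_wpM2r ?enorm_ge0.
  apply: ler_pM => //; first by rewrite mulr_ge0// invr_ge0 ltW.
    by rewrite expr2; apply: ler_pM; rewrite ?invr_ge0 ?(ltW xv0) ?(ltW yv0).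
  by apply: le_trans (cauchy_schwarz _ _) _; rewrite v1' mulr1 enormB.
have BE N : (hausdorff m B <= (N.+1%:R)%:E * hausdorff m (E N))%E.
  pose a (k : nat) : R := k%:R / N.+1%:R.
  pose P k (x : 'rV[R]_m.+1) := [exists i, I i && (0 < dot (x + a k *: w1) (u i))].
  pose Bk (k : 'I_N.+1) := B `&` [set x | P k x && ~~ P k.+1 x].
  apply: le_trans (@outer_measure_bigcup_fin _ _ (hausdorff_outer m) _ Bk B _) _.
    move=> x Bx.
    have P0 : P 0%N x.
      apply/existsP; exists i0; rewrite Ii0 /a mul0r scale0r addr0.
      have := Bu x i0 Bx; have := x1u _ Ii0; rewrite ler_norml => ? /andP[? ?]; lra.
    have PN : ~~ P N.+1 x.
      apply/existsPn => i; rewrite /a divff ?pnatr_eq0// scale1r negb_and -implybE.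
      apply/implyP => Ii; rewrite -leNgt.
      have := Bu x i Bx; have := x1wu _ Ii; rewrite !dotDl ler_norml => ? /andP[? ?]; lra.
    have [k Pk kmax] := ex_maxnP (ex_intro (fun k => P k x && (k <= N)%N) 0%N
      (introT andP (conj P0 (leq0n N)))) (fun k h => proj2 (andP h)).
    have /andP[Pkx kN] := Pk.
    have kN' : (k < N.+1)%N by [].
    exists (Ordinal kN') => //; split => //=; rewrite Pkx/=.
    apply/negP => PS; move: kN; rewrite leq_eqVlt => /orP[/eqP kN|kN].
      by move: PN; rewrite -kN PS.
    by have := kmax k.+1; rewrite PS kN => /(_ isT); rewrite ltnn.
  apply: (@le_trans _ _ (\sum_(k < N.+1) hausdorff m (E N))%E); last first.
    by rewrite mule_natl big_const_ord; elim: (N.+1) => // k IH; rewrite iterS muleS leeD2l.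
  apply: lee_sum => k _; apply: (@hausdorff_translate _ _ (a k *: w1)) => x [Bx /= /andP[Px nPx]].
  have [xv xB] := Bx.
  have a0 : 0 <= a k by rewrite divr_ge0.
  have a1 : a k <= 1 by rewrite ler_pdivrMr// mul1r ler_nat ltnW// ltn_ord.
  split.
  - rewrite dotDl dotZl w1v mulr0 addr0; apply/eqP; rewrite -subr_eq0 -{1}x1v.
    by rewrite -dotNl -dotDl xv.
  - have hx : enorm x <= enorm x1 + 1.
      rewrite -[x](subrK x1) addrC; apply: le_trans (enormD _ _) _.
      rewrite lerD2l; apply: le_trans xB _; lra.
    apply: le_trans (enormD _ _) _; apply: lerD => //.
    by rewrite enormZ ger0_norm// ler_piMl// enorm_ge0.
  - by have /existsP[i /andP[Ii h]] := Px; exists i.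
  - move=> i Ii; have /existsPn/(_ i) := nPx; rewrite Ii/= -leNgt.
    (* A step by [w1 / N.+1] lowers each functional by at most [D / N.+1], since [D] is the norm of
       [w1]. *)
    have -> : a k.+1 = a k + N.+1%:R^-1 by rewrite /a -natr1 mulrDl mul1r.
    rewrite scalerDl addrA [dot (_ + _ + _) _]dotDl => h; rewrite -subr_le0; apply: le_trans h.
    rewrite lerD2l dotZl [leRHS]mulrC -mulNr ler_wpM2r//.
    rewrite lerNl; apply: le_trans (ler_norm _) _; rewrite normrN.
    by apply: le_trans (cauchy_schwarz _ _) _; rewrite u1' mulr1.
have [b b0 hb] : exists2 b : R, 0 < b & (b%:E <= hausdorff m B)%E.
  have [Boo|Boo] := eqVneq (hausdorff m B) +oo%E.
    by exists 1 => //; rewrite Boo leey.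
  have Bf : hausdorff m B \is a fin_num.
    by rewrite ge0_fin_numE ?ltey// ltW.
  by exists (fine (hausdorff m B)); rewrite -?lte_fin fineK.
exists (b / L ^+ m), D; split => //; first by rewrite divr_gt0// exprn_gt0.
move=> N; have := le_trans hb (BE N).
move=> /le_trans /(_ (lee_wpmul2l _ (EL N))); rewrite lee_fin => /(_ (ler0n _ _)).
rewrite muleA -EFinM => h.
have LN : 0 < N.+1%:R * L ^+ m by rewrite mulr_gt0// exprn_gt0.
rewrite (_ : b / L ^+ m / N.+1%:R = (N.+1%:R * L ^+ m)^-1 * b); last first.
  by rewrite invfM; ring.
by rewrite EFinM lee_pdivrMl.
Qed.

End strip.

(** * Polyhedra and their radial functions *)

Section polyhedra.
Context {R : realType} {n k : nat}.
Variable u : 'I_k -> 'rV[R]_n.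
Hypothesis u_unit : forall i, sphere R n (u i).
Hypothesis u_span : forall v, sphere R n v -> exists i, 0 < dot v (u i).
Implicit Types (z : 'I_k -> R) (x v d : 'rV[R]_n).

Definition polyhedron z : set 'rV[R]_n := [set x | forall i, dot x (u i) <= z i].

Let enorm_u i : enorm (u i) = 1. Proof. exact: u_unit. Qed.

Lemma dot_unit_le v i : dot v (u i) <= enorm v.
Proof. by apply: le_trans (le_dot _ _) _; rewrite enorm_u mulr1. Qed.

(** Compactness: the open sets of those [v] with [dot v (u i) > 1 / N.+1] cover the sphere. *)
Lemma span_delta : exists2 d : R, 0 < d & forall v, sphere R n v -> exists i, d <= dot v (u i).
Proof.
have := @compact_sphere R n; rewrite compact_cover.
move=> /(_ ('I_k * nat)%type setT (fun p => [set v | p.2.+1%:R^-1 < dot v (u p.1)])).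
case=> [[i N] _ /=|v Sv|D _ SD].
- rewrite (_ : [set v | _] = (dot^~ (u i)) @^-1` [set t | N.+1%:R^-1 < t]) //.
  by apply: open_comp => [x _|]; [exact: continuous_dotl|exact: open_gt].
- have [i vi] := u_span Sv; have [N] : exists N, 0 + N.+1%:R^-1 < dot v (u i).
    exact/ltr_add_invr.
  by rewrite add0r => ?; exists (i, N).
have [M DM] : exists M, forall p, p \in finmap.enum_fset D -> (p.2 <= M)%N.
  elim: (finmap.enum_fset D) => [|p s [M IH]]; first by exists 0%N.
  exists (maxn p.2 M) => r; rewrite in_cons => /orP[/eqP ->|/IH h]; first exact: leq_maxl.
  exact: leq_trans h (leq_maxr _ _).
exists M.+1%:R^-1 => // v /SD [[i N] /= iD vi]; exists i; apply: le_trans (ltW vi).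
by rewrite lef_pV2 ?posrE// ler_nat ltnS; exact: (DM _ iD).
Qed.

Lemma span_dir d : d != 0 -> exists i, 0 < dot d (u i).
Proof.
move=> d0; have [i] := u_span (enorm_normalize d0).
by rewrite dotZl pmulr_rgt0 ?invr_gt0 ?enorm_gt0//; exists i.
Qed.

Lemma polyhedron_bounded z M : (forall i, z i <= M) ->
  exists B, forall x, polyhedron z x -> enorm x <= B.
Proof.
move=> zM; have [e e0 ue] := span_delta; exists (`|M| / e) => x Px.
have [->|x0] := eqVneq x 0; first by rewrite enorm0 divr_ge0// ltW.
have [i ei] := ue _ (enorm_normalize x0).
have nx : 0 < enorm x by rewrite enorm_gt0.
rewrite ler_pdivlMr//; apply: le_trans (_ : enorm x * dot ((enorm x)^-1 *: x) (u i) <= _).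
  by rewrite ler_wpM2l// ltW.
rewrite dotZl mulVKf ?gt_eqF//; apply: le_trans (Px i) _.
by apply: le_trans (zM i) _; exact: ler_norm.
Qed.

Lemma bounded_finfun z : exists M, forall i, z i <= M.
Proof. by exists (\sum_i `|z i|) => i; rewrite (bigD1 i)//= ler_wpDr ?sumr_ge0// ler_norm. Qed.

Lemma closed_dot_le (w : 'rV[R]_n) a : closed [set x | dot x w <= a].
Proof.
rewrite (_ : [set x | _] = (dot^~ w) @^-1` [set t | t <= a])//.
apply: closed_comp => [x _|]; first exact: continuous_dotl.
exact: closed_le.
Qed.

Lemma closed_polyhedron z : closed (polyhedron z).
Proof.
rewrite (_ : polyhedron z = \bigcap_(i in setT) [set x | dot x (u i) <= z i]).
  by apply: closed_bigI => i _; exact: closed_dot_le.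
by apply/seteqP; split => x /= h i; [move=> _; exact: h|exact: h].
Qed.

Lemma compact_polyhedron z : compact (polyhedron z).
Proof.
have [M zM] := bounded_finfun z; have [B hB] := polyhedron_bounded zM.
exact: (bounded_enorm_compact (@closed_polyhedron z) hB).
Qed.

Lemma convex_polyhedron z : convex_set (polyhedron z).
Proof.
move=> x y l; rewrite !inE => Px Py i.
rewrite /conv/= dotDl !dotZl.
have -> : z i = l%:num * z i + (1 - l%:num) * z i by ring.
by apply: lerD; rewrite ler_wpM2l// subr_ge0.
Qed.

Lemma interior_polyhedron z : (forall i, 0 < z i) -> interior (polyhedron z) 0.
Proof.
move=> z0; have [e e0 ez] : exists2 e : R, 0 < e & forall i, e <= z i.
  case: (posnP k) => [k0|k0].
    by exists 1 => // i; case: (i) => j hj; exfalso; move: hj; rewrite k0.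
  have [j _ jmin] := @Order.TotalTheory.arg_minP _ _ _ (Ordinal k0) xpredT z isT.
  by exists (z j) => // i; exact: jmin.
have h : nbhs (0 : 'rV[R]_n) [set y | enorm (0 - y) < e] by exact: near_enorm.
rewrite /interior/=; apply: filterS h => y /= ye i.
by apply: le_trans (dot_unit_le _ _) _; rewrite -enormN -sub0r (le_trans (ltW ye)).
Qed.

Definition tight z x : {set 'I_k} := [set i | dot x (u i) == z i]%SET.

(** Algebraic form of an extreme point: the normals of the tight constraints span the space. *)
Definition vertex z : set 'rV[R]_n :=
  [set x | polyhedron z x /\ forall d, (forall i, i \in tight z x -> dot d (u i) = 0) -> d = 0].

(** A vertex is determined by its tight constraints, since the difference of two points with the
    same ones is orthogonal to all their normals. *)
Lemma finite_vertex z : finite_set (vertex z).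
Proof.
pose g A := if pselect (exists2 x, vertex z x & tight z x = A) is left h
  then projT1 (cid2 h) else 0.
apply: (@sub_finite_set _ _ (g @` setT)); last first.
  by apply: finite_image; exact: finite_finset.
move=> x Vx; exists (tight z x) => //; rewrite /g.
case: pselect => [h|[]]; last by exists x.
case: cid2 => y /= Vy xy; apply/eqP; rewrite -subr_eq0; apply/eqP.
apply: (Vx.2) => i ix; rewrite dotDl dotNl.
have : i \in tight z y by rewrite xy.
by move: ix; rewrite !inE => /eqP -> /eqP ->; rewrite subrr.
Qed.

(* Walking from [x] along [d] one first hits a new facet; doing so in both
   directions writes a non-vertex as a convex combination of points with more
   tight constraints. *)
Lemma polyhedron_walk z x d : polyhedron z x -> d != 0 ->
  (forall i, i \in tight z x -> dot d (u i) = 0) ->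
  exists2 t : R, 0 < t & polyhedron z (x + t *: d) /\ tight z x \proper tight z (x + t *: d).
Proof.
move=> Px d0 dT; have [i0 di0] := span_dir d0.
pose F i := (z i - dot x (u i)) / dot d (u i).
have [j dj jmin] := @Order.TotalTheory.arg_minP _ _ _ i0 (fun i => 0 < dot d (u i)) F di0.
have jT : j \notin tight z x by apply/negP => /dT dj0; rewrite dj0 ltxx in dj.
exists (F j).
  rewrite divr_gt0// subr_gt0 lt_neqAle Px andbT.
  by move: jT; rewrite inE.
split=> [i|].
  rewrite dotDl dotZl; have [di|di] := leP (dot d (u i)) 0.
    apply: le_trans (Px i); rewrite gerDl mulr_ge0_le0// divr_ge0 ?(ltW dj)//.
    by rewrite subr_ge0 Px.
  by rewrite -lerBrDl -ler_pdivlMr//; exact: jmin.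
apply/properP; split.
  apply/fintype.subsetP => i iT; have := dT i iT; move: iT; rewrite !inE dotDl dotZl => /eqP -> ->.
  by rewrite mulr0 addr0.
exists j => //; rewrite inE dotDl dotZl /F divfK ?(gt_eqF dj)//; apply/eqP; ring.
Qed.

(** Induction on the number of constraints that are not tight at the point. *)
Lemma polyhedron_hull z : polyhedron z = convex_hull (vertex z).
Proof.
apply/seteqP; split; last first.
  by apply: smallest_sub => [|x []//]; exact: convex_polyhedron.
move=> x Px A /= [cA VA].
have [N] := ubnP #|~: tight z x|%SET; elim: N => // N IH in x Px *; rewrite ltnS => xN.
have [Vx|nVx] := pselect (vertex z x); first exact: VA.
have [d dT d0] : exists2 d, (forall i, i \in tight z x -> dot d (u i) = 0) & d != 0.
  apply: contrapT => h; apply: nVx; split => // d dT; apply/eqP/negPn/negP => d0.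
  by apply: h; exists d.
have step y : polyhedron z y -> tight z x \proper tight z y -> A y.
  move=> Py xy; apply: IH => //; apply: leq_trans xN; apply: proper_card.
  by rewrite finset.properC.
have [t t0 [Pt Tt]] := polyhedron_walk Px d0 dT.
have [||s s0 [Ps Ts]] := @polyhedron_walk z x (- d) Px; first by rewrite oppr_eq0.
  by move=> i /dT; rewrite dotNl => ->; rewrite oppr0.
have ts : 0 < s + t by rewrite addr_gt0.
have l01 : 0 <= s / (s + t) <= 1.
  by rewrite divr_ge0 ?(ltW s0) ?(ltW ts)//= ler_pdivrMr// mul1r lerDl ltW.
pose l := s / (s + t).
have Al : A (l *: (x + t *: d) + (1 - l) *: (x + s *: - d)).
  have := cA (x + t *: d) (x + s *: - d) (Itv01 (proj1 (andP l01)) (proj2 (andP l01))).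
  by rewrite !inE; apply; exact: step.
suff -> : x = l *: (x + t *: d) + (1 - l) *: (x + s *: - d) by [].
apply/rowP => i; rewrite /l !mxE; field.
by rewrite gt_eqF.
Qed.

Lemma polytope_polyhedron z : (forall i, 0 < z i) -> polytope (polyhedron z).
Proof.
move=> z0; split; first by exists 0; exact: interior_polyhedron.
by exists (vertex z); [exact: finite_vertex|exact: polyhedron_hull].
Qed.

Lemma convex_body_polyhedron z : (forall i, 0 < z i) -> convex_body_o (polyhedron z).
Proof.
by move=> z0; split; [exact: compact_polyhedron|exact: convex_polyhedron|exact: interior_polyhedron].
Qed.

Section radial_polyhedron.
Variable z : 'I_k -> R.
Hypothesis z0 : forall i, 0 <= z i.
Let A v := [set t : R | 0 <= t /\ polyhedron z (t *: v)].

Let A0 v : A v 0.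
Proof. by split => // i; rewrite scale0r dot0l. Qed.

Let A_ub v i : 0 < dot v (u i) -> ubound (A v) (z i / dot v (u i)).
Proof. by move=> vi t [t0 /(_ i)]; rewrite dotZl ler_pdivlMr. Qed.

Lemma le_radial v (t : R) : sphere R n v -> 0 <= t ->
  t <= radial (polyhedron z) v <-> forall i, t * dot v (u i) <= z i.
Proof.
move=> Sv t0; split => [tr i|ti].
  have [vi|vi] := leP (dot v (u i)) 0.
    by apply: le_trans (z0 i); rewrite mulr_ge0_le0.
  rewrite -ler_pdivlMr//; apply: le_trans tr _; apply: ge_sup; first by exists 0; exact: A0.
  exact: A_ub.
have [i vi] := u_span Sv; apply: ub_le_sup; first by exists (z i / dot v (u i)); exact: A_ub.
by split => // j; rewrite dotZl.
Qed.

Lemma radial_ge0 v : sphere R n v -> 0 <= radial (polyhedron z) v.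
Proof. by move=> Sv; apply/le_radial => // i; rewrite mul0r. Qed.

Lemma radial_dot v i : sphere R n v -> radial (polyhedron z) v * dot v (u i) <= z i.
Proof. by move=> Sv; move: i; apply/le_radial => //; exact: radial_ge0. Qed.

Lemma polyhedron_radial v : sphere R n v -> polyhedron z (radial (polyhedron z) v *: v).
Proof. by move=> Sv i; rewrite dotZl; exact: radial_dot. Qed.

(** The radial function is the least of the ratios [z i / dot v (u i)] with positive denominator. *)
Lemma radial_tight v : sphere R n v ->
  exists2 i, 0 < dot v (u i) & radial (polyhedron z) v * dot v (u i) = z i.
Proof.
move=> Sv; have [i0 vi0] := u_span Sv.
pose F i := z i / dot v (u i).
have [j vj jmin] := @Order.TotalTheory.arg_minP _ _ _ i0 (fun i => 0 < dot v (u i)) F vi0.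
exists j => //; apply/eqP; rewrite eq_le radial_dot//= -ler_pdivrMr//.
apply/le_radial => //; first by rewrite divr_ge0 ?z0// ltW.
move=> i; have [vi|vi] := leP (dot v (u i)) 0.
  by apply: le_trans (z0 i); rewrite mulr_ge0_le0// divr_ge0 ?z0// ltW.
by rewrite -ler_pdivlMr//; exact: jmin.
Qed.

End radial_polyhedron.

Lemma le_radial_polyhedron z z' v : (forall i, 0 <= z i) -> (forall i, z i <= z' i) ->
  sphere R n v -> radial (polyhedron z) v <= radial (polyhedron z') v.
Proof.
move=> z0 zz' Sv.
apply/le_radial => // [i|| i]; [exact: le_trans (zz' i)|exact: radial_ge0|].
by apply: le_trans (zz' i); exact: radial_dot.
Qed.

Lemma radialZ z a v : (forall i, 0 <= z i) -> 0 < a -> sphere R n v ->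
  radial (polyhedron (fun i => a * z i)) v = a * radial (polyhedron z) v.
Proof.
move=> z0 a0 Sv; have az0 i : 0 <= a * z i by rewrite mulr_ge0// ltW.
apply/eqP; rewrite eq_le; apply/andP; split.
  rewrite mulrC -ler_pdivrMr//; apply/le_radial => // [|i].
    by rewrite divr_ge0 ?radial_ge0// ltW.
  by rewrite mulrAC ler_pdivrMr// [leRHS]mulrC; exact: radial_dot.
apply/le_radial => // [|i]; first by rewrite mulr_ge0 ?radial_ge0// ltW.
by rewrite -mulrA ler_wpM2l ?(ltW a0)//; exact: radial_dot.
Qed.

Lemma radial_eq0 z v i : (forall i, 0 <= z i) -> sphere R n v -> z i = 0 ->
  0 < dot v (u i) -> radial (polyhedron z) v = 0.
Proof.
move=> z0 Sv zi vi; apply/eqP; rewrite eq_le radial_ge0// andbT.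
by have := radial_dot z0 i Sv; rewrite zi pmulr_lle0.
Qed.

(** The constant is uniform in [z] and [v], and provides the bound that dominates the integrands. *)
Lemma radial_bounded : exists2 C : R, 0 < C & forall z M v, (forall i, 0 <= z i <= M) ->
  sphere R n v -> radial (polyhedron z) v <= C * M.
Proof.
have [d d0 ud] := span_delta; exists d^-1; first by rewrite invr_gt0.
move=> z M v zM Sv; have [i di] := ud _ Sv; have /andP[z0 ziM] := zM i.
rewrite mulrC ler_pdivlMr//.
have z0' j : 0 <= z j by have /andP[] := zM j.
apply: le_trans ziM; apply: le_trans (radial_dot z0' i Sv).
by rewrite ler_wpM2l// radial_ge0.
Qed.

(** For [a >= 0] the set is cut out of the sphere by half-spaces. This gives the measurability of
    the radial function without its continuity. *)
Lemma closed_radial_ge z a : (forall i, 0 <= z i) ->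
  closed (sphere R n `&` [set v | a <= radial (polyhedron z) v]).
Proof.
move=> z0; have [a0|a0] := leP 0 a; last first.
  rewrite (_ : _ `&` _ = sphere R n); first exact: closed_sphere.
  apply/seteqP; split => v; first by case.
  by move=> Sv; split => //=; apply: le_trans (radial_ge0 z0 Sv); exact: ltW.
rewrite (_ : _ `&` _ = sphere R n `&` \bigcap_(i in setT) [set v | dot v (a *: u i) <= z i]).
  apply: closedI; first exact: closed_sphere.
  by apply: closed_bigI => i _; exact: closed_dot_le.
apply/seteqP; split => v /= [Sv h]; split => //.
  by move=> i _ /=; rewrite dotZr; move: i; apply/le_radial.
by apply/le_radial => // i; have := h i I; rewrite /= dotZr.
Qed.

End polyhedra.

(** * Integration on the sphere *)

Section powR_extras.
Context {R : realType}.

(** At negative arguments the power is a default value that would spoil continuity at 0, hence the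
    absolute value. *)
Lemma continuous_norm_powR (p : R) : 0 < p -> continuous (fun t : R => `|t| `^ p).
Proof.
move=> p0 t; have [->|t0] := eqVneq t 0.
  apply/(@cvgrPdist_lt _ _ _ (nbhs (0 : R)) _ (fun t : R => `|t| `^ p)) => e e0.
  have e'0 : 0 < e `^ p^-1 by exact: powR_gt0.
  apply: filterS (nbhsx_ballx (0 : R) _ e'0) => y; rewrite -ball_normE/= sub0r normrN => ye.
  rewrite normr0 powR0 ?gt_eqF// sub0r normrN ger0_norm ?powR_ge0//.
  have <- : (e `^ p^-1) `^ p = e by rewrite -powRrM mulVf ?gt_eqF// powRr1 ?ltW.
  by rewrite gt0_ltr_powR// nnegrE ?ltW.
have nt : 0 < `|t| by rewrite normr_gt0.
change {for t, continuous ((@powR R)^~ p \o Num.norm)}.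
apply: continuous_comp; first exact: norm_continuous.
apply: differentiable_continuous; apply/derivable1_diffP.
by apply: derivable_powR; rewrite in_itv/= nt.
Qed.

(** The exponent [n - q] may have either sign; a bound for the absolute value of [a * ln x] serves
    both. *)
Lemma powR_bounds (a r0 r1 : R) : 0 < r0 ->
  exists w0 w1 : R, 0 < w0 /\ forall x, r0 <= x <= r1 -> w0 <= x `^ a <= w1.
Proof.
move=> r00; pose b := `|a| * (`|ln r0| + `|ln r1|).
exists (expR (- b)), (expR b); split; first exact: expR_gt0.
move=> x /andP[x0 x1]; have xp : 0 < x by exact: lt_le_trans x0.
have l0 : ln r0 <= ln x by rewrite ler_ln ?posrE.
have l1 : ln x <= ln r1 by rewrite ler_ln ?posrE// (lt_le_trans xp).
have : `|a * ln x| <= b.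
  rewrite normrM ler_wpM2l// ler_norml.
  have := ler_norm (ln r1); have := ler_norm (- ln r0); rewrite normrN.
  have := normr_ge0 (ln r0); have := normr_ge0 (ln r1) => *.
  by apply/andP; split; lra.
by rewrite ler_norml /powR gt_eqF// !ler_expR.
Qed.

Lemma continuous_sum n (I : Type) (r : seq I) (f : I -> 'rV[R]_n -> R) :
  (forall i, continuous (f i)) -> continuous (fun y => \sum_(i <- r) f i y).
Proof.
move=> fc; elim: r => [|i r IH].
  rewrite (_ : (fun y => _) = fun=> 0); first exact: cst_continuous.
  by apply/funext => y; rewrite big_nil.
rewrite (_ : (fun y => _) = f i \+ (fun y => \sum_(i <- r) f i y)); last first.
  by apply/funext => y; rewrite big_cons.
by move=> y; apply: continuousD; [exact: fc|exact: IH].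
Qed.

(** Without a maximizer, the sets where [f < f a], with [a] in [A], would cover [A] by their
    interiors. The largest of finitely many values [f a] gives a contradiction. *)
Lemma usc_max n (A : set 'rV[R]_n) (f : 'rV[R]_n -> R) : compact A -> A !=set0 ->
  (forall x c, A x -> f x < c -> \forall y \near x, A y -> f y < c) ->
  exists2 x, A x & forall y, A y -> f y <= f x.
Proof.
move=> cA [x0 Ax0] usc; apply: contrapT => nmax.
have above x : A x -> exists2 y, A y & f x < f y.
  move=> Ax; apply: contrapT => h; apply: nmax; exists x => // y Ay.
  by rewrite leNgt; apply/negP => xy; apply: h; exists y.
move: cA; rewrite compact_cover.
move=> /(_ _ A (fun a => interior [set y | A y -> f y < f a])).
case=> [a _|x Ax|D DA AD]; first exact: open_interior.
  by have [y Ay xy] := above _ Ax; exists y => //; exact: usc.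
have [b bD bmax] : exists2 b, b \in finmap.enum_fset D & forall a, a \in finmap.enum_fset D -> f a <= f b.
  have [a /= aD _] := AD _ Ax0.
  have : finmap.enum_fset D != [::].
    apply/eqP => D0; have : a \in finmap.enum_fset D by [].
    by rewrite D0.
  elim: (finmap.enum_fset D) => // c [_|d s IH] _.
    by exists c; [rewrite inE|move=> e; rewrite inE => /eqP ->].
  have [//|b bs bmax] := IH.
  have [cb|bc] := leP (f c) (f b).
    exists b; first by rewrite inE bs orbT.
    by move=> e; rewrite inE => /orP[/eqP ->//|]; exact: bmax.
  exists c; first by rewrite inE eqxx.
  move=> e; rewrite inE => /orP[/eqP ->//|/bmax eb].
  exact: le_trans eb (ltW bc).
have Ab : A b by have := DA b bD; rewrite inE.
have [a /= aD /interior_subset/= ab] := AD _ Ab.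
by have := ab Ab; rewrite ltNge bmax.
Qed.

End powR_extras.

(** * Measurable functions and null sets on the sphere *)

Section sphere_measure.
Context {R : realType}.
Variable m : nat.
Notation S := (sphere R m.+1).
Notation T := (caratheodory_type (@hausdorff_outer R m.+1 m)).
Notation H := (hausdorff_measure R m.+1 m).

Lemma measurable_sphere : measurable (S : set T).
Proof. by apply: closed_measurable_hausdorff; exact: closed_sphere. Qed.

Lemma measure_sphere_fin : (H S < +oo)%E.
Proof. exact: hausdorff_sphere_fin. Qed.

Lemma integrable_cst_sphere (K : R) : 0 <= K -> H.-integrable (S : set T) (cst K%:E).
Proof.
move=> K0; apply/integrableP; split; first exact: measurable_cst.
rewrite (_ : (fun x => `|cst K%:E x|)%E = cst K%:E); last first.
  by apply/funext => x /=; rewrite ger0_norm.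
rewrite integral_cst; last exact: measurable_sphere.
by rewrite lte_mul_pinfty ?lee_fin// measure_sphere_fin.
Qed.

(** Completeness of the Caratheodory sigma-algebra, by which sets may be altered within a null
    set. *)
Lemma null_measurable (N : set T) : hausdorff m (N : set 'rV[R]_m.+1) = 0%E -> measurable N.
Proof.
move=> N0; apply: le_caratheodory_measurable => X /=.
have -> : hausdorff_outer m (X `&` N) = 0%E.
  apply/eqP; rewrite eq_le outer_measure_ge0 andbT -N0.
  by apply: le_outer_measure => x [].
by rewrite add0e; apply: le_outer_measure => x [].
Qed.

Lemma measurable_fun_ge (f : 'rV[R]_m.+1 -> R) :
  (forall a, measurable (S `&` [set v | a <= f v] : set T)) ->
  measurable_fun (S : set T) (f : T -> R).
Proof.
move=> h; apply: (measurability (@RGenCInfty.G R)) => [|_ [_ [a ->] <-]].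
  exact: RGenCInfty.measurableE.
rewrite (_ : _ `&` _ = S `&` [set v | a <= f v])//.
by apply/seteqP; split => v /=; rewrite in_itv/= andbT.
Qed.

Lemma measurable_fun_within (f : 'rV[R]_m.+1 -> R) :
  {within S, continuous f} -> measurable_fun (S : set T) (f : T -> R).
Proof.
move=> cf; apply: measurable_fun_ge => a.
have /continuous_closedP/(_ _ (@closed_ge R a)) := cf.
rewrite closed_subspaceP => -[V cV VS].
rewrite setIC (_ : [set v | a <= f v] `&` S = V `&` S); last by rewrite VS.
by apply: measurableI; [exact: closed_measurable_hausdorff|exact: measurable_sphere].
Qed.

Lemma measurable_dot_sphere (w : 'rV[R]_m.+1) : measurable_fun (S : set T) ((fun v => dot v w) : T -> R).
Proof.
apply: measurable_fun_within; apply: continuous_subspaceT; exact: continuous_dotl.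
Qed.

Lemma measurable_fun_sphereS (f : T -> \bar R) (B : set T) :
  measurable_fun (S : set T) f -> B `<=` (S : set T) -> measurable_fun B f.
Proof. by move=> mf BS; apply: measurable_funS mf => //; exact: measurable_sphere. Qed.

Lemma le_integral_sphere (f g : T -> \bar R) :
  measurable_fun (S : set T) f -> measurable_fun (S : set T) g ->
  (forall v, S v -> 0 <= f v)%E -> (forall v, S v -> f v <= g v)%E ->
  (\int[H]_(v in (S : set T)) f v <= \int[H]_(v in (S : set T)) g v)%E.
Proof. by move=> mf mg f0 fg; exact: (ge0_le_integral H measurable_sphere f0 mf mg fg). Qed.

(** Measurability is assumed of [A] only and passes to [B]; this is how the sets [alpha_star] are
    integrated over. *)
Lemma integral_ess_eq (f : T -> \bar R) (A B N : set T) :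
  measurable A -> measurable N -> H N = 0%E -> A `<=` S -> B `<=` S -> N `<=` S ->
  measurable_fun (S : set T) f -> (forall v, S v -> 0 <= f v)%E ->
  A `\` N = B `\` N -> (\int[H]_(v in B) f v = \int[H]_(v in A) f v)%E.
Proof.
move=> mA mN N0 AS BS NS mf f0 AB.
have mBN : measurable (B `&` N : set T).
  apply: null_measurable; apply/eqP; rewrite eq_le (outer_measure_ge0 (hausdorff_outer m)) andbT.
  by rewrite -[leRHS]N0; apply: (le_outer_measure (hausdorff_outer m)) => x [].
have mB : measurable B.
  rewrite -(setUIDK B N); apply: measurableU => //; rewrite -AB.
  exact: measurableD.
have mfS (D : set T) : measurable D -> D `<=` (S : set T) -> measurable_fun D f.
  by move=> _; exact: measurable_fun_sphereS.
rewrite (ge0_negligible_integral mN mB (mfS _ mB BS)) ?N0//; last by move=> v /BS/f0.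
rewrite (ge0_negligible_integral mN mA (mfS _ mA AS)) ?N0//; last by move=> v /AS/f0.
by rewrite AB.
Qed.

End sphere_measure.

(** Abstracts the factor [rho_Q^(n-q)] of the integrands. *)
Record bounded_weight (R : realType) (m : nat) (w : 'rV[R]_m.+1 -> R) (w0 w1 : R) : Prop := {
  weight_lower_gt0 : 0 < w0 ;
  weight_bounds : forall v, sphere R m.+1 v -> w0 <= w v <= w1 ;
  weight_measurable :
    measurable_fun (sphere R m.+1 : set (caratheodory_type (@hausdorff_outer R m.+1 m))) w }.

Definition dens (R : realType) (m k : nat) (u : 'I_k -> 'rV[R]_m.+1) (w : 'rV[R]_m.+1 -> R)
  (q : R) (z : 'I_k -> R) (v : 'rV[R]_m.+1) : R := radial (polyhedron u z) v `^ q * w v.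

Lemma densE (R : realType) (m k : nat) (u : 'I_k -> 'rV[R]_m.+1) w q z v :
  dens u w q z v = radial (polyhedron u z) v `^ q * w v.
Proof. by []. Qed.

(* Locked: unification would otherwise unfold integrals when comparing them. *)
HB.lock Definition wvol (R : realType) (m k : nat) (u : 'I_k -> 'rV[R]_m.+1)
    (w : 'rV[R]_m.+1 -> R) (q : R) (z : 'I_k -> R)
    (A : set (caratheodory_type (@hausdorff_outer R m.+1 m))) : \bar R :=
  (\int[hausdorff_measure R m.+1 m]_(v in A) (dens u w q z v)%:E)%E.

(** * The weighted volume as a function of [z] *)

Section weighted_volume.
Context {R : realType}.
Variables m k : nat.
Variables (u : 'I_k -> 'rV[R]_m.+1) (w : 'rV[R]_m.+1 -> R) (q w0 w1 : R).
Notation S := (sphere R m.+1).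
Notation T := (caratheodory_type (@hausdorff_outer R m.+1 m)).
Notation H := (hausdorff_measure R m.+1 m).
Hypothesis u_unit : forall i, S (u i).
Hypothesis u_span : forall v, S v -> exists i, 0 < dot v (u i).
Hypothesis q0 : 0 < q.
Hypothesis ww : bounded_weight w w0 w1.
Implicit Types (z : 'I_k -> R) (v : 'rV[R]_m.+1) (A B : set T).

Local Notation rho z := (radial (polyhedron u z)).

Local Notation dens := (dens u w q).
Local Notation wvol := (wvol u w q).
Local Notation wvolS z := (fine (wvol z S)).

Lemma weight_gt0 v : S v -> 0 < w v.
Proof. by move=> /(weight_bounds ww)/andP[h _]; exact: lt_le_trans (weight_lower_gt0 ww) h. Qed.

Lemma dens_ge0 z v : S v -> 0 <= dens z v.
Proof. by move=> Sv; rewrite mulr_ge0 ?powR_ge0// ltW// weight_gt0. Qed.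

Lemma measurable_radial z : (forall i, 0 <= z i) ->
  measurable_fun (S : set T) (rho z : T -> R).
Proof.
move=> z0; apply: measurable_fun_ge => a.
by apply: closed_measurable_hausdorff; exact: closed_radial_ge.
Qed.

Lemma measurable_dens z : (forall i, 0 <= z i) ->
  measurable_fun (S : set T) (dens z : T -> R).
Proof.
move=> z0.
have mr : measurable_fun (S : set T) ((fun v => rho z v `^ q) : T -> R).
  exact: (@measurableT_comp _ _ _ T _ _ _ S (rho z) (measurable_powR q) (measurable_radial z0)).
exact: (@measurable_funM _ T R S (fun v => rho z v `^ q) w mr (weight_measurable ww)).
Qed.

Lemma measurable_Edens z : (forall i, 0 <= z i) ->
  measurable_fun (S : set T) (fun v : T => (dens z v)%:E).
Proof. by move=> z0; apply/measurable_EFinP; exact: measurable_dens. Qed.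

Lemma dens_bound M : 0 <= M -> exists2 K : R, 0 <= K & forall z, (forall i, 0 <= z i <= M) ->
  forall v, S v -> dens z v <= K.
Proof.
move=> M0; have [C C0 Cb] := radial_bounded u_span.
exists ((C * M) `^ q * `|w1|); first by rewrite mulr_ge0// powR_ge0.
move=> z zM v Sv; have z0 i : 0 <= z i by have /andP[] := zM i.
apply: ler_pM; rewrite ?powR_ge0 ?(ltW (weight_gt0 Sv))//.
  rewrite ge0_ler_powR ?(ltW q0) ?nnegrE ?mulr_ge0 ?(ltW C0)//.
    exact: radial_ge0.
  exact: Cb.
by have /andP[_ h] := weight_bounds ww Sv; apply: le_trans h (ler_norm _).
Qed.

Lemma wvol_ge0 z A : A `<=` (S : set T) -> (0 <= wvol z A)%E.
Proof. by move=> AS; rewrite wvol.unlock; apply: integral_ge0 => v /AS Sv; rewrite lee_fin dens_ge0. Qed.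

Lemma le_wvol z A B : (forall i, 0 <= z i) -> measurable A -> measurable B ->
  A `<=` B -> B `<=` (S : set T) -> (wvol z A <= wvol z B)%E.
Proof.
move=> z0 mA mB AB BS.
have mf : measurable_fun B (fun v : T => (dens z v)%:E).
  exact: (measurable_fun_sphereS (measurable_Edens z0) BS).
rewrite wvol.unlock; refine (ge0_subset_integral H mA mB mf _ AB).
by move=> v /BS Sv; rewrite lee_fin dens_ge0.
Qed.

Lemma nneg_bounded z : (forall i, 0 <= z i) ->
  exists2 M, 0 <= M & forall i, 0 <= z i <= M.
Proof.
move=> z0; exists (\sum_i z i); first exact: sumr_ge0.
by move=> i; rewrite z0/= (bigD1 i)//= lerDl sumr_ge0.
Qed.

Lemma wvolS_fin z : (forall i, 0 <= z i) -> wvol z S \is a fin_num.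
Proof.
move=> z0; have [M M0 zM] := nneg_bounded z0; have [K K0 hK] := dens_bound M0.
rewrite ge0_fin_numE ?wvol_ge0// wvol.unlock; apply: (@le_lt_trans _ _ (\int[H]_(v in (S : set T)) (cst K%:E) v)%E).
  apply: le_integral_sphere.
  - exact: measurable_Edens.
  - exact: measurable_cst.
  - by move=> v Sv; rewrite lee_fin dens_ge0.
  - by move=> v Sv; rewrite lee_fin; exact: hK.
rewrite integral_cst; last exact: measurable_sphere.
by rewrite lte_mul_pinfty ?lee_fin// measure_sphere_fin.
Qed.

Lemma wvol_fin z A : (forall i, 0 <= z i) -> measurable A -> A `<=` (S : set T) ->
  wvol z A \is a fin_num.
Proof.
move=> z0 mA AS; rewrite ge0_fin_numE ?wvol_ge0//.
have AVS := @le_wvol z A S z0 mA (@measurable_sphere R m) AS (fun v h => h).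
apply: le_lt_trans AVS _.
by have := wvolS_fin z0; rewrite ge0_fin_numE// wvol_ge0.
Qed.

Lemma wvolSE z : (forall i, 0 <= z i) -> (wvolS z)%:E = wvol z S.
Proof. by move=> z0; rewrite fineK// wvolS_fin. Qed.

Lemma le_dens z z' v : (forall i, 0 <= z i) -> (forall i, z i <= z' i) -> S v ->
  dens z v <= dens z' v.
Proof.
move=> z0 zz' Sv; rewrite ler_wpM2r ?(ltW (weight_gt0 Sv))//.
rewrite ge0_ler_powR ?(ltW q0) ?nnegrE ?radial_ge0//.
  by move=> i; exact: le_trans (zz' i).
exact: le_radial_polyhedron.
Qed.

Lemma le_wvolS z z' : (forall i, 0 <= z i) -> (forall i, z i <= z' i) -> wvolS z <= wvolS z'.
Proof.
move=> z0 zz'; have z'0 i : 0 <= z' i by exact: le_trans (zz' i).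
rewrite -lee_fin.
rewrite (wvolSE z0).
rewrite (wvolSE z'0).
rewrite wvol.unlock.
apply: le_integral_sphere.
- exact: measurable_Edens.
- exact: measurable_Edens.
- by move=> v Sv; rewrite lee_fin dens_ge0.
- by move=> v Sv; rewrite lee_fin le_dens.
Qed.

Lemma densZ z a v : (forall i, 0 <= z i) -> 0 < a -> S v ->
  dens (fun i => a * z i) v = a `^ q * dens z v.
Proof.
by move=> z0 a0 Sv; rewrite !densE radialZ// powRM ?(ltW a0) ?radial_ge0// mulrA.
Qed.

Lemma wvolSZ z a : (forall i, 0 <= z i) -> 0 < a ->
  wvolS (fun i => a * z i) = a `^ q * wvolS z.
Proof.
move=> z0 a0; apply: EFin_inj.
have az0 i : 0 <= a * z i by rewrite mulr_ge0// ltW.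
rewrite EFinM (wvolSE z0) (wvolSE az0).
have f0 v : S v -> (0 <= (dens z v)%:E)%E by move=> Sv; rewrite lee_fin dens_ge0.
rewrite wvol.unlock -(ge0_integralZl_EFin H (@measurable_sphere R m) f0
  (measurable_Edens z0) (powR_ge0 a q)).
by apply: eq_integral => v; rewrite inE => Sv; rewrite densZ.
Qed.

(** At an index [i] where [v] meets a constraint, raising all bounds by [e] moves the radial
    function by at most [e / dot v (u i)]. The constant depends on [v], so the convergence is
    pointwise. *)
Lemma radial_shift z v : (forall i, 0 <= z i) -> S v ->
  exists2 c, 0 <= c & forall e, 0 <= e -> rho z v <= rho (fun i => z i + e) v <= rho z v + c * e.
Proof.
move=> z0 Sv; have [i vi ri] := radial_tight u_span z0 Sv.
exists (dot v (u i))^-1; first by rewrite invr_ge0 ltW.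
move=> e e0; have ze0 j : 0 <= z j + e by rewrite addr_ge0.
apply/andP; split; first by apply: le_radial_polyhedron => // j; rewrite lerDl.
rewrite [_^-1 * _]mulrC -[leRHS](mulfK (lt0r_neq0 vi)) ler_pdivlMr//.
by rewrite mulrDl divfK ?gt_eqF// ri; exact: radial_dot.
Qed.

(** Upper semicontinuity in disguise: a whole sup-norm neighbourhood of [z] lies below the shifted
    point, so by monotonicity one sequence of shifts and dominated convergence suffice. *)
Lemma wvolS_shift z c : (forall i, 0 <= z i) -> wvolS z < c ->
  exists N : nat, wvolS (fun i => z i + N.+1%:R^-1) < c.
Proof.
move=> z0 zc.
pose zN (N : nat) i := z i + N.+1%:R^-1.
have zN0 N i : 0 <= zN N i by rewrite addr_ge0.
have [M M0 zM] := nneg_bounded z0.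
have [K K0 hK] := dens_bound (addr_ge0 M0 ler01).
have zNM N i : 0 <= zN N i <= M + 1.
  rewrite zN0/=; have /andP[_ h] := zM i; apply: lerD => //.
  by rewrite invf_le1// ler1n.
have cvgd v : S v -> dens (zN N) v @[N --> \oo] --> dens z v.
  move=> Sv; rewrite densE; apply: cvgMr_tmp.
  have -> : rho z v `^ q = `|rho z v| `^ q by rewrite ger0_norm// radial_ge0.
  have -> : (fun N => rho (zN N) v `^ q) = (fun N => `|rho (zN N) v| `^ q).
    by apply/funext => N; rewrite ger0_norm// radial_ge0.
  apply: (@continuous_cvg _ _ _ _ _ (fun N => rho (zN N) v) (fun t : R => `|t| `^ q)).
    exact: continuous_norm_powR.
  have [d d0 hd] := radial_shift z0 Sv.
  apply: (@squeeze_cvgr _ _ _ _ (fun=> rho z v) (fun N => rho z v + d * N.+1%:R^-1)).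
  - by apply: nearW => N; apply: hd; rewrite invr_ge0.
  - exact: cvg_cst.
  - rewrite -[X in _ --> X]addr0; apply: cvgD; first exact: cvg_cst.
    rewrite -[X in _ --> X](mulr0 d); apply: cvgMl_tmp; exact: cvg_harmonic.
have cvgV : wvol (zN N) S @[N --> \oo] --> wvol z S.
  rewrite wvol.unlock; apply: (@dominated_cvg _ _ _ H S _ (fun N v => (dens (zN N) v)%:E) _ (cst K%:E)).
  - exact: measurable_sphere.
  - by move=> N; exact: measurable_Edens.
  - by move=> v Sv; apply: cvg_EFin; [exact: nearW|exact: cvgd].
  - by [].
  - exact: integrable_cst_sphere.
  - move=> N v Sv; rewrite gee0_abs ?lee_fin ?dens_ge0//; exact: hK.
rewrite -(wvolSE z0) in cvgV.
have [N _ hN] := cvgr_lt _ (fine_cvg cvgV) _ zc.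
by exists N; exact: (hN N (leqnn N)).
Qed.

End weighted_volume.

(** * Elementary inequalities *)

Section real_estimates.
Context {R : realType}.

Lemma powR_le_expR (a b : R) : 0 <= 1 + a -> 0 <= b -> (1 + a) `^ b <= expR (a * b).
Proof.
move=> a0 b0; rewrite expRM ge0_ler_powR ?nnegrE ?expR_ge0//.
exact: expR_ge1Dx.
Qed.

Lemma expRN_le (y : R) : 0 <= y -> y / (1 + y) <= 1 - expR (- y).
Proof.
move=> y0; rewrite expRN lerBrDr -lerBrDl.
have y1 : 0 < 1 + y by rewrite ltr_wpDr.
rewrite [leRHS](_ : _ = (1 + y)^-1); last by field; rewrite gt_eqF.
by rewrite lef_pV2 ?posrE ?expR_gt0 ?expR_ge1Dx.
Qed.

(* A gain of order [t = D / N.+1] cannot be paid for by a cost of order [t^p]. *)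
Lemma linear_gain_contra (M b A D p c : R) : 1 < p -> 0 < b -> 0 < A -> 0 < D ->
  0 < c -> 0 < M ->
  ~ (forall N : nat, M + c / N.+1%:R <= (1 + A * (D / N.+1%:R) `^ p) `^ b * M).
Proof.
move=> p1 b0 A0 D0 c0 M0 h.
pose K := 2 * (b * A * D `^ p).
have K0 : 0 < K by rewrite !mulr_gt0 ?powR_gt0.
pose K1 := (K * M / c) `^ (p - 1)^-1.
have p10 : 0 < p - 1 by rewrite subr_gt0.
have K10 : 0 <= K1 by exact: powR_ge0.
(* Such an [N] ensures [2 * y <= 1], hence [expR y <= 1 + 2 * y], and also [xp > K * M / c], which
   the assumption forbids. *)
have [N] : exists N, 1 + K + K1 < N.+1%:R :> R.
  by exists (Num.truncn (1 + K + K1)); exact: truncnS_gt.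
set x : R := N.+1%:R => xK; have := h N; rewrite -/x.
have x0 : 0 < x by rewrite /x.
have x1 : 1 <= x by rewrite /x ler1n.
pose xp := x `^ (p - 1).
have xp1 : 1 <= xp by rewrite -[leLHS](powRr0 x) ler_powR// ltW.
have xp0 : 0 < xp by exact: lt_le_trans xp1.
have xpE : x `^ p = x * xp.
  by rewrite /xp -[X in X * _]powRr1 ?(ltW x0)// -powRD ?subrKC// gt_eqF ?implybT// (lt_trans ltr01).
have DE : (D / x) `^ p = D `^ p / (x * xp).
  by rewrite powRM ?invr_ge0 ?(ltW D0) ?(ltW x0)// -powR_inv1 ?(ltW x0)// -powRrM mulN1r powRN xpE.
rewrite DE; set a := A * _ => h1.
have a0 : 0 < a by rewrite !mulr_gt0 ?invr_gt0 ?mulr_gt0 ?powR_gt0.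
pose y := a * b.
have yE : 2 * y = K / (x * xp) by rewrite /y /a /K; ring.
have y0 : 0 < y by rewrite mulr_gt0.
have y1 : 2 * y <= 1.
  rewrite yE ler_pdivrMr ?mulr_gt0// mul1r; apply: (@le_trans _ _ x); first by lra.
  by rewrite ler_peMr// ltW.
have ey : expR y <= 1 + 2 * y.
  have := expR_ge1Dx (- y); rewrite expRN => e1.
  have e2 : 0 < expR y := expR_gt0 y.
  have : expR y * (1 - y) <= 1.
    by rewrite -[leRHS](mulfV (lt0r_neq0 e2)) ler_wpM2l// ltW.
  nra.
have : M + c / x <= (1 + 2 * y) * M.
  apply: le_trans h1 _; rewrite ler_wpM2r ?(ltW M0)//; apply: le_trans ey.
  by apply: powR_le_expR; rewrite ?ltW// addr_gt0.
rewrite mulrDl mul1r lerD2l yE.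
rewrite ler_pdivrMr// => h2.
have h3 : xp <= K * M / c.
  rewrite ler_pdivlMr// mulrC.
  move: h2; rewrite (_ : K / (x * xp) * M * x = K * M / xp); last by field; rewrite !gt_eqF.
  by rewrite ler_pdivlMr.
have : K1 < x by lra.
move=> /(gt0_ltr_powR p10); rewrite !nnegrE => /(_ K10 (ltW x0)).
rewrite /K1 -powRrM mulVf ?gt_eqF// powRr1 ?ltNge ?h3//.
by apply: le_trans h3; rewrite ltW.
Qed.

(** Replaces a derivative at [s = 0] by an explicit error factor that tends to 1. Here [V] is the
    maximum, [W] the integral over directions close to one facet, [a] the share of that facet in the
    constraint, and [sigma] the constraint after shrinking. *)
Lemma variation_estimate (p q a s V W sigma : R) : 0 < p -> 0 < q -> 0 < a -> 0 < s ->
  0 < V -> 0 <= W -> 0 <= sigma -> sigma = 1 - a * (1 - expR (- (p * s))) ->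
  V <= sigma `^ (q / p) * V + (1 - expR (- (q * s))) * W ->
  V * a <= W * (1 + (p + q * a) * s).
Proof.
move=> p0 q0 a0 s0 V0 W0 sg0 sgE h.
have ps0 : 0 < p * s by rewrite mulr_gt0.
have qs : 1 - expR (- (q * s)) <= q * s.
  by have := expR_ge1Dx (- (q * s)); lra.
pose x := 1 - expR (- (p * s)).
have x0 : p * s / (1 + p * s) <= x by exact/expRN_le/ltW.
have b0 : 0 < q / p by rewrite divr_gt0.
have sb : sigma `^ (q / p) <= expR (- (a * x) * (q / p)).
  have sgE' : sigma = 1 + - (a * x) by rewrite sgE.
  by rewrite sgE' powR_le_expR ?(ltW b0)// -sgE'.
pose y := a * x * (q / p).
(* A lower bound for [y], chosen because [y0 / (1 + y0)] simplifies to
   [q * s * a / (1 + (p + q * a) * s)]. *)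
pose y0 := q * a * s / (1 + p * s).
have psp : 0 < 1 + p * s by rewrite ltr_wpDr// ltW.
have y00 : 0 < y0 by rewrite divr_gt0// !mulr_gt0.
have y0y : y0 <= y.
  have -> : y0 = a * (p * s / (1 + p * s)) * (q / p) by rewrite /y0; field; rewrite !gt_eqF.
  by rewrite ler_wpM2r ?(ltW b0)// ler_wpM2l// ltW.
have ey : y0 / (1 + y0) <= 1 - expR (- y).
  apply: le_trans (expRN_le (ltW y00)) _.
  by rewrite lerD2l lerN2 ler_expR lerN2.
have d0 : 0 < 1 + (p + q * a) * s.
  by rewrite addr_gt0// mulr_gt0// addr_gt0// mulr_gt0.
have y0E : y0 / (1 + y0) = q * s * a / (1 + (p + q * a) * s).
  have frac (n d : R) : 0 < n -> 0 < d -> n / d / (1 + n / d) = n / (d + n).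
    by move=> n0 d1; field; rewrite !gt_eqF// addr_gt0.
  rewrite /y0 frac ?mulr_gt0//.
  by congr (_ / _); ring.
have h1 : V * (y0 / (1 + y0)) <= q * s * W.
  apply: le_trans (_ : V * (1 - sigma `^ (q / p)) <= _).
    rewrite ler_wpM2l ?(ltW V0)//; apply: le_trans ey _.
    by rewrite lerD2l lerN2; apply: le_trans sb _; rewrite ler_expR /y mulNr.
  apply: le_trans (_ : (1 - expR (- (q * s))) * W <= _); first by lra.
  by rewrite ler_wpM2r.
move: h1; rewrite y0E mulrA ler_pdivrMr// => h1.
have qs0 : 0 < q * s by rewrite mulr_gt0.
rewrite -(ler_pM2l qs0); apply: le_trans (_ : V * (q * s * a) <= _).
  by rewrite le_eqVlt; apply/orP; left; apply/eqP; ring.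
by apply: le_trans h1 _; rewrite mulrA.
Qed.

End real_estimates.

(** * The variational problem *)

Section maximizer.
Context {R : realType}.
Variables m k : nat.
Variables (u : 'I_k -> 'rV[R]_m.+1) (w : 'rV[R]_m.+1 -> R) (q w0 w1 p : R).
Variable alpha : 'I_k -> R.
Notation S := (sphere R m.+1).
Notation T := (caratheodory_type (@hausdorff_outer R m.+1 m)).
Notation H := (hausdorff_measure R m.+1 m).
Hypothesis m0 : (0 < m)%N.
Hypothesis u_unit : forall i, S (u i).
Hypothesis u_span : forall v, S v -> exists i, 0 < dot v (u i).
Hypothesis q0 : 0 < q.
Hypothesis p1 : 1 < p.
Hypothesis ww : bounded_weight w w0 w1.
Hypothesis alpha0 : forall i, 0 < alpha i.
Implicit Types (z : 'I_k -> R) (v : 'rV[R]_m.+1).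

Local Notation rho z := (radial (polyhedron u z)).
Local Notation dens := (dens u w q).
Local Notation wvol := (wvol u w q).
Local Notation wvolS z := (fine (wvol z S)).

Let p0 : 0 < p. Proof. exact: lt_trans p1. Qed.

Definition cost z : R := \sum_i alpha i * z i `^ p.

Lemma costZ a z : 0 <= a -> (forall i, 0 <= z i) ->
  cost (fun i => a * z i) = a `^ p * cost z.
Proof.
move=> a0 z0; rewrite /cost mulr_sumr; apply: eq_bigr => i _.
by rewrite powRM// mulrCA.
Qed.

Lemma cost_ge0 z : 0 <= cost z.
Proof. by apply: sumr_ge0 => i _; rewrite mulr_ge0 ?powR_ge0 ?(ltW (alpha0 i)). Qed.

Lemma exists_index : exists i : 'I_k, True.
Proof.
pose e : 'rV[R]_m.+1 := delta_mx ord0 ord0.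
have e0 : e != 0 by apply/negP => /eqP /rowP /(_ ord0); rewrite !mxE eqxx => /eqP; rewrite oner_eq0.
by have [i _] := u_span (enorm_normalize e0); exists i.
Qed.

Lemma exists_maximizer : exists z, [/\ (forall i, 0 <= z i), cost z = 1 &
  forall z', (forall i, 0 <= z' i) -> cost z' = 1 -> wvolS z' <= wvolS z].
Proof.
(* Row vectors carry the topology; the absolute value makes the constraint continuous on the whole
   space. *)
pose Z : set 'rV[R]_k := [set y | (forall i, 0 <= y ord0 i) /\
  \sum_i alpha i * `|y ord0 i| `^ p = 1].
have ZE y : Z y -> cost (y ord0) = 1.
  move=> [y0 <-]; apply: eq_bigr => i _; by rewrite ger0_norm.
have coordc i : continuous (fun y : 'rV[R]_k => y ord0 i) by exact: coord_continuous.
have cZ : compact Z.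
  (* Each summand of the constraint is at most 1, which bounds coordinate [i] by [M i]. *)
  pose M i : R := (alpha i)^-1 `^ p^-1.
  have cB : compact [set v : 'rV[R]_k | forall i, `[0, M i]%classic (v ord0 i)].
    by apply: (@rV_compact _ _ (fun i => `[0, M i]%classic)) => i; exact: segment_compact.
  apply: subclosed_compact cB _.
    rewrite (_ : Z = (\bigcap_(i in setT) [set y | 0 <= y ord0 i]) `&`
        (fun y => \sum_i alpha i * `|y ord0 i| `^ p) @^-1` [set 1]); last first.
      by apply/seteqP; split => y [h1 h2]; split => // i; [move=> _; exact: h1|exact: h1].
    apply: closedI.
      apply: closed_bigI => i _.
      have : closed ((fun y : 'rV[R]_k => y ord0 i) @^-1` [set t | 0 <= t]).
        by apply: closed_comp => [y _|]; [exact: coordc|exact: closed_ge].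
      exact.
    apply: closed_comp => [y _|]; last exact: closed_eq.
    apply: continuous_sum => i y'.
    change {for y', continuous ( *%R (alpha i) \o (fun t : R => `|t| `^ p) \o (fun y : 'rV[R]_k => y ord0 i))}.
    apply: continuous_comp; first exact: coordc.
    apply: continuous_comp; first exact: continuous_norm_powR.
    exact: mulrl_continuous.
  move=> y [y0 y1] i /=; rewrite in_itv/= y0/=.
  have yi : alpha i * y ord0 i `^ p <= 1.
    rewrite -y1 (bigD1 i)//= ger0_norm// lerDl; apply: sumr_ge0 => j _.
    by rewrite mulr_ge0 ?powR_ge0// ltW.
  have -> : y ord0 i = (y ord0 i `^ p) `^ p^-1.
    by rewrite -powRrM mulfV ?gt_eqF// powRr1.
  rewrite ge0_ler_powR ?invr_ge0 ?(ltW p0) ?nnegrE ?powR_ge0 ?invr_ge0 ?(ltW (alpha0 i))//.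
  by rewrite -[(alpha i)^-1]mul1r ler_pdivlMr// mulrC.
have Z0 : Z !=set0.
  have [i0 _] := exists_index.
  pose a := \sum_i alpha i.
  have a0 : 0 < a.
    rewrite /a (bigD1 i0)//= ltr_pwDl// sumr_ge0// => j _; exact: ltW.
  exists (const_mx (a^-1 `^ p^-1)); split => [i|]; first by rewrite mxE powR_ge0.
  under eq_bigr do rewrite mxE ger0_norm ?powR_ge0// -powRrM mulVf ?gt_eqF// powRr1 ?invr_ge0 ?(ltW a0)//.
  by rewrite -mulr_suml mulfV// gt_eqF.
have [|y Zy ymax] := @usc_max R k Z (fun y => wvolS (y ord0)) cZ Z0.
  move=> y c [y0 _] /(wvolS_shift u_span q0 ww y0)[N hN].
  (* In the sup norm, the ball of radius [1 / N.+1] around [y] lies coordinatewise below the shifted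
     point. *)
  have N0 : 0 < N.+1%:R^-1 :> R by rewrite invr_gt0.
  apply: filterS (nbhsx_ballx y _ N0) => y'; rewrite -ball_normE/= => yy' [y'0 _].
  apply: le_lt_trans hN; apply: (le_wvolS u_span q0 ww) => // i.
  have := le_lt_trans (coord_le_norm _ i) yy'; rewrite !mxE ltr_norml => /andP[h _].
  by rewrite ltW// -ltrBlDl -ltrN2 opprB.
exists (y ord0); split; [by case: Zy|exact: ZE|].
move=> z' z'0 z'1.
have := ymax (\row_i z' i).
have -> : (\row_i z' i) ord0 = z' :> ('I_k -> R) by apply/funext => i; rewrite mxE.
apply; split => [i|]; first by rewrite mxE.
by rewrite -z'1; apply: eq_bigr => i _; rewrite mxE ger0_norm.
Qed.

Section at_maximizer.
Variable z : 'I_k -> R.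
Hypothesis z0 : forall i, 0 <= z i.
Hypothesis z1 : cost z = 1.
Hypothesis zmax : forall z', (forall i, 0 <= z' i) -> cost z' = 1 -> wvolS z' <= wvolS z.

(** Maximality in homogeneous form: [wvolS] has degree [q] and [cost] has degree [p], so competitors
    off the constraint set can be used. *)
Lemma wvolS_le_cost z' : (forall i, 0 <= z' i) -> 0 < cost z' ->
  wvolS z' <= cost z' `^ (q / p) * wvolS z.
Proof.
move=> z'0 c0; pose s := cost z' `^ p^-1.
have s0 : 0 < s by exact: powR_gt0.
have sz0 i : 0 <= s^-1 * z' i by rewrite mulr_ge0// invr_ge0 ltW.
have zE : z' = (fun i => s * (s^-1 * z' i)) by apply/funext => i; rewrite mulVKf// gt_eqF.
rewrite {1}zE (wvolSZ u_span q0 ww sz0 s0).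
rewrite /s -powRrM (mulrC p^-1) ler_pM2l ?powR_gt0//.
apply: zmax => //; rewrite costZ ?invr_ge0 ?(ltW s0)//.
have sp : s `^ p = cost z' by rewrite /s -powRrM mulVf ?gt_eqF// powRr1 ?cost_ge0.
by rewrite -/s -[X in _ * X]sp -powRM ?invr_ge0 ?(ltW s0)// mulVf ?gt_eqF// powR1.
Qed.

(** The competitor with all coordinates 1 contains the unit ball, so its density is at least the
    weight. *)
Lemma wvolS_max_gt0 : 0 < wvolS z.
Proof.
pose z' : 'I_k -> R := fun=> 1.
have [i0 _] := exists_index.
have z'0 i : 0 <= z' i by [].
have c0 : 0 < cost z'.
  rewrite /cost (bigD1 i0)//= ltr_pwDl ?mulr_gt0 ?powR_gt0// sumr_ge0// => j _.
  by rewrite mulr_ge0 ?powR_ge0// ltW.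
suff V0 : 0 < wvolS z'.
  by have := lt_le_trans V0 (wvolS_le_cost z'0 c0); rewrite pmulr_rgt0// powR_gt0.
(* A single constraint and [N = 0] in the strip estimate. *)
have HS : (0 < H S)%E.
  have Pi0 : pred1 i0 i0 by rewrite /= eqxx.
  have du (i : 'I_k) : pred1 i0 i -> dot (- u i0) (u i) < 0.
    move=> /eqP ->; rewrite dotNl -enorm_sqr; have -> : enorm (u i0) = 1 := u_unit i0.
    by rewrite expr1n oppr_lt0.
  have [c [D [c00 D0 /(_ 0%N)]]] := @hausdorff_strip R m 'I_k (pred1 i0) u (- u i0) i0 m0 Pi0 u_unit du.
  move=> h; apply: (lt_le_trans _ (le_trans h _)); first by rewrite lte_fin divr_gt0.
  by apply: (le_outer_measure (hausdorff_outer m)) => v [].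
rewrite -lte_fin (wvolSE u_span q0 ww z'0) wvol.unlock.
apply: (@lt_le_trans _ _ (w0%:E * H S)%E).
  by rewrite mule_gt0 ?lte_fin ?(weight_lower_gt0 ww).
rewrite -(integral_cst H (@measurable_sphere R m)).
apply: le_integral_sphere.
- exact: measurable_cst.
- exact: (measurable_Edens q u_span ww z'0).
- by move=> v _; rewrite lee_fin ltW// (weight_lower_gt0 ww).
- move=> v Sv; rewrite lee_fin densE; have /andP[wv _] := weight_bounds ww Sv.
  apply: le_trans wv _; rewrite ler_peMl ?(ltW (weight_gt0 ww Sv))//.
  have r1 : 1 <= rho z' v.
    apply/(le_radial u_span) => // i; rewrite mul1r.
    by apply: le_trans (dot_unit_le u_unit v i) _; have -> : enorm v = 1 := Sv.
  by rewrite -(powRr0 (rho z' v)) ler_powR// ltW.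
Qed.

End at_maximizer.
End maximizer.

(** * Comparison of weighted volumes, and facet cones *)

Section wvol_estimates.
Context {R : realType}.
Variables m k : nat.
Variables (u : 'I_k -> 'rV[R]_m.+1) (w : 'rV[R]_m.+1 -> R) (q w0 w1 : R).
Notation S := (sphere R m.+1).
Notation T := (caratheodory_type (@hausdorff_outer R m.+1 m)).
Notation H := (hausdorff_measure R m.+1 m).
Hypothesis u_span : forall v, S v -> exists i, 0 < dot v (u i).
Hypothesis q0 : 0 < q.
Hypothesis ww : bounded_weight w w0 w1.
Implicit Types (z : 'I_k -> R) (v : 'rV[R]_m.+1) (A B : set T).

Local Notation rho z := (radial (polyhedron u z)).
Local Notation dens := (dens u w q).
Local Notation wvol := (wvol u w q).

Lemma wvol_indic z A : measurable A -> A `<=` (S : set T) ->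
  wvol z A = (\int[H]_(v in (S : set T)) (dens z v * \1_A v)%:E)%E.
Proof.
move=> mA AS; have AE : A = (S : set T) `&` A by apply/seteqP; split => [v Av|v []//]; split => //; exact: AS.
rewrite {1}AE wvol.unlock integral_mkcondr; apply: eq_integral => v _.
by rewrite /patch indicE; case: ifPn => _; rewrite ?mulr1// mulr0.
Qed.

Lemma measurable_Edens_indic z A : (forall i, 0 <= z i) -> measurable A ->
  measurable_fun (S : set T) (fun v : T => (dens z v * \1_A v)%:E).
Proof.
move=> z0 mA; apply/measurable_EFinP.
exact: (@measurable_funM _ T R S (dens z) \1_A (measurable_dens q u_span ww z0) (measurable_indic mA)).
Qed.

(** For raising coordinates: the gain [K] on [A] is absolute, as the old density may vanish
    there. *)
Lemma wvol_gain z z' A (K : R) : (forall i, 0 <= z i) -> (forall i, 0 <= z' i) ->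
  measurable A -> A `<=` (S : set T) -> 0 <= K ->
  (forall v, S v -> dens z v <= dens z' v) ->
  (forall v, A v -> dens z v + K <= dens z' v) ->
  (wvol z S + K%:E * H A <= wvol z' S)%E.
Proof.
move=> z0 z'0 mA AS K0 hS hA.
have mI : measurable_fun (S : set T) (fun v : T => (K * \1_A v)%:E).
  apply/measurable_EFinP; exact: (@measurable_funM _ T R S (cst K) \1_A (measurable_cst _) (measurable_indic mA)).
have f0 v : S v -> (0 <= (dens z v)%:E)%E by move=> Sv; rewrite lee_fin (dens_ge0 u q ww).
have I0 v : S v -> (0 <= (K * \1_A v)%:E)%E by move=> _; rewrite lee_fin mulr_ge0.
have -> : (K%:E * H A = \int[H]_(v in (S : set T)) (K * \1_A v)%:E)%E.
  have AE : A `&` (S : set T) = A by apply/seteqP; split => [v []//|v Av]; split => //; exact: AS.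
  rewrite -{1}AE -(integral_indic H (@measurable_sphere R m) mA).
  rewrite -(ge0_integralZl_EFin H (@measurable_sphere R m) _ _ K0).
  - by apply: eq_integral => v _; rewrite EFinM.
  - by move=> v _; rewrite lee_fin.
  - by apply/measurable_EFinP; exact: measurable_indic.
rewrite wvol.unlock -(ge0_integralD H (@measurable_sphere R m) f0 (measurable_Edens q u_span ww z0) I0 mI).
apply: le_integral_sphere.
- exact: (emeasurable_funD (measurable_Edens q u_span ww z0) mI).
- exact: (measurable_Edens q u_span ww z'0).
- by move=> v Sv; rewrite adde_ge0 ?f0 ?I0.
- move=> v Sv; rewrite -EFinD lee_fin indicE.
  have [|_] := boolP (v \in A); last by rewrite mulr0 addr0; exact: hS.
  by rewrite inE mulr1; exact: hA.
Qed.

(** For lowering a coordinate: the loss on [A] is at most a fraction [K] of the old density. *)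
Lemma wvol_loss z z' A (K : R) : (forall i, 0 <= z i) -> (forall i, 0 <= z' i) ->
  measurable A -> A `<=` (S : set T) -> 0 <= K ->
  (forall v, S v -> ~ A v -> dens z v <= dens z' v) ->
  (forall v, A v -> dens z v <= dens z' v + K * dens z v) ->
  (wvol z S <= wvol z' S + K%:E * wvol z A)%E.
Proof.
move=> z0 z'0 mA AS K0 hS hA.
have f0 v : S v -> (0 <= (dens z' v)%:E)%E by move=> Sv; rewrite lee_fin (dens_ge0 u q ww).
have I0 v : S v -> (0 <= (dens z v * \1_A v)%:E)%E.
  by move=> Sv; rewrite lee_fin mulr_ge0 ?(dens_ge0 u q ww).
have mI := measurable_Edens_indic z0 mA.
have mKI : measurable_fun (S : set T) (fun v : T => (K%:E * (dens z v * \1_A v)%:E)%E).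
  exact: (emeasurable_funM (measurable_cst _) mI).
have KI0 v : S v -> (0 <= K%:E * (dens z v * \1_A v)%:E)%E.
  by move=> Sv; rewrite mule_ge0 ?lee_fin// -lee_fin I0.
rewrite (wvol_indic z mA AS) -(ge0_integralZl_EFin H (@measurable_sphere R m) I0 mI K0).
rewrite wvol.unlock -(ge0_integralD H (@measurable_sphere R m) f0 (measurable_Edens q u_span ww z'0) KI0 mKI).
apply: le_integral_sphere.
- exact: (measurable_Edens q u_span ww z0).
- exact: (emeasurable_funD (measurable_Edens q u_span ww z'0) mKI).
- by move=> v Sv; rewrite lee_fin (dens_ge0 u q ww).
- move=> v Sv; rewrite -EFinM -EFinD lee_fin indicE.
  have [|] := boolP (v \in A); first by rewrite inE mulr1; exact: hA.
  by rewrite notin_setE mulr0 mulr0 addr0; exact: hS.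
Qed.

Lemma wvol_cvg z (A : nat -> set T) B : (forall i, 0 <= z i) ->
  (forall N, measurable (A N)) -> (forall N, A N `<=` (S : set T)) ->
  measurable B -> B `<=` (S : set T) ->
  (forall v, S v -> \forall N \near \oo, A N v <-> B v) ->
  fine (wvol z (A N)) @[N --> \oo] --> fine (wvol z B).
Proof.
move=> z0 mA AS mB BS AB.
have [M M0 zM] := nneg_bounded z0.
have [K K0 hK] := dens_bound u_span q0 ww M0.
apply: fine_cvg; rewrite fineK; last exact: (wvol_fin u_span q0 ww z0 mB BS).
rewrite (wvol_indic z mB BS).
under eq_fun => N do rewrite (wvol_indic z (mA N) (@AS N)).
apply: (@dominated_cvg _ _ _ H S _ (fun N v => (dens z v * \1_(A N) v)%:E) _ (cst K%:E)).
- exact: measurable_sphere.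
- by move=> N; exact: measurable_Edens_indic.
- move=> v Sv; apply: cvg_near_cst; apply: filterS (AB v Sv) => N [h1 h2].
  rewrite !indicE; congr (_ * _)%:E; congr (_%:R); congr nat_of_bool.
  by apply/idP/idP; rewrite !inE.
- by [].
- exact: integrable_cst_sphere.
- move=> N v Sv; have d0 : 0 <= dens z v by apply: (dens_ge0 u q ww).
  have i1 : \1_(A N) v <= 1 :> R by rewrite indicE lern1 leq_b1.
  have i0 : 0 <= \1_(A N) v :> R by rewrite indicE.
  rewrite gee0_abs ?lee_fin ?(mulr_ge0 d0 i0)//.
  by apply: le_trans (hK z zM v Sv); rewrite (ler_piMr d0 i1).
Qed.

(** For positive [z] this is, off [ridges], the set [alpha_star] of the single normal [u i], in a
    form whose measurability is evident. *)
Definition facet_cone z i : set T := S `&` [set v | rho z v * dot v (u i) = z i].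

Lemma measurable_radial_ge z i a : (forall i, 0 <= z i) ->
  measurable (S `&` [set v | a <= rho z v * dot v (u i)] : set T).
Proof.
move=> z0.
have mf : measurable_fun (S : set T) ((fun v => rho z v * dot v (u i)) : T -> R).
  exact: (@measurable_funM _ T R S (rho z) (fun v => dot v (u i))
    (measurable_radial u_span z0) (measurable_dot_sphere (u i))).
have := mf (@measurable_sphere R m) `[a, +oo[%classic (measurable_itv _).
rewrite (_ : _ `&` _ = S `&` [set v | a <= rho z v * dot v (u i)])//.
by apply/seteqP; split => v /=; rewrite in_itv/= andbT.
Qed.

Lemma measurable_facet_cone z i : (forall i, 0 <= z i) -> measurable (facet_cone z i).
Proof.
move=> z0; rewrite (_ : facet_cone z i = S `&` [set v | z i <= rho z v * dot v (u i)]).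
  exact: measurable_radial_ge.
apply/seteqP; split => v [Sv /= h]; split => //=; first by rewrite h.
by apply/eqP; rewrite eq_le h (radial_dot u_span).
Qed.

(** If [v] hits the facets [i] and [j], eliminating the radial function from the two equations shows
    [v] orthogonal to this combination of [u i] and [u j]. The full great spheres are taken because
    they are known to be null. *)
Definition ridges z : set T :=
  \bigcup_(ij : 'I_k * 'I_k) (if ij.1 == ij.2 then set0 else
    S `&` [set v | dot v (z ij.2 *: u ij.1 - z ij.1 *: u ij.2) = 0]).

(** If a normal of these great spheres vanished, comparing lengths would give [z i = z j], and then
    [u i = u j]. *)
Lemma ridges_null z : (forall i, S (u i)) -> injective u -> (forall i, 0 < z i) ->
  H (ridges z) = 0%E.
Proof.
move=> uS uI z0; apply/eqP; rewrite eq_le (outer_measure_ge0 (hausdorff_outer m)) andbT.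
apply: le_trans (@outer_measure_bigcup_fin _ _ (hausdorff_outer m) _ _ _ (fun v h => h)) _.
rewrite big1// => -[i j] _ /=; case: eqVneq => [_|ij]; first exact: outer_measure0.
apply: hausdorff_great_sphere; rewrite subr_eq0; apply/negP => /eqP h.
have zz : z i = z j.
  have := congr1 enorm h; rewrite !enormZ !gtr0_norm//.
  have -> : enorm (u i) = 1 := uS i; have -> : enorm (u j) = 1 := uS j.
  by rewrite !mulr1.
move: h; rewrite zz => /scalerI h; case/eqP: ij; apply: uI; apply: h.
by rewrite gt_eqF.
Qed.

Lemma facet_cone_unique z i j v : facet_cone z i v -> facet_cone z j v -> ~ ridges z v -> i = j.
Proof.
move=> [Sv /= vi] [_ /= vj] nr; apply/eqP/negPn/negP => ij; apply: nr.
exists (i, j) => //=; rewrite (negbTE ij); split => //=.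
by rewrite !dotE -vi -vj; ring.
Qed.

(** Off the ridges the cones are disjoint. With the whole sphere for [B] this sums the facet
    integrals; with [alpha_star] it evaluates the dual curvature measure. *)
Lemma wvol_cones z (J : pred 'I_k) B : (forall i, S (u i)) -> injective u ->
  (forall i, 0 < z i) -> B `<=` (S : set T) ->
  (forall v, S v -> ~ ridges z v -> B v <-> exists2 i, J i & facet_cone z i v) ->
  wvol z B = (\sum_(i | J i) wvol z (facet_cone z i))%E.
Proof.
move=> uS uI z0 BS BJ.
have z0' i : 0 <= z i by exact: ltW.
have N0 := ridges_null uS uI z0; have mN := null_measurable N0.
have NS : ridges z `<=` (S : set T).
  by move=> v [[i j] _ /=]; case: ifP => // _ [].
pose F i := facet_cone z i `\` ridges z.
have mF i : measurable (F i) by apply: measurableD => //; exact: measurable_facet_cone.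
pose s := [seq i <- index_enum 'I_k | J i].
pose A := \big[setU/set0]_(i <- s) F i.
have AE v : A v <-> exists2 i, J i & F i v.
  rewrite /A -bigcup_seq; split => [[i /=]|[i Ji Fi]].
    by rewrite mem_filter => /andP[Ji _] Fi; exists i.
  by exists i => //=; rewrite mem_filter Ji mem_index_enum.
have mA : measurable A by exact: bigsetU_measurable.
have AS : A `<=` (S : set T) by move=> v /AE[i _ [[]]].
have mf := measurable_Edens q u_span ww z0'.
have f0 v : S v -> (0 <= (dens z v)%:E)%E by move=> Sv; rewrite lee_fin (dens_ge0 u q ww).
have -> : wvol z B = wvol z A.
  rewrite wvol.unlock; apply: (integral_ess_eq mA mN N0 AS BS NS mf f0).
  apply/seteqP; split => v [].
    by move=> /[dup] Av /AE[i Ji [Fi nr]] _; split => //; apply/BJ => //; [exact: AS|exists i].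
  move=> Bv nr; split => //; apply/AE; have [i Ji Fi] := (BJ v (BS v Bv) nr).1 Bv.
  by exists i.
have -> : wvol z A = (\sum_(i <- s) wvol z (F i))%E.
  have us : uniq s by exact: filter_uniq (index_enum_uniq _).
  have ts : trivIset [set` s] F.
    by move=> i j _ _ [v [[Fi nr] [Fj _]]]; exact: (facet_cone_unique Fi Fj nr).
  rewrite wvol.unlock.
  exact: (ge0_integral_bigsetU H mF us ts (measurable_fun_sphereS mf AS) (fun v Av => f0 v (AS v Av))).
rewrite big_filter; apply: eq_bigr => i _.
have FS : F i `<=` (S : set T) by move=> v [[]].
have CS : facet_cone z i `<=` (S : set T) by move=> v [].
have FC : F i `\` ridges z = facet_cone z i `\` ridges z by rewrite /F setDDl setUid.
by rewrite wvol.unlock; apply/esym; exact: (integral_ess_eq (mF i) mN N0 FS CS NS mf f0 FC).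
Qed.

End wvol_estimates.

(** * Positivity of the maximizer and the facet identity *)

Section optimality.
Context {R : realType}.
Variables m k : nat.
Variables (u : 'I_k -> 'rV[R]_m.+1) (w : 'rV[R]_m.+1 -> R) (q w0 w1 p : R).
Variable alpha : 'I_k -> R.
Notation S := (sphere R m.+1).
Notation T := (caratheodory_type (@hausdorff_outer R m.+1 m)).
Notation H := (hausdorff_measure R m.+1 m).
Hypothesis m0 : (0 < m)%N.
Hypothesis u_unit : forall i, S (u i).
Hypothesis u_span : forall v, S v -> exists i, 0 < dot v (u i).
Hypothesis u_inj : injective u.
Hypothesis q0 : 0 < q.
Hypothesis p1 : 1 < p.
Hypothesis ww : bounded_weight w w0 w1.
Hypothesis alpha0 : forall i, 0 < alpha i.

Local Notation rho z := (radial (polyhedron u z)).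
Local Notation dens := (dens u w q).
Local Notation wvol := (wvol u w q).
Local Notation wvolS z := (fine (wvol z S)).
Local Notation cost := (cost p alpha).

Variable z : 'I_k -> R.
Hypothesis z0 : forall i, 0 <= z i.
Hypothesis z1 : cost z = 1.
Hypothesis zmax : forall z', (forall i, 0 <= z' i) -> cost z' = 1 -> wvolS z' <= wvolS z.

Let p0 : 0 < p. Proof. exact: lt_trans p1. Qed.

Let Vgt0 : 0 < wvolS z.
Proof. exact: (wvolS_max_gt0 m0 u_unit u_span q0 p1 ww alpha0 zmax). Qed.

Let le_cost z' : (forall i, 0 <= z' i) -> 0 < cost z' ->
  wvolS z' <= cost z' `^ (q / p) * wvolS z.
Proof. exact: (wvolS_le_cost u_span q0 p1 ww alpha0 zmax). Qed.

(** Otherwise almost every [v] has [dot v (u i) > 0] for some [i] with [z i = 0]; its radial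
    function vanishes, and so would the maximum. Such a direction is what the strip estimate
    requires. *)
Lemma exists_negative_dir : exists2 v, S v & forall i, z i = 0 -> dot v (u i) < 0.
Proof.
apply: contrapT => h.
pose N : set T := \bigcup_(i : 'I_k) (S `&` [set v | dot v (u i) = 0]).
have N0 : H N = 0%E.
  apply/eqP; rewrite eq_le (outer_measure_ge0 (hausdorff_outer m)) andbT.
  apply: le_trans (@outer_measure_bigcup_fin _ _ (hausdorff_outer m) _ _ _ (fun v h => h)) _.
  rewrite big1// => i _; apply: hausdorff_great_sphere.
  by rewrite -enorm_eq0; have -> : enorm (u i) = 1 := u_unit i; rewrite oner_eq0.
have mN := null_measurable N0.
have : wvol z S = 0%E.
  rewrite wvol.unlock (ge0_negligible_integral mN (@measurable_sphere R m)
    (measurable_Edens q u_span ww z0) _ N0); last by move=> v Sv; rewrite lee_fin (dens_ge0 u q ww).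
  apply: integral0_eq => v [Sv nN].
  have [i zi vi] : exists2 i, z i = 0 & 0 < dot v (u i).
    apply: contrapT => h'; apply: h; exists v => // i zi.
    have [//|vi|vi] := ltgtP (dot v (u i)) 0; first by exfalso; apply: h'; exists i.
    by exfalso; apply: nN; exists i.
  by rewrite densE (radial_eq0 u_span z0 Sv zi vi) powR0 ?gt_eqF// mul0r.
by move=> V0; move: Vgt0; rewrite V0 ltxx.
Qed.

Lemma maximizer_gt0 i : 0 < z i.
Proof.
rewrite lt_def z0 andbT; apply/negP => /eqP zi0.
have [v0 _ v0neg] := exists_negative_dir.
pose I := [pred j | z j == 0].
have Ii : I i by rewrite /= zi0.
have v0I j : I j -> dot v0 (u j) < 0 by move=> /eqP; exact: v0neg.
have [c [D [c0 D0 strip]]] := hausdorff_strip m0 Ii u_unit v0I.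
have [r [r0 r1 rz]] : exists r, [/\ 0 < r, r <= 1 & forall j, z j != 0 -> r <= z j].
  have : exists r, [/\ 0 < r, r <= 1 & forall j, j \in enum 'I_k -> z j != 0 -> r <= z j].
    elim: (enum 'I_k) => [|j s [r [r0 r1 rs]]]; first by exists 1.
    have [zj|zj] := eqVneq (z j) 0.
      exists r; split => // l; rewrite inE => /orP[/eqP ->|]; last exact: rs.
      by rewrite zj eqxx.
    exists (Order.min r (z j)); split => [||l].
    - by rewrite lt_min r0 lt_def zj z0.
    - by rewrite ge_min r1.
    - rewrite inE => /orP[/eqP -> _|ls zl]; first by rewrite ge_min lexx orbT.
      by rewrite ge_min rs.
  by move=> [r [r0 r1 h]]; exists r; split => // j; apply: h; rewrite mem_enum.
pose A := \sum_(j | I j) alpha j.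
have A0 : 0 < A.
  by rewrite /A (bigD1 i)//= ltr_pwDl// sumr_ge0// => j _; exact: ltW.
(* On the strip the density rises from 0 to at least [K]. *)
pose K := r `^ q * w0.
have K0 : 0 < K by rewrite mulr_gt0 ?powR_gt0 ?(weight_lower_gt0 ww).
have b0 : 0 < q / p by rewrite divr_gt0.
apply: (@linear_gain_contra R (wvolS z) (q / p) A D p (K * c)) => //.
  by rewrite mulr_gt0.
move=> N; set t := D / N.+1%:R.
have t0 : 0 < t by rewrite divr_gt0.
pose zt j := z j + (if z j == 0 then t else 0).
have zt0 j : 0 <= zt j by rewrite addr_ge0//; case: ifP => // _; exact: ltW.
have ztcost : cost zt = 1 + A * t `^ p.
  rewrite -z1 /cost /A mulr_suml [X in _ + X]big_mkcond -big_split/=.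
  apply: eq_bigr => j _; rewrite /zt; case: eqVneq => [->|_]; last by rewrite !addr0.
  by rewrite add0r powR0 ?gt_eqF// mulr0 add0r.
have ct0 : 0 < cost zt by rewrite ztcost addr_gt0// mulr_gt0// powR_gt0.
rewrite -ztcost; apply: le_trans (le_cost zt0 ct0).
pose E : set T := [set x | [/\ S x, exists2 i, I i & 0 < dot x (u i) &
      forall i, I i -> dot x (u i) <= t]].
have mE : measurable E.
  rewrite (_ : E = S `&` ((\bigcup_(j in [set j | I j]) [set x | 0 < dot x (u j)]) `&`
      (\bigcap_(j in [set j | I j]) [set x | dot x (u j) <= t]))).
    apply: measurableI; first exact: measurable_sphere.
    apply: measurableI.
      apply: open_measurable_hausdorff; apply: bigcup_open => j _.
      rewrite (_ : [set x | _] = (dot^~ (u j)) @^-1` [set a | 0 < a])//.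
      by apply: open_comp => [x _|]; [exact: continuous_dotl|exact: open_gt].
    apply: closed_measurable_hausdorff; apply: closed_bigI => j _.
    exact: closed_dot_le.
  by apply/seteqP; split => x; [move=> [Sx [j Ij xj] h]; split => //; split => //; exists j|
    move=> [Sx [[j Ij xj] h]]; split => //; exists j].
have ES : E `<=` (S : set T) by move=> x [].
have zzt j : z j <= zt j by rewrite lerDl; case: ifP => // _; exact: ltW.
have gain := @wvol_gain R m k u w q w0 w1 u_span ww z zt E K z0 zt0 mE ES (ltW K0).
have {}gain : (wvol z S + K%:E * H E <= wvol zt S)%E.
  apply: gain => v; first exact: (le_dens u_span q0 ww z0 zzt).
  move=> [Sv [j /eqP zj vj] vt].
  rewrite densE (radial_eq0 u_span z0 Sv zj vj) powR0 ?gt_eqF// mul0r add0r densE.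
  (* For raised coordinates [r <= 1] and [dot v (u l) <= t]; for the others [dot v (u l) <= 1] and
     [r <= z l]. *)
  have rr : r <= rho zt v.
    apply/(le_radial u_span zt0 Sv (ltW r0)) => l; rewrite /zt.
    case: eqVneq => [zl|zl].
      rewrite zl add0r; have [vl|vl] := leP 0 (dot v (u l)).
        by apply: le_trans (vt l _); [rewrite ler_piMl|rewrite /= zl].
      by apply: le_trans (ltW t0); rewrite mulr_ge0_le0 ?ltW.
    rewrite addr0; apply: le_trans (rz l zl); rewrite ler_piMr ?(ltW r0)//.
    by apply: le_trans (dot_unit_le u_unit v l) _; have -> : enorm v = 1 := Sv.
  have /andP[wv _] := weight_bounds ww Sv.
  apply: ler_pM; rewrite ?powR_ge0 ?(ltW (weight_lower_gt0 ww))//.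
  by rewrite ge0_ler_powR ?nnegrE ?(ltW q0) ?(ltW r0) ?(le_trans (ltW r0) rr).
rewrite -lee_fin (wvolSE u_span q0 ww zt0); apply: le_trans gain.
rewrite EFinD (wvolSE u_span q0 ww z0) leeD2l//.
rewrite -mulrA EFinM lee_pmul2l ?lte_fin//; exact: strip.
Qed.

Let zpos := maximizer_gt0.

(** Shrinking [z i] leaves the radial function unchanged off [C N], the directions that come within
    the factor [expR (- s N)] of constraint [i]. These sets shrink to the facet cone, so the loss is
    governed by its integral. *)
Lemma wvol_facet_ge i : alpha i * z i `^ p * wvolS z <= fine (wvol z (facet_cone u z i)).
Proof.
pose a := alpha i * z i `^ p.
have a0 : 0 < a by rewrite mulr_gt0// powR_gt0.
have z0' := z0.
pose s (N : nat) : R := N.+1%:R^-1.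
have s0 N : 0 < s N by rewrite invr_gt0.
pose C N : set T := S `&` [set v | expR (- s N) * z i <= rho z v * dot v (u i)].
have mC N : measurable (C N) by exact: (measurable_radial_ge u_span).
have CS N : C N `<=` (S : set T) by move=> v [].
have Cfin N := wvol_fin u_span q0 ww z0 (mC N) (@CS N).
have C0 N : 0 <= fine (wvol z (C N)) by rewrite fine_ge0// (wvol_ge0 u q ww).
have est N : wvolS z * a <= fine (wvol z (C N)) * (1 + (p + q * a) * s N).
  pose z' j := if j == i then expR (- s N) * z j else z j.
  have z'0 j : 0 <= z' j by rewrite /z'; case: ifP => // _; rewrite mulr_ge0 ?expR_ge0.
  have e1 : expR (- s N) <= 1 by rewrite -[leRHS]expR0 ler_expR oppr_le0 ltW.
  have cE : cost z' = 1 - a * (1 - expR (- (p * s N))).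
    rewrite -[X in _ = X - _]z1 /cost (bigD1 i)//= [in RHS](bigD1 i)//= /z' eqxx.
    rewrite powRM ?expR_ge0// -expRM mulNr (mulrC (s N)).
    rewrite (eq_bigr (fun j => alpha j * z j `^ p)); last by move=> j /negbTE ->.
    by rewrite /a; ring.
  have c0 : 0 < cost z'.
    rewrite /cost (bigD1 i)//= ltr_pwDl//.
      by rewrite mulr_gt0// powR_gt0// /z' eqxx mulr_gt0 ?expR_gt0.
    by apply: sumr_ge0 => j _; rewrite mulr_ge0 ?powR_ge0// ltW.
  apply: (@variation_estimate R p q a (s N) (wvolS z) (fine (wvol z (C N))) (cost z')) => //.
    exact: ltW.
  pose K := 1 - expR (- (q * s N)).
  have K0 : 0 <= K by rewrite subr_ge0 -[leRHS]expR0 ler_expR oppr_le0 mulr_ge0 ?(ltW q0)// ltW.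
  apply: (@le_trans _ _ (wvolS z' + K * fine (wvol z (C N)))); last first.
    by rewrite lerD2r; exact: le_cost.
  have loss := @wvol_loss R m k u w q w0 w1 u_span ww z z' (C N) K z0 z'0 (mC N) (@CS N) K0.
  have {}loss : (wvol z S <= wvol z' S + K%:E * wvol z (C N))%E.
    apply: loss => v.
      move=> Sv nC; have vi : rho z v * dot v (u i) < expR (- s N) * z i.
        by rewrite ltNge; apply/negP => h; apply: nC.
      rewrite !densE ler_wpM2r ?(ltW (weight_gt0 ww Sv))//.
      rewrite ge0_ler_powR ?nnegrE ?(ltW q0) ?(radial_ge0 u_span)//.
      apply/(le_radial u_span z'0 Sv (radial_ge0 u_span z0 Sv)) => j.
      rewrite /z'; case: eqVneq => [->|_]; first exact: ltW.
      exact: radial_dot.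
    (* Here [z'] is at least [expR (- s N) * z] in every coordinate, so the density keeps the factor
       [expR (- (q * s N))]. *)
    move=> [Sv _]; rewrite -lerBlDr -{1}[dens z v]mul1r -mulrBl /K subKr.
    have -> : expR (- (q * s N)) = expR (- s N) `^ q by rewrite -expRM mulNr mulrC.
    rewrite -(densZ w q u_span z0 (expR_gt0 _) Sv).
    apply: (le_dens u_span q0 ww) => // j; first by rewrite mulr_ge0 ?expR_ge0.
    by rewrite /z'; case: ifP => // _; rewrite ler_piMl.
  rewrite -lee_fin EFinD EFinM (wvolSE u_span q0 ww z0) (wvolSE u_span q0 ww z'0).
  by rewrite fineK.
have cvgC : fine (wvol z (C N)) @[N --> \oo] --> fine (wvol z (facet_cone u z i)).
  apply: (wvol_cvg u_span q0 ww z0 mC CS).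
  - exact: measurable_facet_cone.
  - by move=> v [].
  - move=> v Sv.
    have [vi|vi] := eqVneq (rho z v * dot v (u i)) (z i).
      apply: nearW => N; split => // _; split => //=; rewrite vi ler_piMl//.
      by rewrite -[leRHS]expR0 ler_expR oppr_le0 ltW.
    have {}vi : rho z v * dot v (u i) < z i by rewrite lt_neqAle vi (radial_dot u_span).
    pose e := (z i - rho z v * dot v (u i)) / z i.
    have e0 : 0 < e by rewrite divr_gt0// subr_gt0.
    have [N0] : exists N, 0 + N.+1%:R^-1 < e by exact/ltr_add_invr.
    rewrite add0r => N0e; exists N0 => // N /= N0N.
    split => [[_ /= h]|[_ /= h]]; last by move: vi; rewrite h ltxx.
    exfalso; have sN : s N < e.
      by apply: le_lt_trans N0e; rewrite lef_pV2 ?posrE// ler_nat ltnS.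
    have : (1 - s N) * z i <= rho z v * dot v (u i).
      apply: le_trans h; rewrite ler_wpM2r//; exact: expR_ge1Dx.
    move: sN; rewrite /e ltr_pdivlMr// mulrBl mul1r; lra.
have cvg1 : fine (wvol z (C N)) * (1 + (p + q * a) * s N) @[N --> \oo] -->
    fine (wvol z (facet_cone u z i)) * (1 + (p + q * a) * 0).
  apply: cvgM => //; apply: cvgD; first exact: cvg_cst.
  by apply: cvgMl_tmp; exact: cvg_harmonic.
rewrite mulr0 addr0 mulr1 in cvg1.
rewrite mulrC -(cvg_lim _ cvg1)//; apply: limr_ge; first by apply/cvg_ex; eexists; exact: cvg1.
exact: nearW.
Qed.

Lemma wvol_facet i : fine (wvol z (facet_cone u z i)) = alpha i * z i `^ p * wvolS z.
Proof.
have mF j := measurable_facet_cone u_span j z0.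
have FS j : facet_cone u z j `<=` (S : set T) by move=> v [].
have Ffin j := wvol_fin u_span q0 ww z0 (mF j) (@FS j).
have sumF : wvolS z = \sum_j fine (wvol z (facet_cone u z j)).
  apply: EFin_inj; rewrite (wvolSE u_span q0 ww z0).
  rewrite (@wvol_cones R m k u w q w0 w1 u_span ww z xpredT (S : set T) u_unit u_inj zpos (fun v h => h)).
    by rewrite -sumEFin; apply: eq_bigr => j _; rewrite fineK.
  move=> v Sv _; split => // _.
  by have [j _ vj] := radial_tight u_span z0 Sv; exists j.
have sumA : \sum_j alpha j * z j `^ p * wvolS z = wvolS z.
  by rewrite -mulr_suml -[X in X * _]/(cost z) z1 mul1r.
have := sumF; rewrite -[LHS]sumA => /esym/eqP.
rewrite -subr_eq0 -sumrB psumr_eq0 => [/allP/(_ i)|j _].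
  by rewrite mem_index_enum subr_eq0 => /(_ isT)/eqP.
by rewrite subr_ge0 wvol_facet_ge.
Qed.

End optimality.

(** * Discrete measures *)

Section discrete_measures.
Context {R : realType}.

(** The integrator is a plain set function and has to be recognised as a finite sum of measures;
    [msum] expects a sequence, which is padded with [mzero]. *)
Lemma integral_sum_dirac d (X : measurableType d) k (c : 'I_k -> {nonneg R}) (a : 'I_k -> X)
    (D : set X) (f : X -> \bar R) : measurable D -> measurable_fun D f ->
  (forall x, D x -> 0 <= f x)%E ->
  (\int[(fun A => \sum_i (c i)%:num%:E * \d_(a i) A)]_(x in D) f x =
   \sum_i (c i)%:num%:E * (\d_(a i) D * f (a i)))%E.
Proof.
move=> mD mf f0.
pose m_ (j : nat) : measure X R :=
  if insub j is Some i then mscale (c i) (dirac (a i)) else mzero.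
have mE (i : 'I_k) : m_ i = mscale (c i) (dirac (a i)) by rewrite /m_ valK.
have -> : (fun A => \sum_i (c i)%:num%:E * \d_(a i) A)%E = msum m_ k.
  by apply/funext => A; rewrite /msum; apply: eq_bigr => i _; rewrite mE.
rewrite (ge0_integral_measure_sum m_ mD f0 mf); apply: eq_bigr => i _.
by rewrite mE (ge0_integral_mscale _ mD (c i) mf f0) (integral_dirac _ mD mf).
Qed.

Variable n : nat.
Notation S := (sphere R n).
Notation BT := (borel_rV R n).

Lemma borel_open (A : set 'rV[R]_n) : open A -> measurable (A : set BT).
Proof. by move=> oA; apply: sub_sigma_algebra. Qed.

Lemma borel_closed (A : set 'rV[R]_n) : closed A -> measurable (A : set BT).
Proof.
move=> cA; rewrite -(setCK A); apply: measurableC; apply: borel_open.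
exact: closed_openC.
Qed.

Lemma closed_finite_set (A : set 'rV[R]_n) : finite_set A -> closed A.
Proof.
have := @accessible_finite_set_closed 'rV[R]_n => -[+ _]; apply.
apply: hausdorff_accessible; exact: norm_hausdorff.
Qed.

Variable mu : {finite_measure set BT -> \bar R}.

(** Points off the support have null neighbourhoods, but uncountably many of them. The sphere minus
    the finite support is exhausted by compact sets [K j], each covered by finitely many such
    neighbourhoods. *)
Lemma measure_support_compl : discrete_on_sphere mu -> mu (~` measure_support mu) = 0%E.
Proof.
move=> [muS finF]; set F := measure_support mu.
have [s Fs] : exists s : seq 'rV[R]_n, F = [set` s] by exact/finite_seqP.
have mF : measurable (~` F : set BT).
  by apply: measurableC; apply: borel_closed; exact: closed_finite_set.
apply/(negligibleP _ mF).
pose K (j : nat) : set 'rV[R]_n := S `&` \bigcap_(a in F) [set x | j.+1%:R^-1 <= enorm (x - a)].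
have cK j : compact (K j).
  apply: (subclosed_compact _ compact_sphere); last by move=> x [].
  apply: closedI; first exact: closed_sphere.
  apply: closed_bigI => a _.
  have : closed ((fun x => enorm (x - a)) @^-1` [set t : R | j.+1%:R^-1 <= t]).
    apply: closed_comp => [x _|]; last exact: closed_ge.
    by apply: (@continuous_lip _ _ (fun x => enorm (x - a)) 1) => y y';
      rewrite mul1r; apply: le_trans (ler_enormB _ _) _; rewrite opprB addrA subrK.
  exact.
have sub : ~` F `<=` ~` S `|` \bigcup_j K j.
  move=> x nFx; have [Sx|nSx] := pselect (S x); [right|by left].
  have : exists j : nat, forall a, a \in s -> j.+1%:R^-1 <= enorm (x - a).
    have : forall a, a \in s -> x != a.
      by move=> a sa; apply/negP => /eqP xa; apply: nFx; rewrite Fs xa.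
    elim: s {Fs} => [|a s IH] h; first by exists 0%N.
    have [|j hj] := IH; first by move=> b bs; apply: h; rewrite inE bs orbT.
    have xa : 0 < enorm (x - a) by rewrite enorm_gt0 subr_eq0 h// inE eqxx.
    have [i] : exists i : nat, 0 + i.+1%:R^-1 < enorm (x - a) by exact/ltr_add_invr.
    rewrite add0r => hi; exists (maxn i j) => b; rewrite inE => /orP[/eqP ->|/hj hb].
      by apply: le_trans (ltW hi); rewrite lef_pV2 ?posrE// ler_nat ltnS leq_maxl.
    by apply: le_trans hb; rewrite lef_pV2 ?posrE// ler_nat ltnS leq_maxr.
  by move=> [j hj]; exists j => //; split => // a; rewrite Fs; exact: hj.
apply: (@negligibleS _ BT R mu _ _ sub); apply: negligibleU.
  by apply/negligibleP => //; apply: borel_open; apply: closed_openC; exact: closed_sphere.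
apply: negligible_bigcup => j.
have [U hU] : {U : 'rV[R]_n -> set 'rV[R]_n & forall x, ~ F x -> [/\ open (U x), U x x & mu (U x) = 0%E]}.
  apply: (@choice _ _ (fun x V => ~ F x -> [/\ open V, V x & mu V = 0%E])) => x.
  have [Fx|nFx] := pselect (F x); first by exists set0.
  move/existsNP : nFx => [V /not_implyP[oV /not_implyP[Vx /negP]]].
  by rewrite -leNgt measure_le0 => /eqP V0; exists V.
have KF x : K j x -> ~ F x.
  move=> [_ Kx] Fx; have := Kx x Fx; rewrite /= subrr enorm0 leNgt.
  by rewrite invr_gt0 ltr0n.
have := cK j; rewrite compact_cover => /(_ _ (K j) U)[x /KF/hU[]//|x Kx|D DK KD].
  by exists x => //; have [] := hU _ (KF _ Kx).
have neg (l : seq 'rV[R]_n) : (forall x, x \in l -> K j x) ->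
    mu.-negligible (\bigcup_(x in [set` l]) U x : set BT).
  rewrite bigcup_seq; elim: l => [_|x l IH h]; first by rewrite big_nil; exact: negligible_set0.
  rewrite big_cons; apply: negligibleU.
    have [oU _ U0] := hU _ (KF _ (h x (mem_head _ _))).
    by apply/negligibleP => //; exact: borel_open.
  by apply: IH => y yl; apply: h; rewrite inE yl orbT.
apply: (@negligibleS _ BT R mu _ _ KD (neg (finmap.enum_fset D) _)).
by move=> x /DK; rewrite inE.
Qed.

(** The atoms are the support points. They lie on the sphere, whose complement is open and null. *)
Lemma discrete_measure_repr : discrete_on_sphere mu ->
  exists k (u : 'I_k -> 'rV[R]_n) (alpha : 'I_k -> R),
    [/\ injective u, forall i, S (u i), forall i, 0 < alpha i &
    forall eta : set BT, measurable eta -> mu eta = (\sum_i (alpha i)%:E * \d_(u i : BT) eta)%E].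
Proof.
move=> dmu; have F0 := measure_support_compl dmu; have [muS finF] := dmu.
set F := measure_support mu in F0 finF.
have mF : measurable (F : set BT) by apply: borel_closed; exact: closed_finite_set.
have [s Fs] : exists s : seq 'rV[R]_n, F = [set` s] by exact/finite_seqP.
pose t := undup s; pose u (i : 'I_(size t)) := tnth (in_tuple t) i.
have uF i : F (u i) by rewrite Fs/= -mem_undup; exact: mem_tnth.
have Fu x : F x -> exists i, u i = x.
  rewrite Fs/= -mem_undup => xt; have : x \in in_tuple t by [].
  by move=> /tnthP[i xi]; exists i.
have u_inj : injective u.
  move=> i j; rewrite /u !(tnth_nth 0) /= => /eqP.
  by rewrite nth_uniq ?undup_uniq ?ltn_ord// => /eqP /val_inj.
have m1 a : measurable ([set a] : set BT).
  by apply: borel_closed; apply: closed_finite_set; exact: finite_set1.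
have muf a : mu [set a] \is a fin_num by exact: fin_num_measure.
pose alpha i := fine (mu [set u i]).
have mFc : measurable (~` F : set BT) by exact: measurableC.
have le_mu (A B : set BT) : measurable A -> measurable B -> A `<=` B -> (mu A <= mu B)%E.
  by move=> mA mB; apply: le_measure; rewrite inE.
have muE (eta : set BT) : measurable eta -> mu eta = (\sum_i (alpha i)%:E * \d_(u i : BT) eta)%E.
  move=> meta.
  have -> : mu eta = mu (eta `&` F).
    apply/eqP; rewrite eq_le; apply/andP; split; last first.
      by apply: le_mu; [exact: measurableI|exact: meta|move=> x []].
    apply: (@le_trans _ _ (mu (eta `&` F) + mu (~` F))%E); last by rewrite F0 adde0.
    apply: (@le_trans _ _ (mu ((eta `&` F) `|` ~` F))).
      apply: le_mu; [exact: meta|by apply: measurableU => //; exact: measurableI|].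
      by move=> x ex; have [Fx|nFx] := pselect (F x); [left|right].
    by apply: measureU2; [exact: measurableI|exact: mFc].
  have -> : eta `&` F = \big[setU/set0]_(i < size t | u i \in eta) [set u i].
    apply/seteqP; split => x.
      move=> [ex /Fu[i ui]]; rewrite -bigcup_seq_cond; exists i => /=.
        by rewrite mem_index_enum/=; apply/mem_set; rewrite ui.
      by rewrite ui.
    by rewrite -bigcup_seq_cond => -[i /= /andP[_ /set_mem ei] ->]; split.
  rewrite measure_bigsetU_ord//; last first.
    by move=> i j _ _ [x [-> /u_inj]].
  rewrite big_mkcond/=; apply: eq_bigr => i _; rewrite diracE.
  by case: ifPn => _; rewrite ?mule1 ?mule0// /alpha fineK.
exists (size t), u, alpha; split => //.
- move=> i; apply: contrapT => nS.
  have := uF i (~` S) _ nS; rewrite muS ltxx => h.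
  by have := h (closed_openC closed_sphere).
- move=> i; rewrite -lte_fin /alpha fineK//.
  (* The complement of the other support points is an open neighbourhood of [u i], with all its mass
     at [u i]. *)
  have oU : open (~` (F `\ u i)).
    by apply: closed_openC; apply: closed_finite_set; exact: finite_setD.
  have := uF i _ oU; move=> /(_ (fun h => h.2 erefl)) /lt_le_trans; apply.
  apply: (@le_trans _ _ (mu [set u i] + mu (~` F))%E); last by rewrite F0 adde0.
  apply: (@le_trans _ _ (mu ([set u i] `|` ~` F))); last first.
    exact: measureU2.
  apply: le_mu.
  - exact: borel_open.
  - exact: measurableU.
  - move=> x nx; have [Fx|nFx] := pselect (F x); [left|by right].
    by apply: contrapT => xu; apply: nx.
Qed.

End discrete_measures.

(** * Normals at boundary points of polyhedra *)

Section facet_normals.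
Context {R : realType}.
Variables m k : nat.
Variables (u : 'I_k -> 'rV[R]_m.+1) (z : 'I_k -> R).
Notation S := (sphere R m.+1).
Hypothesis u_unit : forall i, S (u i).
Hypothesis u_span : forall v, S v -> exists i, 0 < dot v (u i).
Hypothesis z0 : forall i, 0 < z i.
Let P := polyhedron u z.
Let rho := radial P.
Let z0' i : 0 <= z i. Proof. exact: ltW. Qed.

Let supportf_ub y : has_ubound [set dot x y | x in P].
Proof.
have [M zM] := bounded_finfun z; have [B hB] := polyhedron_bounded u_span zM.
exists (B * enorm y) => _ [x Px <-]; apply: le_trans (le_dot _ _) _.
by rewrite ler_wpM2r ?enorm_ge0// hB.
Qed.

Let le_supportf x y : P x -> dot x y <= supportf P y.
Proof. by move=> Px; apply: ub_le_sup; [exact: supportf_ub|exists x]. Qed.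

(** A direction in the cone yields a point of [P] where constraint [i] is attained. *)
Lemma supportf_facet v i : facet_cone u z i v -> supportf P (u i) = z i.
Proof.
move=> [Sv /= vi]; have Pv : P (rho v *: v) by exact: polyhedron_radial.
apply/eqP; rewrite eq_le; apply/andP; split.
  by apply: ge_sup; [exists (dot (rho v *: v) (u i)); exists (rho v *: v)|move=> _ [x Px <-]; exact: Px].
by rewrite -vi -dotZl; exact: le_supportf.
Qed.

Lemma facet_cone_alpha_star v i (eta : set 'rV[R]_m.+1) : facet_cone u z i v ->
  eta (u i) -> alpha_star P eta v.
Proof.
move=> Cv; have [Sv /= vi] := Cv => ei; split => //; exists (u i); split => //; split.
  exact: polyhedron_radial.
by rewrite (supportf_facet Cv) dotZl.
Qed.

(** Off the ridges only constraint [i] is tight at [x], so one can move a little within [P] along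
    any [e] with [dot e (u i) <= 0], whence [dot e y <= 0]. Taking [- u i] and the part of [y]
    orthogonal to [u i] for [e] forces [y = u i]. *)
Lemma facet_normal_unique v y i : S v -> S y -> facet_cone u z i v -> ~ ridges u z v ->
  face P y (rho v *: v) -> y = u i.
Proof.
move=> Sv Sy Cv nr [Px xy]; have [_ /= vi] := Cv.
set x := rho v *: v in Px xy.
have Pxj j : dot x (u j) <= z j := Px j.
have slack j : j != i -> 0 < z j - dot x (u j).
  move=> ji; rewrite subr_gt0 lt_neqAle Pxj andbT; apply/negP => /eqP xj.
  have Cj : facet_cone u z j v by split => //=; rewrite -dotZl.
  by case/eqP: ji; exact: (facet_cone_unique Cj Cv nr).
clearbody x.
have [d d0 hd] : exists2 d, 0 < d & forall j, j != i -> d <= z j - dot x (u j).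
  have : exists2 d, 0 < d & forall j, j \in enum 'I_k -> j != i -> d <= z j - dot x (u j).
    elim: (enum 'I_k) => [|j s [d d0 ds]]; first by exists 1.
    have [->|ji] := eqVneq j i.
      by exists d => // l; rewrite inE => /orP[/eqP ->|]; [rewrite eqxx|exact: ds].
    exists (Order.min d (z j - dot x (u j))); first by rewrite lt_min d0 slack.
    move=> l; rewrite inE => /orP[/eqP -> _|ls li]; first by rewrite ge_min lexx orbT.
    by rewrite ge_min ds.
  by move=> [d d0 h]; exists d => // j; apply: h; rewrite mem_enum.
have dir e : dot e (u i) <= 0 -> dot e y <= 0.
  move=> ei; pose t := d / (1 + enorm e).
  have ne : 0 < 1 + enorm e by rewrite ltr_pwDl// enorm_ge0.
  have t0 : 0 < t by rewrite divr_gt0.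
  have Pxe : P (x + t *: e).
    move=> j; rewrite dotDl dotZl; have [->|ji] := eqVneq j i.
      by apply: le_trans (Pxj i); rewrite gerDl mulr_ge0_le0// ltW.
    rewrite -lerBrDl; apply: le_trans (hd j ji); rewrite /t mulrAC ler_pdivrMr//.
    rewrite ler_wpM2l ?(ltW d0)//; apply: le_trans (dot_unit_le u_unit e j) _.
    by rewrite lerDr.
  have := le_supportf y Pxe; rewrite -xy dotDl dotZl gerDl.
  by rewrite pmulr_rle0.
have ui : dot (u i) (u i) = 1 by rewrite -enorm_sqr; have -> : enorm (u i) = 1 := u_unit i; rewrite expr1n.
have yy : dot y y = 1 by rewrite -enorm_sqr; have -> : enorm y = 1 := Sy; rewrite expr1n.
have c0 : 0 <= dot (u i) y.
  by have := dir (- u i); rewrite !dotNl ui oppr_le0 oppr_le0; apply; exact: ler01.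
have c1 : 1 - dot (u i) y ^+ 2 <= 0.
  have := dir (y - dot (u i) y *: u i); rewrite !dotE ui yy (dotC y (u i)) mulr1 subrr.
  by rewrite expr2; apply.
have c2 : 1 <= dot (u i) y.
  by move: c0 c1; rewrite subr_le0 -{1}(expr1n R 2) => c0; rewrite ler_sqr ?nnegrE.
apply/eqP; rewrite -subr_eq0 -dotxx_eq0 eq_le dotxx_ge0 andbT.
by rewrite !dotE ui yy (dotC y (u i)); lra.
Qed.

(** The support function is Lipschitz, with the bound [B] for the norms of points of [P] as
    constant. *)
Lemma measurable_supportf (p : R) (eta : set (borel_rV R m.+1)) :
  measurable_fun eta (fun y : borel_rV R m.+1 => (supportf P y `^ p)%:E).
Proof.
have [M zM] := bounded_finfun z; have [B hB] := polyhedron_bounded u_span zM.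
have P0 : P 0 by move=> i; rewrite dot0l.
have lipS y y' : supportf P y <= supportf P y' + B * enorm (y - y').
  apply: ge_sup; first by exists (dot 0 y); exists 0.
  move=> _ [x Px <-]; rewrite -[y](subrK y') dotDr addrC; apply: lerD; first exact: le_supportf.
  rewrite addrK; apply: le_trans (le_dot _ _) _.
  by rewrite ler_wpM2r ?enorm_ge0// hB.
have cS : continuous (supportf P).
  apply: (@continuous_lip _ _ _ B) => y y'; rewrite ler_norml; apply/andP; split.
    by have := lipS y' y; rewrite enormB; lra.
  by have := lipS y y'; lra.
have mS : measurable_fun [set: borel_rV R m.+1] (supportf P : borel_rV R m.+1 -> R).
  apply: (measurability (@RGenCInfty.G R)) => [|_ [_ [a ->] <-]].
    exact: RGenCInfty.measurableE.
  rewrite setTI (_ : _ @^-1` _ = supportf P @^-1` [set t | a <= t]); last first.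
    by apply/seteqP; split => y /=; rewrite in_itv/= andbT.
  apply: borel_closed; apply: closed_comp => [y _|]; first exact: cS.
  exact: closed_ge.
apply: (@measurable_funS _ _ (borel_rV R m.+1) _ setT) => //.
apply/measurable_EFinP.
exact: (@measurableT_comp _ _ _ (borel_rV R m.+1) _ _ _ setT (supportf P) (measurable_powR p) mS).
Qed.

End facet_normals.

(** * Star bodies as weights, and the discrete dual Minkowski problem *)

Lemma star_radial_bounds (R : realType) n (Q : set 'rV[R]_n) : compact Q -> interior Q 0 ->
  exists r0 r1 : R, 0 < r0 /\ forall v, sphere R n v -> r0 <= radial Q v <= r1.
Proof.
move=> cQ /nbhs_ballP[e /= e0 eQ].
have [M [Mr hM]] := compact_bounded cQ.
pose r1 := n%:R * (M + 1).
have ub v : sphere R n v -> ubound [set t | 0 <= t /\ Q (t *: v)] r1.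
  move=> Sv t [t0 Qt]; have -> : t = enorm (t *: v).
    by rewrite enormZ ger0_norm//; have -> : enorm v = 1 := Sv; rewrite mulr1.
  apply: le_trans (enorm_le_norm _) _; rewrite ler_wpM2l//.
  by apply: hM => //; rewrite ltrDl.
have e20 : 0 < e / 2 by rewrite divr_gt0.
have in_e v : sphere R n v -> [set t | 0 <= t /\ Q (t *: v)] (e / 2).
  move=> Sv; split; first exact: ltW.
  apply: eQ; rewrite -ball_normE/= sub0r normrN; apply: le_lt_trans (norm_le_enorm _) _.
  rewrite enormZ ger0_norm ?ltW//; have -> : enorm v = 1 := Sv.
  by rewrite mulr1; lra.
exists (e / 2), r1; split => // v Sv; apply/andP; split.
  by apply: ub_le_sup; [exists r1; exact: ub|exact: in_e].
by apply: ge_sup; [exists (e / 2); exact: in_e|exact: ub].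
Qed.

Lemma star_body_weight (R : realType) m (Q : set 'rV[R]_m.+1) (a : R) : star_body_o Q ->
  exists w0 w1, bounded_weight (fun v => radial Q v `^ a) w0 w1.
Proof.
move=> [cQ _ iQ cr]; have [r0 [r1 [r00 hr]]] := star_radial_bounds cQ iQ.
have [w0 [w1 [w00 hw]]] := powR_bounds a r1 r00.
exists w0, w1; split; [exact: w00|by move=> v Sv; exact: hw (hr v Sv)|].
exact: (@measurableT_comp _ _ _ (caratheodory_type (@hausdorff_outer R m.+1 m)) _ _ _
  (sphere R m.+1) (radial Q) (measurable_powR a) (measurable_fun_within cr)).
Qed.

Theorem theorem6p8 (R : realType) (n : nat) (p q : R) (Q : set 'rV[R]_n)
    (mu : {finite_measure set (borel_rV R n) -> \bar R})
    (hn : (2 <= n)%N) (hp : 1 < p) (hq : 0 < q)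
    (hQ : star_body_o Q)
    (hmu : discrete_on_sphere mu)
    (hmu_hemi : forall u : 'rV[R]_n,
       sphere R n u -> ~ concentrated_on mu (closed_hemisphere u)) :
  exists P : set 'rV[R]_n,
    [/\ polytope P,
        convex_body_o P &
        forall eta : set (borel_rV R n),
          measurable eta -> eta `<=` sphere R n ->
          ((dualV q P Q)^-1 * dualC_pq p q P Q eta)%E = mu eta].
Proof.
destruct n as [|m]; first by [].
have m0 : (0 < m)%N by [].
have [k [u [alpha [u_inj u_unit alpha0 muE]]]] := discrete_measure_repr hmu.
have u_span v : sphere R m.+1 v -> exists i, 0 < dot v (u i).
  (* If no atom had a positive product with [v], all of them would lie in the closed hemisphere of
     [- v]. *)
  move=> Sv; apply: contrapT => h; have SNv : sphere R m.+1 (- v).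
    by rewrite /sphere/= enormN; exact: Sv.
  apply: (hmu_hemi _ SNv); rewrite /concentrated_on muE; last first.
    apply: measurableC; apply: borel_closed; apply: closedI; first exact: closed_sphere.
    have : closed ((dot^~ (- v)) @^-1` [set t : R | 0 <= t]).
      by apply: closed_comp => [x _|]; [exact: continuous_dotl|exact: closed_ge].
    exact.
  rewrite big1// => i _; rewrite diracE memNset ?mule0// => nh; apply: nh.
  split; first exact: u_unit.
  rewrite dotNr oppr_ge0 dotC leNgt; apply/negP => vi; apply: h; by exists i.
pose w v := radial Q v `^ (m.+1%:R - q).
have [w0 [w1 ww]] := star_body_weight (m.+1%:R - q) hQ.
rewrite -/w in ww.
have [z [z0' z1 zmax]] := exists_maximizer u_span hq hp ww alpha0.
have z0 := maximizer_gt0 m0 u_unit u_span hq hp ww alpha0 z0' z1 zmax.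
have facet := wvol_facet m0 u_unit u_span u_inj hq hp ww alpha0 z0' z1 zmax.
have V0 := wvolS_max_gt0 m0 u_unit u_span hq hp ww alpha0 zmax.
set V := fine _ in V0 facet.
pose P := polyhedron u z.
have dualVE : dualV q P Q = (m.+1%:R^-1 * V)%:E.
  rewrite EFinM (wvolSE u_span hq ww z0') wvol.unlock.
  by [].
have mF i := measurable_facet_cone u_span i z0'.
have FS i : facet_cone u z i `<=` sphere R m.+1 by move=> v [].
have Ffin i := wvol_fin u_span hq ww z0' (mF i) (@FS i).
have c0 i : 0 <= m.+1%:R^-1 * (alpha i * z i `^ p * V).
  by rewrite mulr_ge0// ltW// mulr_gt0// mulr_gt0// powR_gt0.
pose c i : {nonneg R} := NngNum (c0 i).
(* Proved for every set [eta], measurable or not, since the integrator is replaced as a function. *)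
have dualCE : dualC q P Q = (fun eta : set (borel_rV R m.+1) =>
    \sum_i (c i)%:num%:E * \d_(u i : borel_rV R m.+1) eta)%E.
  apply/funext => eta.
  have -> : dualC q P Q eta = ((m.+1%:R^-1)%:E * wvol u w q z (alpha_star P eta))%E.
    by rewrite wvol.unlock.
  rewrite (@wvol_cones R m k u w q w0 w1 u_span ww z (fun i => u i \in eta)
    (alpha_star P eta) u_unit u_inj z0).
  - rewrite [in LHS]big_mkcond/= ge0_sume_distrr => [|i _]; last first.
      by case: ifP => // _; apply: (wvol_ge0 u q ww); exact: FS.
    apply: eq_bigr => i _; rewrite diracE.
    case: ifPn => _; last by rewrite !mule0.
    by rewrite mule1 -(fineK (Ffin i)) facet -EFinM.
  - by move=> v [].
  - move=> v Sv nr; split=> [[_ [y [Sy ey fy]]]|[i /set_mem ei Ci]]; last first.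
      exact: (facet_cone_alpha_star u_unit u_span z0 Ci ei).
    have [i _ vi] := radial_tight u_span z0' Sv.
    have Ci : facet_cone u z i v by [].
    exists i => //; apply/mem_set.
    by rewrite -(facet_normal_unique u_unit u_span Sv Sy Ci nr fy).
exists P; split.
- exact: (polytope_polyhedron u_unit u_span z0).
- exact: (convex_body_polyhedron u_unit u_span z0).
move=> eta meta _.
rewrite /dualC_pq dualCE integral_sum_dirac//; last 2 first.
- exact: (measurable_supportf u_span z0).
- by move=> y _; rewrite lee_fin powR_ge0.
have nV : m.+1%:R^-1 * V != 0 by rewrite gt_eqF// mulr_gt0.
have -> : (\sum_i (c i)%:num%:E * (\d_(u i : borel_rV R m.+1) eta * (supportf P (u i) `^ - p)%:E) =
    (m.+1%:R^-1 * V)%:E * mu eta)%E.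
  rewrite muE// ge0_sume_distrr => [|i _]; last by rewrite mule_ge0// lee_fin ltW.
  apply: eq_bigr => i _.
  (* The facet integral is positive, so the cone is nonempty and the support function at [u i] is
     [z i]. *)
  have [v Cv] : exists v, facet_cone u z i v.
    apply: contrapT => h; have F0 : facet_cone u z i = set0.
      by rewrite -subset0 => v Cv; apply: h; exists v.
    have := facet i; rewrite F0 wvol.unlock integral_set0/= => /eqP.
    by rewrite lt_eqF// mulr_gt0// mulr_gt0// powR_gt0.
  rewrite (supportf_facet u_span z0 Cv) powRN diracE /=.
  case: (_ \in _); last by rewrite !mul0e !mule0.
  rewrite mul1e mule1 -!EFinM; congr EFin.
  have zp : z i `^ p != 0 by rewrite gt_eqF// powR_gt0.
  by move: zp; move: (z i `^ p) (m.+1%:R^-1) => a N a0; field.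
rewrite dualVE muleA mulVe ?mul1e//.
Qed.
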